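(* Let $n\geq1$ and suppose that either (a) $\lambda_1=\cdots=\lambda_n=C=1$, $\alpha<0$ and $A>0$; or (b) $\lambda_1=\cdots=\lambda_m=1$ and $\lambda_{m+1}=\cdots=\lambda_n=-1$ for some $1\leq m<n$, $C=1$, $A>0$, and $\alpha\in\mathbb{R}$. Consider smooth solutions $w_1,\ldots,w_n$ (with values in $\mathbb{C}\setminus\{0\}$) and $\theta$ (with values in $\mathbb{R}$ or $\mathbb{R}/2\pi\mathbb{Z}$) of $$(1)\qquad \frac{dw_j}{ds}=\lambda_je^{i\theta(s)}\,\overline{w_1\cdots w_{j-1}w_{j+1}\cdots w_n},\quad j=1,\ldots,n,\qquad \frac{d\theta}{ds}=\alpha\,\mathrm{Im}\bigl(e^{-i\theta(s)}w_1\cdots w_n\bigr)$$ with first integral $A$, and the associated functions $u,\phi_j,\phi$, constants $\alpha_j$ and submanifold $L$ (see context). Then solutions exist for all $s\in\mathbb{R}$, and we take $I=\mathbb{R}$. In each of cases (a), (b) divide into two subcases: (i) $\sum_{j=1}^n\frac{\lambda_j}{\alpha_j}+\alpha=0$ and $\alpha_1\cdots\alpha_n=A^2$; or (ii) otherwise. In case (i), the equations have explicit solutions, and for some $\psi_1,\ldots,\psi_n\in\mathbb{R}$ one obtains $$L=\Bigl\{\bigl(x_1\sqrt{\alpha_1}\,e^{i(\psi_1-\lambda_1As/\alpha_1)},\ldots,x_n\sqrt{\alpha_n}\,e^{i(\psi_n-\lambda_nAs/\alpha_n)}\bigr):x_1,\ldots,x_n\in\mathbb{R},\ s\in\mathbb{R},\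 \sum_{j=1}^n\lambda_jx_j^2=1\Bigr\},$$ which is Hamiltonian stationary in addition to being self-similar, and invariant under a subgroup $\mathbb{R}$ or $\mathrm{U}(1)$ of diagonal matrices $\bigl\{\mathrm{diag}(e^{i\lambda_1t/\alpha_1},\ldots,e^{i\lambda_nt/\alpha_n}):t\in\mathbb{R}\bigr\}$ in $\mathrm{U}(n)$. In case (ii), $u$ and $\phi-\theta$ are periodic in $s$ with period $S>0$, and $$u(s+S)=u(s),\quad \phi_j(s+S)=\phi_j(s)+\gamma_j,\quad \phi(s+S)=\phi(s)+\sum_{j=1}^n\gamma_j,\quad \theta(s+S)=\theta(s)+\sum_{j=1}^n\gamma_j,$$ for some $\gamma_1,\ldots,\gamma_n\in\mathbb{R}$ and all $s\in\mathbb{R}$. In case (b) with $\alpha=0$ we have $\theta(s)\equiv\theta(0)$ and $\sum_{j=1}^n\gamma_j=0$.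
   Context: Notation: given a solution of (1) on an open interval $I$, write $w_j=r_je^{i\phi_j}$ with $r_j>0$ and $\phi_j$ real-valued smooth ($\theta$ is likewise lifted to a real-valued function), $\phi=\sum_{j=1}^n\phi_j$, fix $s_0\in I$, and set $\alpha_j=r_j(s_0)^2$, $$u(s)=2\int_{s_0}^sr_1(t)\cdots r_n(t)\cos(\phi(t)-\theta(t))\,dt,\qquad Q(u)=\prod_{j=1}^n(\alpha_j+\lambda_ju).$$ Then $r_j^2=\alpha_j+\lambda_ju$ on $I$ and $Q(u)^{1/2}e^{\alpha u/2}\sin(\phi-\theta)$ is a constant, denoted $A$. The associated submanifold is $$L=\Bigl\{\bigl(x_1w_1(s),\ldots,x_nw_n(s)\bigr):s\in I,\ x_j\in\mathbb{R},\ \sum_{j=1}^n\lambda_jx_j^2=C\Bigr\}\subset\mathbb{C}^n,$$ an immersed Lagrangian submanifold (immersed via $(x,s)\mapsto(x_1w_1(s),\ldots,x_nw_n(s))$) with Lagrangian angle $\theta(s)$. Here Lagrangian is with respect to $\omega=\sum_jdx_j\wedge dy_j$, and the Lagrangian angle $\theta$ is defined by $dz_1\wedge\cdots\wedge dz_n|_L=e^{i\theta}\mathrm{vol}_L$. A Lagrangian is Hamiltonian stationary if its Lagrangian angle is harmonic on $L$ (for the induced metric). Self-similar means $H\equiv cF^\perp$ for some constant $c\in\mathbb{R}$, where $H$ is the mean curvature vector and $F^\perp$ the normal part of the position vector. ''Solutions exist for all $s\in\mathbb{R}$'' means every solution on an open interval $I$ extends to $\mathbb{R}$. Empty products are $1$.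 *)

(* Defs.v *)
From mathcomp Require Import all_boot all_order all_algebra.
From mathcomp Require Import all_classical all_reals all_analysis.
From mathcomp Require Export complex.

Set Implicit Arguments.
Unset Strict Implicit.
Unset Printing Implicit Defensive.

Import Order.TTheory GRing.Theory Num.Theory.
Import numFieldNormedType.Exports.

Local Open Scope classical_set_scope.
Local Open Scope ring_scope.
Local Open Scope complex_scope.

(* [Re] and [Im] of ring_scope are R[i]-valued; these are the R-valued ones. *)
Notation Rpart := complex.Re.
Notation Ipart := complex.Im.

Section OneVariable.
Context {R : realType}.

Definition expi (t : R) : R[i] := cos t +i* sin t.

Definition smooth_on1 (I : set R) (f : R -> R) : Prop :=
  forall (k : nat) (s : R), I s -> derivable (derive1n k f) s 1.

Definition Csmooth_on1 (I : set R) (f : R -> R[i]) : Prop :=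
  smooth_on1 I (fun s => Rpart (f s)) /\ smooth_on1 I (fun s => Ipart (f s)).

Definition Cderive1 (f : R -> R[i]) (s : R) : R[i] :=
  derive1 (fun t => Rpart (f t)) s +i* derive1 (fun t => Ipart (f t)) s.

(* Oriented integral: also meaningful when b < a. *)
Definition oint (a b : R) (f : R -> R) : R :=
  if a <= b then \int[lebesgue_measure]_(t in `[a, b]) f t
  else - \int[lebesgue_measure]_(t in `[b, a]) f t.

End OneVariable.

Section System.
Context {R : realType} {n : nat}.
Implicit Types (I : set R) (lam : 'I_n -> R) (alpha s t A : R).
Implicit Types (w : 'I_n -> R -> R[i]) (theta : R -> R) (phi : 'I_n -> R -> R).

(* theta is the real-valued lift of the angle. *)
Definition solution I lam alpha w theta : Prop :=
  [/\ forall j, Csmooth_on1 I (w j),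
      smooth_on1 I theta,
      forall j s, I s -> w j s != 0,
      forall j s, I s ->
        Cderive1 (w j) s =
        (lam j)%:C * expi (theta s) * (\prod_(k | k != j) w k s)^*%C
    & forall s, I s ->
        derive1 theta s = alpha * Ipart (expi (- theta s) * \prod_j w j s)].

Definition radius w (j : 'I_n) s : R := Normc.normc (w j s).

(* w_j = r_j e^{i phi_j} with phi_j a smooth real-valued lift. *)
Definition polar_lift I w phi : Prop :=
  (forall j, smooth_on1 I (phi j)) /\
  (forall j s, I s -> w j s = (radius w j s)%:C * expi (phi j s)).

Definition phi_sum phi s : R := \sum_j phi j s.

Definition alphas w (s0 : R) (j : 'I_n) : R := radius w j s0 ^+ 2.

Definition ufun w theta phi (s0 s : R) : R :=
  2 * oint s0 s (fun t => \prod_j radius w j t * cos (phi_sum phi t - theta t)).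

Definition Qfun lam w (s0 v : R) : R := \prod_j (alphas w s0 j + lam j * v).

Definition first_integral I lam alpha w theta phi (s0 A : R) : Prop :=
  forall s, I s ->
    Num.sqrt (Qfun lam w s0 (ufun w theta phi s0 s)) *
    expR (alpha * ufun w theta phi s0 s / 2) *
    sin (phi_sum phi s - theta s) = A.

Definition case_a lam (C alpha A : R) : Prop :=
  [/\ forall j, lam j = 1, C = 1, alpha < 0 & 0 < A].

(* Indices are shifted: j = 0, ..., m - 1 carry +1. *)
Definition case_b lam (C A : R) : Prop :=
  exists m : nat,
    [/\ (1 <= m < n)%N, forall j : 'I_n, lam j = if (j < m)%N then 1 else -1,
        C = 1 & 0 < A].

Definition case_i lam alpha w (s0 A : R) : Prop :=
  \sum_j lam j / alphas w s0 j + alpha = 0 /\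
  \prod_j alphas w s0 j = A ^+ 2.

Definition L_map w (x : 'rV[R]_n) s : 'rV[R[i]]_n :=
  \row_j ((x 0 j)%:C * w j s).

Definition quadric lam (C : R) : set 'rV[R]_n :=
  [set x | \sum_j lam j * x 0 j ^+ 2 = C].

Definition L_set I lam (C : R) w : set 'rV[R[i]]_n :=
  [set z | exists x s, [/\ quadric lam C x, I s & z = L_map w x s]].

End System.

(** Geometry of immersions into C^n through local parametrizations
    Phi : U -> C^n, with U open in R^n. *)

Section Geometry.
Context {R : realType} {n : nat}.
Implicit Types (U : set 'rV[R]_n) (f : 'rV[R]_n -> R) (p : 'rV[R]_n).
Implicit Types (Phi : 'rV[R]_n -> 'rV[R[i]]_n) (v z : 'rV[R[i]]_n).

Definition partial (a : 'I_n) f p : R := 'D_(delta_mx 0 a) f p.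

(* All iterated partial derivatives exist and are differentiable on U. *)
Definition smooth_on U f : Prop :=
  forall (l : seq 'I_n) p, U p -> differentiable (foldr partial f l) p.

Definition Cpartial (a : 'I_n) Phi p : 'rV[R[i]]_n :=
  \row_k (partial a (fun q => Rpart (Phi q 0 k)) p
          +i* partial a (fun q => Ipart (Phi q 0 k)) p).

Definition inner v z : R :=
  \sum_k (Rpart (v 0 k) * Rpart (z 0 k) + Ipart (v 0 k) * Ipart (z 0 k)).

(* The form sum_k dx_k /\ dy_k. *)
Definition omega v z : R :=
  \sum_k (Rpart (v 0 k) * Ipart (z 0 k)
          - Ipart (v 0 k) * Rpart (z 0 k)).

Definition Cjacobian Phi p : 'M[R[i]]_n := \matrix_(a, k) Cpartial a Phi p 0 k.

Definition gram Phi p : 'M[R]_n :=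
  \matrix_(a, b) inner (Cpartial a Phi p) (Cpartial b Phi p).

Definition vol Phi p : R := Num.sqrt (\det (gram Phi p)).

Definition normal_part Phi p v : 'rV[R[i]]_n :=
  v - \sum_a \sum_b
        (invmx (gram Phi p) a b * inner v (Cpartial a Phi p))%:C
        *: Cpartial b Phi p.

(* Trace, for the induced metric, of the second fundamental form. *)
Definition mean_curvature Phi p : 'rV[R[i]]_n :=
  \sum_a \sum_b (invmx (gram Phi p) a b)%:C
                *: normal_part Phi p (Cpartial a (Cpartial b Phi) p).

(* Laplace-Beltrami operator of the induced metric. *)
Definition laplacian Phi f p : R :=
  (vol Phi p)^-1 *
  \sum_a partial a
    (fun q => vol Phi q * \sum_b invmx (gram Phi q) a b * partial b f q) p.

(* An immersed n-dimensional submanifold is given by the collection of all its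
   local parametrizations: [P U Phi] means that Phi : U -> C^n is one. *)
Definition params := set 'rV[R]_n -> ('rV[R]_n -> 'rV[R[i]]_n) -> Prop.

Implicit Type P : params.

Definition immersed P : Prop :=
  forall U Phi p, P U Phi -> U p ->
    row_free (row_mx (map_mx (@complex.Re R) (Cjacobian Phi p))
                     (map_mx (@complex.Im R) (Cjacobian Phi p))).

Definition lagrangian P : Prop :=
  immersed P /\
  forall U Phi p a b, P U Phi -> U p ->
    omega (Cpartial a Phi p) (Cpartial b Phi p) = 0.

(* ang is a lift over V of the Lagrangian angle: the equation
   dz_1 /\ ... /\ dz_n = e^{i ang} vol, evaluated on the coordinate frame.
   A parametrization reversing a chosen orientation shifts ang by pi. *)
Definition lagrangian_angle Phi (V : set 'rV[R]_n) (ang : 'rV[R]_n -> R) : Prop :=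
  smooth_on V ang /\
  forall q, V q -> \det (Cjacobian Phi q) = expi (ang q) * (vol Phi q)%:C.

(* The Lagrangian angle takes values in R / 2 pi Z; it is harmonic when it has,
   near each point, a harmonic real-valued lift (two local lifts differ by a
   locally constant function). *)
Definition hamiltonian_stationary P : Prop :=
  lagrangian P /\
  forall U Phi p, P U Phi -> U p ->
    exists (V : set 'rV[R]_n) (ang : 'rV[R]_n -> R),
      [/\ open V, V p, V `<=` U, lagrangian_angle Phi V ang
        & forall q, V q -> laplacian Phi ang q = 0].

Definition self_similar P : Prop :=
  immersed P /\
  exists c : R, forall U Phi p, P U Phi -> U p ->
    mean_curvature Phi p = c%:C *: normal_part Phi p (Phi p).

(* Local parametrizations of L: compositions of (x, s) |-> L_map w x s with the
   local parametrizations (X, sigma) of the n-manifold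
   quadric lam C * I inside R^n * R. *)
Definition L_params (I : set R) (lam : 'I_n -> R) (C : R)
    (w : 'I_n -> R -> R[i]) : params :=
  fun U Phi => open U /\
    exists (X : 'rV[R]_n -> 'rV[R]_n) (sigma : 'rV[R]_n -> R),
      [/\ forall j, smooth_on U (fun p => X p 0 j),
          smooth_on U sigma,
          forall p, U p -> quadric lam C (X p) /\ I (sigma p),
          forall p, U p ->
            row_free (row_mx (\matrix_(a, j) partial a (fun q => X q 0 j) p)
                             (\col_a partial a sigma p))
        & Phi = fun p => L_map w (X p) (sigma p)].

End Geometry.

Section Groups.
Context {R : realType} {n : nat}.
Implicit Type G : set 'M[R[i]]_n.

Definition diag_flow (b : 'I_n -> R) (t : R) : 'M[R[i]]_n :=
  diag_mx (\row_j expi (b j * t)).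

Definition subgroup_of_Un G : Prop :=
  [/\ forall M, G M -> M \is unitarymx,
      G 1%:M,
      forall M N, G M -> G N -> G (M *m N)
    & forall M, G M -> G (invmx M)].

Definition Ccontinuous_mx (f : R -> 'M[R[i]]_n) : Prop :=
  forall j k, continuous (fun t => Rpart (f t j k)) /\
              continuous (fun t => Ipart (f t j k)).

(* Isomorphisms onto an immersed, not necessarily closed, Lie subgroup: the
   inverse need not be continuous for the subspace topology. *)
Definition isomorphic_to_R G : Prop :=
  exists f : R -> 'M[R[i]]_n,
    [/\ Ccontinuous_mx f, forall s t, f (s + t) = f s *m f t,
        injective f & range f = G].

Definition isomorphic_to_U1 G : Prop :=
  exists f : R[i] -> 'M[R[i]]_n,
    [/\ Ccontinuous_mx (fun t => f (expi t)),
        forall z z', `|z| = 1 -> `|z'| = 1 -> f (z * z') = f z *m f z',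
        forall z z', `|z| = 1 -> `|z'| = 1 -> f z = f z' -> z = z'
      & f @` [set z | `|z| = 1] = G].

Definition invariant_under G (L : set 'rV[R[i]]_n) : Prop :=
  forall M, G M -> [set z *m M | z in L] = L.

End Groups.

(* Main.v *)
Require Import Defs.
From mathcomp Require Import all_boot all_order all_algebra.
From mathcomp Require Import all_classical all_reals all_analysis.
From mathcomp Require Import perm ring lra.

Set Implicit Arguments.
Unset Strict Implicit.
Unset Printing Implicit Defensive.

Import Order.TTheory GRing.Theory Num.Theory.
Import numFieldNormedType.Exports.

Local Open Scope classical_set_scope.
Local Open Scope ring_scope.
Local Open Scope complex_scope.

(** Write w_j = r_j e^{i phi_j} and psi = phi - theta. Then r_j^2 = al_j + lam_j u and
    u' = 2 Q(u)^{1/2} cos(psi), while A = Q(u)^{1/2} e^{alpha u / 2} sin(psi). Eliminating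
    psi shows that u moves like a particle on a line,

      u'' = F(u),    u'^2 = f(u),    f(u) = 4 (Q(u) - A^2 e^{-alpha u}),    F = f' / 2,

    whose force F is smooth on all of R because Q is a polynomial (solution_newton).
    All other unknowns are recovered from u by quadratures: phi_j' and theta' are
    functions of u.

    The hypotheses provide points a < 0 < b with f(a), f(b) < 0 such that every factor
    al_j + lam_j x of Q is positive between them (barriers). As f(u) = u'^2 >= 0, u can
    never reach a or b. Cutting F off outside [a, b] makes it bounded and Lipschitz, so
    Picard iteration gives a motion for all times (newton_exists, confined_exists);
    Gronwall's inequality identifies it with u on the given interval, and the solution
    rebuilt from it is the extension (rebuilt_solution, extend_solution).

    A rest point m is a common zero of f and F. It satisfies Q(m) = A^2 e^{-alpha m} and
    sum_j lam_j / (al_j + lam_j m) + alpha = 0. Since log Q(x) + alpha x is strictly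
    concave, f < 0 elsewhere between a and b, so the motion is then constantly m
    (rest_point_unique). For m = 0 these two equations are exactly case_i.

    If they fail, the motion has two turning times: otherwise it would be monotone from
    some time on and tend to a rest point (two_turning_points). The equation is
    reversible, so u is symmetric about each turning time, and hence periodic
    (newton_periodic). Then phi_j and theta increase by constants over a period, and psi
    does not change, because it stays in an interval where the sine is positive.

    If they hold, then u = 0 by uniqueness, and w_j = al_j^{1/2} e^{i (psi_j - kap_j s)}
    with kap_j = lam_j A / al_j. On L the forms dx_k + kap_k x_k ds are an orthogonal
    coframe with squared lengths 1 / al_k, because the cross terms vanish on the tangent
    space of the quadric. In this coframe the following can be computed directly.
    The complex Jacobian determinant is e^{i theta} times a real number
    (det_Cjacobian), so theta is the Lagrangian angle. The mean curvature vector is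
    alpha times the normal part of the position (Phi_self_similar). Finally theta is
    affine in s, and the density times the gradient of s is a combination of cofactors
    of the Jacobian matrix of the functions e^{kap_k s} x_k, so its divergence vanishes
    by the Piola identity and the invariance of the x_k under the symmetry
    s -> s + t (Phi_stationary). This symmetry is the diagonal flow. Its kernel is
    trivial or generated by a least period, which makes the group a copy of R or of
    U(1) (flow_isomorphic). *)

(** * Differentiation rules along a direction *)

Section DirectionalRules.
Context {R : realType} {V : normedModType R}.
Implicit Types (x v : V) (f g : V -> R) (df dg : R).

(** The rules are stated on pointwise expressions, so that the derivative of a
    formula is a composition of terms that follows its syntax. *)
Lemma der_eq x v f df dg : is_derive x v f df -> df = dg -> is_derive x v f dg.
Proof. by move=> Hf <-. Qed.

Lemma der_cst x v (c : R) : is_derive x v (fun=> c) 0.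
Proof. exact: is_derive_cst. Qed.

Lemma der_add x v f g df dg : is_derive x v f df -> is_derive x v g dg ->
  is_derive x v (fun t => f t + g t) (df + dg).
Proof. by move=> *; exact: is_deriveD. Qed.

Lemma der_opp x v f df : is_derive x v f df ->
  is_derive x v (fun t => - f t) (- df).
Proof. by move=> *; exact: is_deriveN. Qed.

Lemma der_mul x v f g df dg : is_derive x v f df -> is_derive x v g dg ->
  is_derive x v (fun t => f t * g t) (df * g x + f x * dg).
Proof.
move=> Hf Hg; rewrite addrC [df * _]mulrC.
exact: (@is_deriveM _ _ f g x v df dg).
Qed.

Lemma der_mulc x v f df (c : R) : is_derive x v f df ->
  is_derive x v (fun t => c * f t) (c * df).
Proof.
by move=> Hf; have := der_mul (der_cst x v c) Hf; rewrite mul0r add0r.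
Qed.

Lemma der_exp x v f df (k : nat) : is_derive x v f df ->
  is_derive x v (fun t => f t ^+ k) (k%:R * f x ^+ k.-1 * df).
Proof.
move=> Hf; have -> : (fun t => f t ^+ k) = f ^+ k.
  by apply: funext => t; rewrite exprfctE.
exact: (@is_deriveX _ _ f k x v df).
Qed.

Lemma der_sum n x v (f : 'I_n -> V -> R) (df : 'I_n -> R) :
  (forall i, is_derive x v (f i) (df i)) ->
  is_derive x v (fun t => \sum_i f i t) (\sum_i df i).
Proof.
move=> H; have -> : (fun t => \sum_i f i t) = \sum_i f i.
  by apply: funext => t; rewrite fct_sumE.
exact: is_derive_sum.
Qed.

(** Along the line t -> f (x + t v) this is the chain rule in one variable. *)
Lemma der_comp x v f df (h : R -> R) dh : is_derive x v f df ->
  is_derive (f x) 1 h dh -> is_derive x v (fun t => h (f t)) (dh * df).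
Proof.
move=> Hf Hh.
have /derivable1P df1 : derivable f x v by apply: ex_derive.
have dh1 : derivable h (f x) 1 by apply: ex_derive.
pose g (t : R) := f (t *: v + x).
have g0 : g 0 = f x by rewrite /g scale0r add0r.
have dg : derivable g 0 1 by [].
have dgE : derive1 g 0 = df.
  have <- : 'D_v f x = df by apply: derive_val.
  rewrite derive1E /derive; congr (lim _).
  rewrite /g scale0r add0r.
  by congr ((fun F => F @ 0^') _); apply: funext => t /=; rewrite addr0 [t *: 1]mulr1.
have dhg : derivable (h \o g) 0 1.
  apply/derivable1_diffP; apply: differentiable_comp; first exact/derivable1_diffP.
  by rewrite g0; apply/derivable1_diffP.
split.
  by apply/derivable1P.
have -> : 'D_v (fun t => h (f t)) x = derive1 (h \o g) 0.
  rewrite derive1E /derive; congr (lim _).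
  rewrite /comp /g scale0r add0r.
  by congr ((fun F => F @ 0^') _); apply: funext => t /=; rewrite addr0 [t *: 1]mulr1.
rewrite derive1_comp ?g0 // dgE; congr (_ * _).
by rewrite derive1E; apply: derive_val.
Qed.

Lemma der_near x v f g df : (\forall y \near x, f y = g y) ->
  is_derive x v f df -> is_derive x v g df.
Proof. by move=> fg; exact: near_eq_is_derive. Qed.

Lemma der_ext x v f g df : f =1 g -> is_derive x v f df -> is_derive x v g df.
Proof. by move=> /funext ->. Qed.

Lemma der_unique x v f df dg : is_derive x v f df -> is_derive x v f dg -> df = dg.
Proof. by move=> [_ <-] [_ <-]. Qed.

Lemma der_inv x v f df : f x != 0 -> is_derive x v f df ->
  is_derive x v (fun t => (f t)^-1) (- (f x)^-2 * df).
Proof.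
by move=> fx0 [fxv <-]; split; [exact: derivableV|rewrite deriveV].
Qed.

Lemma der_expR x v f df : is_derive x v f df ->
  is_derive x v (fun t => expR (f t)) (expR (f x) * df).
Proof. by move=> Hf; apply: der_comp; apply: is_derive_expR. Qed.

Lemma der_cos x v f df : is_derive x v f df ->
  is_derive x v (fun t => cos (f t)) (- sin (f x) * df).
Proof. by move=> Hf; apply: der_comp; apply: is_derive_cos. Qed.

Lemma der_sin x v f df : is_derive x v f df ->
  is_derive x v (fun t => sin (f t)) (cos (f x) * df).
Proof. by move=> Hf; apply: der_comp; apply: is_derive_sin. Qed.

Lemma der_sqrt x v f df : 0 < f x -> is_derive x v f df ->
  is_derive x v (fun t => Num.sqrt (f t)) ((2 * Num.sqrt (f x))^-1 * df).
Proof. by move=> fx0 Hf; apply: der_comp; apply: is_derive1_sqrt. Qed.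

End DirectionalRules.

Lemma derive1_der {R : realType} (f : R -> R) (x df : R) : is_derive x 1 f df -> derive1 f x = df.
Proof. by move=> H; rewrite derive1E; apply: derive_val. Qed.

Lemma der_derive1 {R : realType} (f : R -> R) (x : R) :
  derivable f x 1 -> is_derive x 1 f (derive1 f x).
Proof. by move=> H; rewrite derive1E; exact/derivableP. Qed.

Lemma der_continuous1 {R : realType} (f : R -> R) (x df : R) : is_derive x 1 f df -> {for x, continuous f}.
Proof. by move=> Hf; apply: differentiable_continuous; apply/derivable1_diffP; apply: ex_derive. Qed.

(** * Functions on intervals and antiderivatives *)

Section Intervals.
Context {R : realType}.
Implicit Types (I : set R) (f df : R -> R) (s t : R).

Lemma continuous_segment f x y :
  (forall z, x <= z <= y -> {for z, continuous f}) ->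
  {within `[x, y], continuous f}.
Proof.
move=> cf; apply: continuous_in_subspaceT => z /set_mem /=.
by rewrite in_itv /=; exact: cf.
Qed.

Lemma nondecr_on I f df s t : is_interval I ->
  (forall z, I z -> is_derive z 1 f (df z)) -> (forall z, s <= z <= t -> 0 <= df z) ->
  I s -> I t -> s <= t -> f s <= f t.
Proof.
move=> itvI dfI df0 Is It st.
have inI z : s <= z <= t -> I z by exact: itvI.
have [||c] := @MVT_segment _ f df s t st.
- by move=> z; rewrite in_itv /= => /andP[sz zt]; apply/dfI/inI; rewrite !ltW.
- by apply: continuous_segment => z /inI/dfI; exact: der_continuous1.
rewrite in_itv /= => ct E; rewrite -subr_ge0 E mulr_ge0 ?subr_ge0 //; exact: df0.
Qed.

Lemma cst_on I f s t : is_interval I ->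
  (forall z, I z -> is_derive z 1 f 0) -> I s -> I t -> f s = f t.
Proof.
move=> itvI dfI.
have key x y : I x -> I y -> x <= y -> f x = f y.
  move=> Ix Iy xy; apply/eqP; rewrite eq_le; apply/andP; split.
    exact: (@nondecr_on I f (fun=> 0)).
  rewrite -lerN2; apply: (@nondecr_on I (fun z => - f z) (fun=> -0)) => // z.
    by move=> /dfI; exact: der_opp.
by move=> Is It; have [st|/ltW ts] := leP s t; [exact: key|apply/esym/key].
Qed.

Lemma intervalT : is_interval [set: R]. Proof. by []. Qed.

Lemma open_nbhs_in I s : open I -> I s -> \forall t \near s, I t.
Proof. by move=> oI Is; exact: open_nbhs_nbhs. Qed.

Lemma open_interval_room I s : open I -> I s -> exists2 e : R, 0 < e & I (s - e) /\ I (s + e).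
Proof.
move=> oI Is; have /nbhs_ballP [e /= e0 He] := open_nbhs_in oI Is.
exists (e / 2); first by rewrite divr_gt0.
by split; apply: He; rewrite /ball /= ?opprB ?opprD ?addrA ?subrr ?add0r ?[_ - s]addrC ?addrA ?addNr ?add0r ?addrCA ?addrA ?subrr ?addr0 ?add0r ?normrN gtr0_norm ?divr_gt0 // ltr_pdivrMr // ltr_pMr // ltr1n.
Qed.

(** Near s, either orientation of the integral is the difference of two values of
    the primitive based at a point c of I to the left of both s0 and s. *)
Lemma oint_der I f s0 s : open I -> is_interval I -> I s0 -> I s ->
  (forall z, I z -> {for z, continuous f}) ->
  is_derive s 1 (fun t => oint s0 t f) (f s).
Proof.
move=> oI itvI Is0 Is cf.
have [e e0 [Iml Imr]] : exists2 e : R, 0 < e & I (Num.min s0 s - e) /\ I (Num.max s0 s + e).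
  have [e1 e10 [Il _]] : exists2 e : R, 0 < e & I (Num.min s0 s - e) /\ I (Num.min s0 s + e).
    by apply: open_interval_room => //; case: (leP s0 s).
  have [e2 e20 [_ Ir]] : exists2 e : R, 0 < e & I (Num.max s0 s - e) /\ I (Num.max s0 s + e).
    by apply: open_interval_room => //; case: (leP s0 s).
  exists (Num.min e1 e2); first by rewrite lt_min e10.
  have Im : I (Num.min s0 s) by case: (leP s0 s).
  have IM : I (Num.max s0 s) by case: (leP s0 s).
  have E0 : 0 < Num.min e1 e2 by rewrite lt_min e10.
  have E1 : Num.min e1 e2 <= e1 by rewrite ge_min lexx.
  have E2 : Num.min e1 e2 <= e2 by rewrite ge_min lexx orbT.
  move: (Num.min e1 e2) E0 E1 E2 => e E0 E1 E2.
  by split; [apply: itvI Il Im _ _|apply: itvI IM Ir _ _]; lra.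
set c := Num.min s0 s - e in Iml; set d := Num.max s0 s + e in Imr.
have cd : c < d.
  by rewrite /c /d; have [] := leP s0 s => ?; lra.
have cdI z : c <= z <= d -> I z by exact: itvI.
have c0 : c < s0 < d by rewrite /c /d; have [] := leP s0 s => ?; lra.
have cs : c < s < d by rewrite /c /d; have [] := leP s0 s => ?; lra.
have intf x y : c <= x -> y <= d ->
    (@lebesgue_measure R).-integrable `[x, y] (EFin \o f).
  move=> cx yd; apply: continuous_compact_integrable; first exact: segment_compact.
  apply: continuous_segment => z /andP[xz zy]; apply/cf/cdI.
  by rewrite (le_trans cx) //= (le_trans zy).
pose G t := \int[lebesgue_measure]_(x in `[c, t]) f x.
have GB x y : c <= x -> x <= y -> y <= d ->
    \int[lebesgue_measure]_(t in `[x, y]) f t = G y - G x.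
  move=> cx xy yd; rewrite /G Rintegral_itvB; last 1 first.
  - by [].
  - rewrite Rintegral_itv_obnd_cbnd //.
    apply: integrableS (intf x y cx yd) => //.
    by apply: subset_itvr; rewrite bnd_simp.
  - exact: intf.
  - by rewrite bnd_simp.
have [/andP[cs0 s0d] /andP[cs1 sd]] := (c0, cs).
have [dG dGE] : derivable G s 1 /\ derive1 G s = f s.
  apply: (@continuous_FTC1_closed _ f c s d) => //; first exact: intf.
  exact: cf.
apply: (@der_near _ _ s 1 (fun t => G t - G s0)); last first.
  apply: (@der_eq _ _ _ _ _ (f s + 0)); last by rewrite addr0.
  apply: der_add; first by rewrite -dGE; exact: der_derive1.
have N : \forall y \near s, c < y < d.
  have : s \in `]c, d[ by rewrite in_itv /= cs.
  move=> H; have := near_in_itvoo H; apply: filterS => y.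
  by rewrite in_itv.
apply: filterS N => y /andP[cy yd]; rewrite /oint; case: ifPn => s0y.
  by rewrite GB // ltW.
by rewrite GB ?opprB // ltW // ltNge.
Qed.

Lemma oint0 f s : oint s s f = 0.
Proof.
rewrite /oint lexx.
have -> : `[s, s]%classic = [set s] by exact: set_itv1.
exact: Rintegral_set1.
Qed.

Lemma antiderivative f s0 : continuous f ->
  exists F : R -> R, F s0 = 0 /\ forall s, is_derive s 1 F (f s).
Proof.
move=> cf; exists (fun s => oint s0 s f); split; first exact: oint0.
move=> s; have H := @oint_der setT f s0 s openT intervalT I I.
by apply: H => z _; exact: cf.
Qed.

End Intervals.

(** * The equation u'' = F(u): uniqueness and a priori bounds *)

Section Newton.
Context {R : realType}.
Implicit Types (I D : set R) (F u v : R -> R).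

(** The equation u'' = F(u) with velocity v. *)
Definition newton I F u v : Prop := forall s, I s ->
  is_derive s 1 u (v s) /\ is_derive s 1 v (F (u s)).

Definition lipschitz_bound D F (L : R) : Prop :=
  forall x y, D x -> D y -> `|F x - F y| <= L * `|x - y|.

Lemma sq_sum_eq0 (x y : R) : x ^+ 2 + y ^+ 2 <= 0 -> x = 0 /\ y = 0.
Proof.
move=> H; have [x2 y2] : x ^+ 2 = 0 /\ y ^+ 2 = 0.
  by have := sqr_ge0 x; have := sqr_ge0 y; lra.
by split; apply/eqP; rewrite -sqrf_eq0 ?x2 ?y2.
Qed.

(** Gronwall: the squared distance E between two motions in the phase plane
    satisfies |E'| <= (1 + L) E, hence E e^{-(1 + L) s} decreases after s0 and
    E e^{(1 + L) s} increases before it, both from or to the value 0. *)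
Lemma newton_unique I D F L u1 v1 u2 v2 s0 :
  is_interval I -> I s0 -> 0 <= L -> lipschitz_bound D F L ->
  newton I F u1 v1 -> newton I F u2 v2 ->
  (forall s, I s -> D (u1 s)) -> (forall s, I s -> D (u2 s)) ->
  u1 s0 = u2 s0 -> v1 s0 = v2 s0 ->
  forall s, I s -> u1 s = u2 s /\ v1 s = v2 s.
Proof.
move=> itvI Is0 L0 lipF N1 N2 D1 D2 eu ev s Is.
pose E t := (u1 t - u2 t) ^+ 2 + (v1 t - v2 t) ^+ 2.
pose dE t := 2 * (u1 t - u2 t) * (v1 t - v2 t) +
             2 * (v1 t - v2 t) * (F (u1 t) - F (u2 t)).
have EdE (t : R) : I t -> is_derive t 1 E (dE t).
  move=> It; have [du1 dv1] := N1 t It; have [du2 dv2] := N2 t It.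
  have H1 := der_exp 2 (der_add du1 (der_opp du2)).
  have H2 := der_exp 2 (der_add dv1 (der_opp dv2)).
  apply: (der_eq (der_add H1 H2)); rewrite /dE /= !expr1; ring.
have E0 t : 0 <= E t by rewrite addr_ge0 ?sqr_ge0.
have Es0 : E s0 = 0 by rewrite /E eu ev !subrr expr0n addr0.
pose K := 1 + L.
have dEb t : I t -> `|dE t| <= K * E t.
  move=> It; have := lipF _ _ (D1 t It) (D2 t It).
  rewrite /dE /K /E -(real_normK (num_real (u1 t - u2 t))).
  rewrite -(real_normK (num_real (v1 t - v2 t))) => lip.
  apply: le_trans (ler_normD _ _) _; rewrite !normrM [`|2|]ger0_norm //.
  have a0 := normr_ge0 (u1 t - u2 t); have b0 := normr_ge0 (v1 t - v2 t).
  move: (`|u1 t - u2 t|) (`|v1 t - v2 t|) (`|F _ - F _|) lip a0 b0 => a b f lip a0 b0.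
  have : b * f <= b * (L * a) by exact: ler_wpM2l.
  have : 0 <= (1 + L) * (a - b) ^+ 2 by rewrite mulr_ge0 ?sqr_ge0 // addr_ge0.
  nra.
have dW (k t : R) : is_derive t 1 (fun x => expR (k * x)) (expR (k * t) * k).
  apply: (der_eq (der_expR (der_mulc k (is_derive_id t 1)))).
  by rewrite mulr1.
have key : E s <= 0.
  have [ss|/ltW ss] := leP s0 s.
    pose g t := - (expR (- K * t) * E t).
    have dg (t : R) : I t -> is_derive t 1 g (expR (- K * t) * (K * E t - dE t)).
      move=> It; apply: (der_eq (der_opp (der_mul (dW (- K) t) (EdE t It)))); ring.
    have : g s0 <= g s.
      apply: (nondecr_on itvI dg) => // t /andP[t1 t2].
      have It : I t by apply: itvI Is0 Is _ _; rewrite t1.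
      rewrite mulr_ge0 ?expR_ge0 // subr_ge0.
      by have := dEb t It; rewrite ler_norml => /andP[].
    rewrite /g Es0 mulr0 oppr0 oppr_ge0 pmulr_rle0 ?expR_gt0 //.
  pose g t := expR (K * t) * E t.
  have dg (t : R) : I t -> is_derive t 1 g (expR (K * t) * (K * E t + dE t)).
    move=> It; apply: (der_eq (der_mul (dW K t) (EdE t It))); ring.
  have : g s <= g s0.
    apply: (nondecr_on itvI dg) => // t /andP[t1 t2].
    have It : I t by apply: itvI Is Is0 _ _; rewrite t1.
    rewrite mulr_ge0 ?expR_ge0 // -lerBlDl sub0r.
    by have := dEb t It; rewrite ler_norml => /andP[].
  rewrite /g Es0 mulr0 pmulr_rle0 ?expR_gt0 //.
by have [/eqP + /eqP] := sq_sum_eq0 key; rewrite !subr_eq0 => /eqP -> /eqP ->.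
Qed.

(** Two functions are compared below through their second derivatives, by applying
    this to their sum and difference. *)
Lemma convex_min (p p1 p2 : R -> R) (s : R) :
  (forall t : R, is_derive t 1 p (p1 t)) -> (forall t : R, is_derive t 1 p1 (p2 t)) ->
  (forall t, 0 <= p2 t) -> p1 0 = 0 -> p 0 <= p s.
Proof.
move=> dp dp1 p20 p10.
have mono t t' : t <= t' -> p1 t <= p1 t'.
  by move=> tt; apply: (nondecr_on (I := setT) (df := p2) intervalT).
have [s0|/ltW s0] := leP 0 s.
  apply: (nondecr_on (I := setT) (df := p1) intervalT) => // t /andP[t0 _].
  by rewrite -p10; exact: mono.
rewrite -lerN2.
apply: (nondecr_on (I := setT) (f := fun t => - p t) (df := fun t => - p1 t) intervalT) => // t.
by move=> /andP[_ t0]; rewrite oppr_ge0 -p10; exact: mono.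
Qed.

(** The weight of a Bielecki norm: as it equals its second derivative up to the
    factor c^2, integrating twice divides weighted bounds by c^2. *)
Definition bielecki (c s : R) : R := expR (c * s) + expR (- c * s).

Lemma bielecki_ge1 c s : 1 <= bielecki c s.
Proof.
rewrite /bielecki; have [cs|/ltW cs] := leP 0 (c * s).
  by apply: le_trans (_ : expR (c * s) <= _); rewrite ?lerDl ?expR_ge0 // -expR0 ler_expR.
apply: le_trans (_ : expR (- c * s) <= _); rewrite ?lerDr ?expR_ge0 // -expR0 ler_expR.
by rewrite mulNr oppr_ge0.
Qed.

(** Both K W + h and K W - h, with W the weight, are convex with a critical point
    at 0, where they are nonnegative. *)
Lemma bielecki_bound (c K : R) (h h1 h2 : R -> R) (s : R) : 0 <= K ->
  (forall t : R, is_derive t 1 h (h1 t)) -> (forall t : R, is_derive t 1 h1 (h2 t)) ->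
  (forall t, `|h2 t| <= K * c ^+ 2 * bielecki c t) -> h 0 = 0 -> h1 0 = 0 ->
  `|h s| <= K * bielecki c s.
Proof.
move=> K0 dh dh1 h2b h0 h10.
have dW (k t : R) : is_derive t 1 (fun x => expR (k * x)) (expR (k * t) * k).
  apply: (der_eq (der_expR (der_mulc k (is_derive_id t 1)))).
  by rewrite mulr1.
have aux (e : R) : `|e| = 1 -> 0 <= K * bielecki c s + e * h s.
  move=> e1.
  pose p t := K * bielecki c t + e * h t.
  pose p1 t := K * (c * expR (c * t) - c * expR (- c * t)) + e * h1 t.
  pose p2 t := K * c ^+ 2 * bielecki c t + e * h2 t.
  have dp (t : R) : is_derive t 1 p (p1 t).
    have H := der_mulc K (der_add (dW c t) (dW (- c) t)).
    apply: (der_eq (der_add H (der_mulc e (dh t)))); rewrite /p1; ring.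
  have dp1 (t : R) : is_derive t 1 p1 (p2 t).
    have H := der_mulc K (der_add (der_mulc c (dW c t)) (der_opp (der_mulc c (dW (- c) t)))).
    apply: (der_eq (der_add H (der_mulc e (dh1 t)))); rewrite /p2 /bielecki; ring.
  have p20 t : 0 <= p2 t.
    have := h2b t; rewrite -[`|h2 t|]mul1r -e1 -normrM ler_norml => /andP[+ _].
    by rewrite /p2; lra.
  have p10 : p1 0 = 0 by rewrite /p1 h10 !mulr0 subrr mulr0 addr0.
  have := convex_min s dp dp1 p20 p10; apply: le_trans.
  by rewrite /p h0 mulr0 addr0 mulr_ge0 // (le_trans _ (bielecki_ge1 _ _)).
rewrite ler_norml; apply/andP; split.
  by have := aux 1 (normr1 _); rewrite mul1r; lra.
by have := aux (-1) (normrN1 _); rewrite mulN1r; lra.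
Qed.

(** The intervals of radius 2 C / 2^k around a_k are nested; the limit is the
    supremum of their left ends. *)
Lemma geometric_limit (a : nat -> R) (C : R) : 0 <= C ->
  (forall k, `|a k.+1 - a k| <= C / 2 ^+ k) ->
  exists l, forall k, `|a k - l| <= 2 * C / 2 ^+ k.
Proof.
move=> C0 Ha.
pose d k := 2 * C / 2 ^+ k.
have dS k : d k = 2 * d k.+1 by rewrite /d exprS; field; rewrite expf_neq0.
have Ha' k : `|a k.+1 - a k| <= d k.+1.
  by apply: le_trans (Ha k) _; rewrite /d exprS le_eqVlt; apply/orP; left; apply/eqP; field; rewrite expf_neq0.
have d0 k : 0 <= d k by rewrite /d divr_ge0 ?exprn_ge0 // mulr_ge0.
have up m k : a m - d m <= a (m + k)%N - d (m + k)%N.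
  elim: k => [|k IH]; first by rewrite addn0.
  apply: le_trans IH _; rewrite addnS; have := Ha' (m + k)%N; rewrite ler_norml.
  by have := dS (m + k)%N; lra.
have dn m k : a (m + k)%N + d (m + k)%N <= a m + d m.
  elim: k => [|k IH]; first by rewrite addn0.
  apply: le_trans _ IH; rewrite addnS; have := Ha' (m + k)%N; rewrite ler_norml.
  by have := dS (m + k)%N; lra.
have cross m k : a m - d m <= a k + d k.
  apply: le_trans (up m k) _; rewrite addnC; apply: le_trans _ (dn k m).
  by have := d0 (k + m)%N; lra.
pose lo := range (fun m => a m - d m).
have lo0 : lo !=set0 by exists (a 0%N - d 0%N); exists 0%N.
exists (sup lo) => k; rewrite ler_distl; apply/andP; split.
  suff : sup lo <= a k + d k by rewrite /d; lra.
  by apply: ge_sup => // _ [m _ <-]; exact: cross.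
suff : a k - d k <= sup lo by rewrite /d; lra.
apply: ub_le_sup; last by exists k.
by exists (a k + d k) => _ [m _ <-]; exact: cross.
Qed.

Lemma le_geometric (x y z : R) : 0 <= z -> (forall k, x <= y + z / 2 ^+ k) -> x <= y.
Proof.
move=> z0 H; rewrite leNgt; apply/negP => yx.
have e0 : 0 < x - y by rewrite subr_gt0.
have [k Hk] : exists k : nat, z / 2 ^+ k < x - y.
  exists (Num.Def.archi_bound (z / (x - y))).
  set k := Num.Def.archi_bound _.
  rewrite ltr_pdivrMr ?exprn_gt0 // mulrC -ltr_pdivrMr //.
  apply: lt_trans (archi_boundP _) _; first by rewrite divr_ge0 // ltW.
  by rewrite -natrX ltr_nat ltn_expl.
by have := H k; lra.
Qed.

Lemma local_lipschitz_continuous (u : R -> R) (s C : R) : 0 <= C ->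
  (forall t, `|t - s| <= 1 -> `|u t - u s| <= C * `|t - s|) -> {for s, continuous u}.
Proof.
move=> C0 H; apply/cvgrPdist_lt => e e0.
have e1 : 0 < e / (C + 1) by rewrite divr_gt0 // ltr_wpDl.
near=> t.
have t1 : `|t - s| < 1 by rewrite distrC; near: t; exact: cvgr_dist_lt.
have t2 : `|t - s| < e / (C + 1) by rewrite distrC; near: t; exact: cvgr_dist_lt.
rewrite distrC; apply: le_lt_trans (H t (ltW t1)) _.
rewrite ltr_pdivlMr ?ltr_wpDl // in t2.
by have := normr_ge0 (t - s); nra.
Unshelve. all: by end_near. Qed.

End Newton.

(** * The equation u'' = F(u): global existence *)

Section NewtonExistence.
Context {R : realType}.
Variables (F : R -> R) (L M x0 y0 : R).
Hypotheses (L0 : 0 < L) (M0 : 0 <= M).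
Hypothesis lipF : lipschitz_bound setT F L.
Hypothesis bndF : forall x, `|F x| <= M.

(* With this rate the Picard operator halves the weighted distance. *)
Let c := Num.sqrt (2 * L).

Let c2 : c ^+ 2 = 2 * L. Proof. by rewrite sqr_sqrtr // mulr_ge0 // ltW. Qed.

Let vel (u : R -> R) t := y0 + oint 0 t (fun s => F (u s)).
Let step (u : R -> R) s := x0 + oint 0 s (vel u).
Let picard n := iter n step (fun s => x0 + y0 * s).
Let K0 := M / c ^+ 2.

Let contF : continuous F.
Proof.
by move=> s; apply: (@local_lipschitz_continuous _ F s L (ltW L0)) => t _; exact: lipF.
Qed.

Let velD (u : R -> R) : continuous u -> forall t : R, is_derive t 1 (vel u) (F (u t)).
Proof.
move=> cu t; have := @oint_der _ setT (fun s => F (u s)) 0 t openT intervalT I I.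
move=> H; apply: (der_eq (der_add (der_cst t 1 y0) (H _))); last exact: add0r.
by move=> z _; apply: continuous_comp; [exact: cu|exact: contF].
Qed.

Let vel_continuous u : continuous u -> continuous (vel u).
Proof. by move=> cu t; exact: der_continuous1 (velD cu t). Qed.

Let stepD (u : R -> R) : continuous u -> forall t : R, is_derive t 1 (step u) (vel u t).
Proof.
move=> cu t; have := @oint_der _ setT (vel u) 0 t openT intervalT I I.
move=> H; apply: (der_eq (der_add (der_cst t 1 x0) (H _))); last exact: add0r.
by move=> z _; exact: vel_continuous.
Qed.

Let step_continuous u : continuous u -> continuous (step u).
Proof. by move=> cu t; exact: der_continuous1 (stepD cu t). Qed.

Let picard_continuous n : continuous (picard n).
Proof.
elim: n => [|n IH]; last exact: step_continuous.
by move=> t; apply: der_continuous1.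
Qed.

Let step0 u : step u 0 = x0. Proof. by rewrite /step oint0 addr0. Qed.
Let vel0 u : vel u 0 = y0. Proof. by rewrite /vel oint0 addr0. Qed.

Let step_contraction (K : R) (u w : R -> R) : 0 <= K -> continuous u -> continuous w ->
  (forall s, `|u s - w s| <= K * bielecki c s) ->
  forall s, `|step u s - step w s| <= K / 2 * bielecki c s.
Proof.
move=> K_ge0 cu cw uw s.
apply: (@bielecki_bound _ c (K / 2) (fun s => step u s - step w s)
  (fun s => vel u s - vel w s) (fun s => F (u s) - F (w s))).
- by rewrite divr_ge0.
- by move=> t; apply: der_add (stepD cu t) _; apply: der_opp; exact: stepD.
- by move=> t; apply: der_add (velD cu t) _; apply: der_opp; exact: velD.
- move=> t; apply: le_trans (lipF I I) _.
  rewrite c2; have -> : K / 2 * (2 * L) * bielecki c t = L * (K * bielecki c t) by field.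
  by apply: ler_wpM2l; [exact: ltW|exact: uw].
- by rewrite !step0 subrr.
- by rewrite !vel0 subrr.
Qed.

Let K0_ge0 : 0 <= K0. Proof. by rewrite divr_ge0 // sqr_ge0. Qed.

Let picard_increment n s : `|picard n.+1 s - picard n s| <= K0 / 2 ^+ n * bielecki c s.
Proof.
elim: n s => [|n IH] s.
  rewrite expr0 divr1.
  have c20 : c ^+ 2 != 0 by rewrite c2 mulf_neq0 // gt_eqF.
  have cp := picard_continuous (n := 0).
  apply: (@bielecki_bound _ c K0 (fun s => picard 1 s - picard 0 s)
    (fun s => vel (picard 0) s - y0) (fun s => F (picard 0 s))).
  - exact: K0_ge0.
  - move=> t; apply: der_add (stepD cp t) _; apply: der_opp.
    apply: (der_eq (der_add (der_cst t 1 x0) (der_mulc y0 (is_derive_id t 1)))).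
    by rewrite add0r mulr1.
  - move=> t; apply: (der_eq (der_add (velD cp t) (der_cst t 1 (- y0)))).
    exact: addr0.
  - move=> t; rewrite /K0 divfK //; apply: le_trans (bndF _) _.
    by rewrite ler_peMr // bielecki_ge1.
  - by rewrite /picard /= step0 mulr0 addr0 subrr.
  - by rewrite vel0 subrr.
have -> : K0 / 2 ^+ n.+1 = K0 / 2 ^+ n / 2 by rewrite exprS; field; rewrite expf_neq0.
apply: step_contraction => [||| t].
- by rewrite divr_ge0 // exprn_ge0.
- exact: (@picard_continuous n.+1).
- exact: picard_continuous.
- exact: IH.
Qed.

Let picard_limit : exists u : R -> R,
  forall s n, `|picard n s - u s| <= 2 * (K0 * bielecki c s) / 2 ^+ n.
Proof.
suff /choice [u pu] s : exists l, forall n,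
    `|picard n s - l| <= 2 * (K0 * bielecki c s) / 2 ^+ n by exists u.
apply: geometric_limit => [|n].
  by rewrite mulr_ge0 // (le_trans _ (bielecki_ge1 _ _)).
by apply: le_trans (picard_increment _ _) _; rewrite mulrAC.
Qed.

(* The bound on F makes the iterates locally equi-Lipschitz, hence their limit is
   continuous and can be integrated. *)
Let picard_equilipschitz n s t : `|t - s| <= 1 ->
  `|picard n t - picard n s| <= (`|y0| + M * (`|s| + 1)) * `|t - s|.
Proof.
move=> ts.
have vb u z : continuous u -> `|z| <= `|s| + 1 -> `|vel u z| <= `|y0| + M * (`|s| + 1).
  move=> cu zs; rewrite -[vel u z](subrK (vel u 0)) [in X in _ + X]vel0 addrC.
  apply: le_trans (ler_normD _ _) _; rewrite lerD2l.
  have aux a b : a <= b -> `|vel u b - vel u a| <= M * (b - a).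
    move=> ab.
    have [|d _ ->] := @MVT_segment _ (vel u) (fun z => F (u z)) a b ab (fun x _ => velD cu x).
      by apply: continuous_segment => x _; exact: vel_continuous.
    by rewrite normrM [`|b - a|]ger0_norm ?subr_ge0 // ler_wpM2r ?subr_ge0.
  have [z0|/ltW z0] := leP 0 z.
    apply: le_trans (aux _ _ z0) _; rewrite subr0 ler_wpM2l //.
    exact: le_trans (ler_norm _) zs.
  rewrite distrC; apply: le_trans (aux _ _ z0) _; rewrite sub0r ler_wpM2l //.
  by apply: le_trans zs; rewrite -normrN ler_norm.
have [dp [dpD dpb]] : exists dp : R -> R, (forall z : R, is_derive z 1 (picard n) (dp z)) /\
    forall z, `|z| <= `|s| + 1 -> `|dp z| <= `|y0| + M * (`|s| + 1).
  case: n => [|n].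
    exists (fun=> y0); split=> [z|z _].
      apply: (der_eq (der_add (der_cst z 1 x0) (der_mulc y0 (is_derive_id z 1)))).
      by rewrite add0r mulr1.
    by rewrite lerDl mulr_ge0 // addr_ge0.
  exists (vel (picard n)); split=> z; last by move=> H; apply: vb.
  exact: stepD.
have aux a b : a <= b -> `|a| <= `|s| + 1 -> `|b| <= `|s| + 1 ->
    `|picard n b - picard n a| <= (`|y0| + M * (`|s| + 1)) * `|b - a|.
  move=> ab ha hb.
  have [|d dab ->] := @MVT_segment _ (picard n) dp a b ab (fun x _ => dpD x).
    by apply: continuous_segment => x _; exact: picard_continuous.
  rewrite normrM ler_wpM2r // dpb //.
  move: dab ha hb; rewrite in_itv /= !ler_norml => /andP[? ?] /andP[? ?] /andP[? ?].
  by apply/andP; split; lra.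
have tb : `|t| <= `|s| + 1.
  by rewrite -[t](subrK s) addrC; apply: le_trans (ler_normD _ _) _; rewrite lerD2l.
have sb : `|s| <= `|s| + 1 by rewrite lerDl.
have [st|/ltW st] := leP s t; first exact: aux.
by rewrite distrC (distrC t s); exact: aux.
Qed.

(** Global existence for a bounded Lipschitz force. The Picard operator contracts by
    1/2 in a weighted norm on the whole line, so a single iteration converges for
    all times and no local solutions have to be glued. *)
Lemma newton_exists : exists u v : R -> R,
  [/\ newton setT F u v, u 0 = x0 & v 0 = y0].
Proof.
have [u pu] := picard_limit.
have W0 s : 0 <= bielecki c s by rewrite (le_trans _ (bielecki_ge1 _ _)).
have KW s : 0 <= 2 * (K0 * bielecki c s) by apply: mulr_ge0 => //; apply: mulr_ge0.
have cu : continuous u.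
  move=> s; pose C := `|y0| + M * (`|s| + 1).
  apply: (@local_lipschitz_continuous _ u s C) => [|t ts].
    by rewrite addr_ge0 // mulr_ge0 // addr_ge0.
  apply: (@le_geometric _ _ _ (2 * (K0 * bielecki c t) + 2 * (K0 * bielecki c s))) => [|n].
    by rewrite addr_ge0.
  rewrite [_ / 2 ^+ n]mulrDl; have := picard_equilipschitz n ts; have := pu t n; have := pu s n.
  rewrite -/C ![`|picard n _ - u _|]distrC => H1 H2 H3.
  have -> : u t - u s = (u t - picard n t) + (picard n t - picard n s) - (u s - picard n s) by ring.
  apply: le_trans (ler_normB _ _) _; apply: le_trans (lerD (ler_normD _ _) (lexx _)) _.
  lra.
have fixed s : u s = step u s.
  apply/eqP; rewrite -subr_eq0 -normr_le0.
  apply: (@le_geometric _ _ _ (2 * (K0 * bielecki c s))) => [|n] //.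
  have H1 := pu s n.+1.
  have H2 : `|step (picard n) s - step u s| <= 2 * K0 / 2 ^+ n / 2 * bielecki c s.
    apply: step_contraction => // [|t].
      by rewrite divr_ge0 ?exprn_ge0 // mulr_ge0.
    by apply: le_trans (pu t n) _; rewrite mulrA mulrAC.
  rewrite -[step (picard n)]/(picard n.+1) in H2.
  have -> : u s - step u s = (picard n.+1 s - step u s) - (picard n.+1 s - u s) by ring.
  apply: le_trans (ler_normB _ _) _; apply: le_trans (lerD H2 H1) _.
  rewrite add0r le_eqVlt; apply/orP; left; apply/eqP.
  by rewrite exprS; field; rewrite expf_neq0.
exists u, (vel u); split; [|by rewrite fixed step0|exact: vel0].
move=> s _; split; last exact: velD.
apply: der_ext (stepD cu s) => t; exact/esym/fixed.
Qed.

End NewtonExistence.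

(** * Motions confined between two barriers *)

Section ConfinedMotion.
Context {R : realType}.
Implicit Types (I : set R) (F f u v : R -> R) (a b s t m : R).

(** The contrapositive of the intermediate value theorem. *)
Lemma ivt_avoid I (g : R -> R) c s0 s : is_interval I ->
  (forall t, I t -> {for t, continuous g}) -> (forall t, I t -> g t != c) ->
  I s0 -> I s -> (g s0 < c) = (g s < c).
Proof.
move=> itvI cg gc.
have aux x y : I x -> I y -> x <= y -> (g x < c) = (g y < c).
  move=> Ix Iy xy; have cxy : {within `[x, y], continuous g}.
    by apply: continuous_segment => z xzy; apply: cg; exact: itvI xzy.
  have no : ~ (Num.min (g x) (g y) <= c <= Num.max (g x) (g y)).
    move=> /(IVT xy cxy) [z]; rewrite in_itv /= => xzy gz.
    by have := gc z (itvI _ _ Ix Iy _ xzy); rewrite gz eqxx.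
  apply/idP/idP => [gx|gy]; rewrite ltNge; apply/negP => h; apply: no.
    by rewrite ge_min le_max (ltW gx) h orbT.
  by rewrite ge_min le_max (ltW gy) h orbT.
by move=> Is0 Is; have [/aux ->|/ltW/aux ->] := leP s0 s.
Qed.

(** As f (u s) is never negative, u cannot take the values a and b, where f is; it
    is therefore caught between them. *)
Lemma confined I f u a b s0 s : is_interval I ->
  (forall t, I t -> {for t, continuous u}) -> (forall t, I t -> 0 <= f (u t)) ->
  f a < 0 -> f b < 0 -> I s0 -> a < u s0 < b -> I s -> a < u s < b.
Proof.
move=> itvI cu fu fa fb Is0 /andP[au ub] Is.
have neq c : f c < 0 -> forall t, I t -> u t != c.
  by move=> fc t It; apply: contraTneq (fu t It) => ->; rewrite -ltNge.
rewrite -(ivt_avoid itvI cu (neq _ fb) Is0 Is) ub andbT.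
rewrite lt_neqAle eq_sym neq //= leNgt.
by rewrite -(ivt_avoid itvI cu (neq _ fa) Is0 Is) -leNgt ltW.
Qed.

Lemma newton_shift F u v c : newton setT F u v ->
  newton setT F (fun s => u (s + c)) (fun s => v (s + c)).
Proof.
move=> N s _; have [du dv] := N (s + c) I.
have ds : is_derive s 1 (fun x : R => x + c) 1.
  by apply: (der_eq (der_add (is_derive_id s 1) (der_cst s 1 c))); exact: addr0.
split.
  by apply: (der_eq (der_comp ds du)); rewrite mulr1.
by apply: (der_eq (der_comp ds dv)); rewrite mulr1.
Qed.

Lemma newton_reflect F u v c : newton setT F u v ->
  newton setT F (fun s => u (c - s)) (fun s => - v (c - s)).
Proof.
move=> N s _; have [du dv] := N (c - s) I.
have ds : is_derive s 1 (fun x : R => c - x) (-1).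
  by apply: (der_eq (der_add (der_cst s 1 c) (der_opp (is_derive_id s 1)))); exact: add0r.
split.
  by apply: (der_eq (der_comp ds du)); rewrite mulrN1.
by apply: (der_eq (der_opp (der_comp ds dv))); rewrite mulrN1 opprK.
Qed.

Lemma lipschitz_segment F (dF : R -> R) a b : a <= b ->
  (forall x : R, is_derive x 1 F (dF x)) -> continuous dF ->
  exists2 L, 0 < L & lipschitz_bound [set x | a <= x <= b] F L.
Proof.
move=> ab FdF cdF.
have [|c cab cmax] := @EVT_max _ (fun x => `|dF x|) a b ab.
  by apply: continuous_segment => z _; apply: continuous_comp; [exact: cdF|exact: norm_continuous].
exists (`|dF c| + 1) => [|x y]; first by rewrite ltr_wpDl.
have aux x' y' : a <= x' <= b -> a <= y' <= b -> x' <= y' ->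
    `|F y' - F x'| <= (`|dF c| + 1) * `|y' - x'|.
  move=> /andP[ax xb] /andP[ay yb] xy.
  have [|d dxy ->] := @MVT_segment _ F dF x' y' xy (fun z _ => FdF z).
    by apply: continuous_segment => z _; exact: der_continuous1.
  rewrite normrM ler_wpM2r //; apply: le_trans (_ : `|dF c| <= _); last by rewrite lerDl.
  apply: cmax; move: dxy; rewrite !in_itv /= => /andP[? ?].
  by apply/andP; split; lra.
move=> /= hx hy; have [xy|/ltW yx] := leP x y.
  by rewrite distrC [`|x - y|]distrC; exact: aux.
exact: aux.
Qed.

Definition clamp a b x : R := Num.max a (Num.min b x).

Lemma clampP a b x : a <= b -> a <= clamp a b x <= b.
Proof. by move=> ab; rewrite /clamp le_max lexx /= ge_max ab ge_min lexx. Qed.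

Lemma clamp_id a b x : a <= x <= b -> clamp a b x = x.
Proof. by move=> /andP[ax xb]; rewrite /clamp (min_r xb) max_r. Qed.

Lemma clamp_lip a b x y : a <= b -> `|clamp a b x - clamp a b y| <= `|x - y|.
Proof.
move=> ab; rewrite /clamp ler_norml.
have := ler_norm (x - y); have := ler_norm (y - x); rewrite [`|y - x|]distrC => h1 h2.
have h0 := normr_ge0 (x - y).
by case: (leP b x); case: (leP b y) => ? ?; rewrite ?(max_r ab);
  case: (leP a x) => ?; case: (leP a y) => ?; apply/andP; split; lra.
Qed.

(** Outside the barriers the force is replaced by its boundary value, which makes
    it bounded and Lipschitz; conservation of energy keeps the motion inside. *)
Lemma confined_exists F f (dF : R -> R) a b y0 :
  a < 0 < b -> f a < 0 -> f b < 0 ->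
  (forall x : R, is_derive x 1 f (2 * F x)) ->
  (forall x : R, is_derive x 1 F (dF x)) -> continuous dF -> y0 ^+ 2 = f 0 ->
  exists u v : R -> R, [/\ newton setT F u v, u 0 = 0, v 0 = y0,
    forall s, v s ^+ 2 = f (u s) & forall s, a < u s < b].
Proof.
move=> /andP[a0 b0] fa fb dfF FdF cdF y0f.
have ab : a <= b by rewrite ltW // (lt_trans a0).
have [L L0 lipF] := lipschitz_segment ab FdF cdF.
pose G x := F (clamp a b x).
have lipG : lipschitz_bound setT G L.
  move=> x y _ _; apply: le_trans (lipF _ _ (clampP x ab) (clampP y ab)) _.
  by rewrite ler_wpM2l ?clamp_lip // ltW.
have [M M0 bndG] : exists2 M, 0 <= M & forall x, `|G x| <= M.
  exists (`|F a| + L * (b - a)) => [|x].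
    by rewrite addr_ge0 // mulr_ge0 ?subr_ge0 // ltW.
  rewrite -[G x](subrK (F a)) addrC; apply: le_trans (ler_normD _ _) _.
  have /andP[ac cb] := clampP x ab.
  rewrite lerD2l; apply: le_trans (lipF _ _ _ _) _; rewrite /= ?lexx ?ab ?ac //.
  by rewrite ler_wpM2l ?ger0_norm ?subr_ge0 ?lerD2r // ltW.
have [u [v [N u0 v0]]] := newton_exists 0 y0 L0 M0 lipG bndG.
have cG : continuous (fun x => 2 * G x).
  move=> x; apply: (@local_lipschitz_continuous _ _ x (2 * L)) => [|t _].
    by rewrite mulr_ge0 // ltW.
  by rewrite -mulrBr normrM ger0_norm // -mulrA ler_wpM2l // lipG.
have [g [g0 dg]] := antiderivative 0 cG.
have gf x : a <= x <= b -> g x = f x - f 0.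
  move=> xab; have itv : is_interval [set x | a <= x <= b].
    move=> p q /= /andP[? ?] /andP[? ?] z /andP[? ?]; apply/andP; split; lra.
  have d0 (z : R) : [set x | a <= x <= b] z -> is_derive z 1 (fun z => g z - f z) 0.
    move=> zab; apply: (der_eq (der_add (dg z) (der_opp (dfF z)))).
    by rewrite /G clamp_id // subrr.
  have z0 : [set x | a <= x <= b] 0 by rewrite /= !ltW.
  have := cst_on itv d0 xab z0; rewrite g0; lra.
have en s : v s ^+ 2 = g (u s) + f 0.
  pose e s := v s ^+ 2 - g (u s).
  have de (t : R) : setT t -> is_derive t 1 e 0.
    move=> _; have [du dv] := N t I.
    apply: (der_eq (der_add (der_exp 2 dv) (der_opp (der_comp du (dg (u t)))))).
    by rewrite /= expr1; ring.
  have := cst_on intervalT de (I : setT s) (I : setT 0).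
  by rewrite /e v0 u0 g0 y0f; lra.
have uab s : a < u s < b.
  apply: (@confined setT (fun x => g x + f 0) u a b 0) => //.
  - by move=> t _; have [du _] := N t I; exact: der_continuous1 du.
  - by move=> t _; rewrite -en sqr_ge0.
  - by rewrite gf ?lexx // subrK.
  - by rewrite gf ?lexx ?ab // subrK.
  - by rewrite u0 a0 b0.
have cl s : a <= u s <= b by have /andP[? ?] := uab s; rewrite !ltW.
exists u, v; split=> // s; last by rewrite en gf // subrK.
by move=> _; have := N s I; rewrite /G clamp_id.
Qed.

Lemma linear_growth (g dg : R -> R) T d s :
  (forall t : R, is_derive t 1 g (dg t)) -> (forall t, T <= t -> d <= dg t) ->
  T <= s -> g T + d * (s - T) <= g s.
Proof.
move=> gdg dgd Ts; pose h t := g t - d * t.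
have dh (t : R) : setT t -> is_derive t 1 h (dg t - d).
  move=> _; apply: (der_eq (der_add (gdg t) (der_opp (der_mulc d (is_derive_id t 1))))).
  by rewrite mulr1.
have : h T <= h s.
  apply: (nondecr_on intervalT dh) => // z /andP[Tz _].
  by rewrite subr_ge0 dgd.
by rewrite /h; lra.
Qed.

(** The limit m is the supremum of u. If F(m) > 0 or f(m) > 0 then v stays above a
    positive constant near m and u is unbounded; if F(m) < 0 then v becomes
    negative; and f(m) < 0 contradicts v^2 = f(u). *)
Lemma increasing_motion_limit F f u v a b T : continuous F -> continuous f ->
  newton setT F u v -> (forall s, a <= u s <= b) -> (forall s, v s ^+ 2 = f (u s)) ->
  (forall s, T <= s -> 0 < v s) -> exists m, [/\ a <= m <= b, f m = 0 & F m = 0].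
Proof.
move=> cF cf N uab vf v0.
have du (t : R) : is_derive t 1 u (v t) by have [] := N t I.
have dv (t : R) : is_derive t 1 v (F (u t)) by have [] := N t I.
have mono x y : T <= x -> x <= y -> u x <= u y.
  move=> Tx xy; apply: (nondecr_on intervalT (fun z _ => du z)) => // z /andP[xz _].
  by rewrite ltW // v0 // (le_trans Tx).
pose S := [set u s | s in [set s | T <= s]].
have S0 : S !=set0 by exists (u T); exists T => //=.
have hs : has_sup S.
  by split=> //; exists b => _ [s _ <-]; have /andP[] := uab s.
pose m := sup S.
have um s : T <= s -> u s <= m.
  by move=> Ts; apply: sup_upper_bound => //; exists s.
have away d : 0 < d -> forall T1, T <= T1 -> ~ (forall t, T1 <= t -> d <= v t).
  move=> d0 T1 TT1 H.
  have [s] : exists s, s = T1 + (b - u T1 + 1) / d by eexists.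
  have /andP[_ ub1] := uab T1 => sE.
  have T1s : T1 <= s by rewrite sE lerDl divr_ge0 ?ltW //; lra.
  have := linear_growth du H T1s; rewrite sE addrAC subrr add0r mulrCA divff ?gt_eqF // mulr1.
  by have /andP[_] := uab s; rewrite sE; lra.
have enter d : 0 < d -> exists2 T1, T <= T1 & forall t, T1 <= t -> `|m - u t| < d.
  move=> d0; have [_ [T1 /= TT1 <-] h] := sup_adherent d0 hs.
  exists T1 => // t T1t; have Tt := le_trans TT1 T1t.
  by rewrite ger0_norm ?subr_ge0 ?um //; have := mono _ _ TT1 T1t; rewrite -/m in h; lra.
have near (g : R -> R) (e : R) : continuous g -> 0 < e ->
    exists2 T1, T <= T1 & forall t, T1 <= t -> `|g m - g (u t)| < e.
  move=> cg e0; have /cvgrPdist_lt/(_ e e0)/nbhs_ballP [d /= d0 H] := cg m.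
  have [T1 TT1 HT] := enter d d0; exists T1 => // t /HT; exact: H.
have /andP[aT bT] := uab T.
have mab : a <= m <= b.
  rewrite (le_trans aT) ?um //=; apply: ge_sup => // _ [s _ <-].
  by have /andP[] := uab s.
exists m; split=> //.
- apply/eqP; rewrite eq_le; apply/andP; split; rewrite leNgt; apply/negP => f0.
    have [|T1 TT1 H] := near f (f m / 2) cf; first by rewrite divr_gt0.
    have d0 : 0 < Num.sqrt (f m / 2) by rewrite sqrtr_gt0 divr_gt0.
    apply: (away _ d0 _ TT1) => t T1t.
    have v0t := v0 t (le_trans TT1 T1t).
    rewrite -(ger0_norm (ltW v0t)) -sqrtr_sqr ler_sqrt ?sqr_ge0 // vf.
    by have := H t T1t; rewrite ltr_norml => /andP[]; lra.
  have [|T1 TT1 H] := near f (- f m) cf; first by rewrite oppr_gt0.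
  have := H T1 (lexx _); rewrite ltr_norml => /andP[h _].
  by have := sqr_ge0 (v T1); rewrite vf; lra.
- apply/eqP; rewrite eq_le; apply/andP; split; rewrite leNgt; apply/negP => F0.
    have [|T1 TT1 H] := near F (F m) cF => //.
    apply: (away (v T1) _ _ TT1); first exact: v0.
    move=> t T1t; apply: (nondecr_on intervalT (fun z _ => dv z)) => // z /andP[T1z _].
    by have := H z T1z; rewrite ltr_norml => /andP[]; lra.
  have [|T1 TT1 H] := near F (- F m / 2) cF; first by rewrite divr_gt0 // oppr_gt0.
  pose d := - F m / 2.
  have d0 : 0 < d by rewrite divr_gt0 // oppr_gt0.
  have [s sE] : exists s, s = T1 + v T1 / d by eexists.
  have vT1 := v0 T1 TT1.
  have T1s : T1 <= s by rewrite sE lerDl divr_ge0 // ltW.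
  have dnv (t : R) : is_derive t 1 (fun t => - v t) (- F (u t)) by exact: der_opp.
  have nb t : T1 <= t -> d <= - F (u t).
    by move=> /H; rewrite ltr_norml /d => /andP[]; lra.
  have := linear_growth dnv nb T1s.
  rewrite sE addrAC subrr add0r mulrCA divff ?gt_eqF // mulr1.
  by have := v0 s (le_trans TT1 T1s); rewrite sE; lra.
Qed.

(** With at most one turning point, v has a constant sign from some time on and u
    is monotone, up to the reflection u -> -u; it then tends to a rest point. *)
Lemma two_turning_points F f u v a b : continuous F -> continuous f ->
  newton setT F u v -> (forall s, a <= u s <= b) -> (forall s, v s ^+ 2 = f (u s)) ->
  (forall m, a <= m <= b -> f m = 0 -> F m = 0 -> False) ->
  exists s1 s2, [/\ s1 < s2, v s1 = 0 & v s2 = 0].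
Proof.
move=> cF cf N uab vf nom; apply: contrapT => H.
have [T HT] : exists T, forall s, T <= s -> v s != 0.
  have [[z vz]|noz] := pselect (exists z, v z = 0); last first.
    by exists 0 => s _; apply/eqP => vs; apply: noz; exists s.
  exists (z + 1) => s zs; apply/eqP => vs; apply: H; exists z, s; split=> //.
  by apply: lt_le_trans zs; rewrite ltrDl.
have cv t : {for t, continuous v} by have [_ dv] := N t I; exact: der_continuous1 dv.
have itv : is_interval [set s | T <= s] by move=> x y Tx _ z /andP[xz _]; exact: le_trans xz.
have sgn s : T <= s -> (v T < 0) = (v s < 0).
  by move=> Ts; apply: (ivt_avoid itv (fun t _ => cv t) HT) => /=.
have [vT|vT] := ltP (v T) 0; last first.
  have [s Ts|m [mab fm Fm]] := increasing_motion_limit (T := T) cF cf N uab vf.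
    by rewrite lt_neqAle eq_sym HT //= leNgt -sgn // -leNgt.
  exact: nom mab fm Fm.
have [|||||s Ts|m [mab fm Fm]] := @increasing_motion_limit (fun x => - F (- x))
    (fun x => f (- x)) (fun s => - u s) (fun s => - v s) (- b) (- a) T.
- by move=> x; apply: continuousN; apply: continuous_comp; [exact: opp_continuous|exact: cF].
- by move=> x; apply: continuous_comp; [exact: opp_continuous|exact: cf].
- by move=> s _; have [du dv] := N s I; rewrite opprK; split; exact: der_opp.
- by move=> s; have := uab s; rewrite !lerN2 andbC.
- by move=> s; rewrite sqrrN opprK.
- by rewrite oppr_gt0 -sgn.
apply: (nom (- m)) => //; last by apply/eqP; rewrite -oppr_eq0; apply/eqP.
by move: mab; rewrite lerNl lerNr andbC.
Qed.

(** The equation is reversible, so by uniqueness the motion is symmetric about every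
    turning time; the two symmetries compose to a translation of time. *)
Lemma newton_periodic F L D u v s1 s2 : 0 <= L -> lipschitz_bound D F L ->
  newton setT F u v -> (forall s, D (u s)) -> v s1 = 0 -> v s2 = 0 ->
  forall s, u (s + 2 * (s2 - s1)) = u s /\ v (s + 2 * (s2 - s1)) = v s.
Proof.
move=> L0 lipF N uD.
have refl c : v c = 0 -> forall s, u (2 * c - s) = u s /\ v (2 * c - s) = - v s.
  move=> vc s; have E : 2 * c - c = c by ring.
  have [||<- <-] := newton_unique intervalT (I : setT c) L0 lipF
    (newton_reflect (2 * c) N) N (fun t _ => uD _) (fun t _ => uD _) _ _ (I : setT s).
  - by rewrite E.
  - by rewrite E vc oppr0.
  by rewrite opprK.
move=> v1 v2 s.
have [e1 e1'] := refl s1 v1 s; have [e2 e2'] := refl s2 v2 (2 * s1 - s).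
have -> : s + 2 * (s2 - s1) = 2 * s2 - (2 * s1 - s) by ring.
by rewrite e2 e2' e1 e1' opprK.
Qed.

End ConfinedMotion.

(** * The potential of the system *)

Section Potential.
Context {R : realType} {n : nat}.
Variables (lam al : 'I_n -> R) (alpha A : R).

Definition Qpoly : {poly R} := \prod_j ((al j)%:P + lam j *: 'X).

Lemma QpolyE x : Qpoly.[x] = \prod_j (al j + lam j * x).
Proof.
rewrite /Qpoly horner_prod; apply: eq_bigr => j _.
by rewrite hornerD hornerC hornerZ hornerX.
Qed.

(** Along a solution of the system, u'^2 = energy u and u'' = force u. *)
Definition energy (x : R) : R := 4 * (Qpoly.[x] - A ^+ 2 * expR (- alpha * x)).

Definition force (x : R) : R :=
  2 * (Qpoly^`().[x] + alpha * A ^+ 2 * expR (- alpha * x)).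

Let dforce (x : R) : R :=
  2 * (Qpoly^`()^`().[x] - alpha ^+ 2 * A ^+ 2 * expR (- alpha * x)).

Let der_e (x : R) : is_derive x 1 (fun x => expR (- alpha * x)) (expR (- alpha * x) * - alpha).
Proof.
by apply: (der_eq (der_expR (der_mulc (- alpha) (is_derive_id x 1)))); rewrite mulr1.
Qed.

Lemma energy_der (x : R) : is_derive x 1 energy (2 * force x).
Proof.
have := der_mulc 4 (der_add (is_derive_poly Qpoly x) (der_opp (der_mulc (A ^+ 2) (der_e x)))).
by move/der_eq; apply; rewrite /force; ring.
Qed.

Lemma force_der (x : R) : is_derive x 1 force (dforce x).
Proof.
have := der_mulc 2 (der_add (is_derive_poly Qpoly^`() x) (der_mulc (alpha * A ^+ 2) (der_e x))).
by move/der_eq; apply; rewrite /dforce; ring.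
Qed.

Lemma dforce_continuous : continuous dforce.
Proof.
by move=> x; apply: der_continuous1.
Qed.

Lemma energy_continuous : continuous energy.
Proof. by move=> x; exact: der_continuous1 (energy_der x). Qed.

Lemma force_continuous : continuous force.
Proof. by move=> x; exact: der_continuous1 (force_der x). Qed.

Lemma force_lipschitz a b : a <= b ->
  exists2 L, 0 < L & lipschitz_bound [set x | a <= x <= b] force L.
Proof. by move=> ab; exact: lipschitz_segment ab force_der dforce_continuous. Qed.

Lemma force_confined a b y0 : a < 0 < b -> energy a < 0 -> energy b < 0 ->
  y0 ^+ 2 = energy 0 ->
  exists u v : R -> R, [/\ newton setT force u v, u 0 = 0, v 0 = y0,
    forall s, v s ^+ 2 = energy (u s) & forall s, a < u s < b].
Proof.
by move=> *; apply: confined_exists energy_der force_der dforce_continuous _.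
Qed.

Lemma Qpoly_deriv x : (forall j, 0 < al j + lam j * x) ->
  Qpoly^`().[x] = Qpoly.[x] * \sum_j lam j / (al j + lam j * x).
Proof.
move=> pos; rewrite /Qpoly; elim: (index_enum _) => [|j r IH].
  by rewrite !big_nil derivC hornerC mulr0.
rewrite !big_cons; move: (\prod_(k <- r) _) (\sum_(k <- r) _) IH => P S IH.
rewrite derivM hornerD !hornerM IH derivD derivC derivZ derivX !hornerE /=.
have := pos j; set y := al j + _ => y0.
by field; rewrite gt_eqF.
Qed.

Lemma Qpoly_gt0 x : (forall j, 0 < al j + lam j * x) -> 0 < Qpoly.[x].
Proof. by move=> pos; rewrite QpolyE prodr_gt0. Qed.

Lemma energy_zero x : energy x = 0 -> Qpoly.[x] = A ^+ 2 * expR (- alpha * x).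
Proof. by rewrite /energy => H; lra. Qed.

Lemma rest_point_balance x : (forall j, 0 < al j + lam j * x) ->
  energy x = 0 -> force x = 0 -> \sum_j lam j / (al j + lam j * x) + alpha = 0.
Proof.
move=> pos /energy_zero Qx; rewrite /force Qpoly_deriv // -[alpha * _ * _]mulrA -Qx => H.
have Q0 := Qpoly_gt0 pos; move: H; set S := \sum_j _ => H.
have : Qpoly.[x] * (S + alpha) = 0 by lra.
by move/eqP; rewrite mulf_eq0 gt_eqF //= => /eqP.
Qed.

(** Each factor of Q obeys 1 + t <= e^t about the rest point m, and the exponents
    add up to -alpha (x - m); this is the strict concavity of log Q. *)
Lemma rest_point_unique (a b m x : R) (j0 : 'I_n) : (forall j, lam j != 0) ->
  (forall y, a < y < b -> forall j, 0 < al j + lam j * y) ->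
  a < m < b -> energy m = 0 -> force m = 0 -> a < x < b -> 0 <= energy x -> x = m.
Proof.
move=> lam0 pos mab em fm xab ex.
have posm := pos m mab; have posx := pos x xab.
have bal := rest_point_balance posm em fm.
apply/eqP; apply: contraTT ex => xm; rewrite -ltNge.
pose t j := lam j * (x - m) / (al j + lam j * m).
have t0 j : t j != 0.
  apply: mulf_neq0; last by rewrite invr_eq0 gt_eqF.
  by apply: mulf_neq0 => //; rewrite subr_eq0.
have factor j : al j + lam j * x = (al j + lam j * m) * (1 + t j).
  by rewrite /t; have := posm j; set y := al j + lam j * m => y0;
     rewrite (_ : al j + lam j * x = y + lam j * (x - m)); [field; rewrite gt_eqF|rewrite /y; ring].
have tp j : 0 < 1 + t j by have := posx j; rewrite factor pmulr_rgt0.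
have sumt : \sum_j t j = - alpha * (x - m).
  rewrite -[- alpha](_ : \sum_j lam j / (al j + lam j * m) = _); last by lra.
  by rewrite mulr_suml; apply: eq_bigr => j _; rewrite /t mulrAC.
have : Qpoly.[x] < Qpoly.[m] * expR (- alpha * (x - m)).
  rewrite !QpolyE -sumt expR_sum -big_split /=.
  apply: ltr_prod; first by apply/hasP; exists j0; rewrite ?mem_index_enum.
  by move=> j _; rewrite factor; rewrite mulr_ge0 ?ltW //= ltr_pM2l // expR_gt1Dx.
rewrite (energy_zero em) -mulrA -expRD -mulrDr addrC subrK /energy.
by lra.
Qed.

(** The zero of Q nearest to 0 on the side where the factors with lam_j = e vanish. *)
Lemma nearest_zero (e : R) : (exists j, lam j = e) -> (forall j, 0 < al j) ->
  exists c, [/\ 0 < c, exists2 j, lam j = e & al j = c & forall j, lam j = e -> c <= al j].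
Proof.
move=> [j0 /eqP lj0] al0.
case: (@arg_minP _ R _ j0 (fun j => lam j == e) al lj0) => j /eqP lj Hj.
exists (al j); split=> //; first by exists j.
by move=> k /eqP; exact: Hj.
Qed.

Lemma energy_zero_factor x j : A != 0 -> al j + lam j * x = 0 -> energy x < 0.
Proof.
move=> A0 x0; rewrite /energy QpolyE (bigD1 j) //= x0 mul0r sub0r.
have : 0 < A ^+ 2 * expR (- alpha * x) by rewrite mulr_gt0 ?expR_gt0 ?exprn_even_gt0.
by lra.
Qed.

(** The energy is negative at a zero of Q, and the zeros of Q nearest to 0 on
    either side bound an interval where all factors are positive. If all lam_j are
    1 there is no zero to the right; there alpha < 0 and Q grows more slowly than
    e^{-alpha x}. *)
Lemma barriers C : (0 < n)%N -> case_a lam C alpha A \/ case_b lam C A ->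
  (forall j, 0 < al j) ->
  exists a b, [/\ a < 0 < b, energy a < 0, energy b < 0 &
    forall x, a < x < b -> forall j, 0 < al j + lam j * x].
Proof.
move=> n0 hc al0.
have A0 : A != 0 by case: hc => [[_ _ _ ?]|[m [_ _ _ ?]]]; rewrite gt_eqF.
have lam1 : exists j, lam j = 1.
  case: hc => [[H _ _ _]|[m [/andP[m0 mn] H _ _]]]; first by exists (Ordinal n0).
  by exists (Ordinal n0); rewrite H /= m0.
have [c [c0 [j lj alj] Hc]] := nearest_zero lam1 al0.
have ec : energy (- c) < 0.
  by apply: (@energy_zero_factor _ j) => //; rewrite lj alj; ring.
case: hc => [[H _ alpha0 Agt0]|[m [/andP[m0 mn] H _ Agt0]]]; last first.
  have lamN1 : exists j, lam j = -1 by exists (Ordinal mn); rewrite H /= ltnn.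
  have [d [d0 [k lk alk] Hd]] := nearest_zero lamN1 al0.
  exists (- c), d; split=> //; first by rewrite oppr_lt0 c0.
    by apply: (@energy_zero_factor _ k) => //; rewrite lk alk; ring.
  move=> x /andP[cx xd] i; have := H i; case: ifP => _ li; rewrite li.
    by have := Hc i li; lra.
  by have := Hd i li; lra.
(* Each factor y of Q is at most e^{eps y} / eps; this choice of eps makes the
   product grow like e^{-alpha x / 2}, and b is where e^{-alpha x} takes over. *)
pose eps := - alpha / (2 * n%:R).
have n0R : 0 < n%:R :> R by rewrite ltr0n.
have eps0 : 0 < eps by apply: divr_gt0; rewrite ?oppr_gt0 //; apply: mulr_gt0.
pose K := \prod_j (eps^-1 * expR (eps * al j)).
have K0 : 0 < K by apply: prodr_gt0 => i _; rewrite mulr_gt0 ?invr_gt0 ?expR_gt0.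
have A20 : 0 < A ^+ 2 by rewrite exprn_gt0.
pose t := K / A ^+ 2.
have t0 : 0 < t by rewrite divr_gt0.
pose b := 2 * t / - alpha.
have b0 : 0 < b by apply: divr_gt0; rewrite ?oppr_gt0 //; apply: mulr_gt0.
have bt : - alpha * b = 2 * t by rewrite /b; field; rewrite lt_eqF.
exists (- c), b; split=> //; first by rewrite oppr_lt0 c0.
  suff : Qpoly.[b] < A ^+ 2 * expR (- alpha * b) by rewrite /energy; lra.
  have Qb : Qpoly.[b] <= K * expR t.
    have -> : expR t = \prod_(j < n) expR (eps * b).
      rewrite -expR_sum sumr_const card_ord -mulr_natl; congr expR.
      have -> : eps * b = - alpha * b / (2 * n%:R) by rewrite /eps mulrAC.
      by rewrite bt; field; rewrite gt_eqF.
    rewrite QpolyE -big_split /=; apply: ler_prod => i _.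
    have y0 : 0 < al i + lam i * b by rewrite H mul1r addr_gt0.
    rewrite ltW //= -mulrA -expRD H mul1r -mulrDr.
    have yE : al i + b = eps^-1 * (eps * (al i + b)) by rewrite mulKf // gt_eqF.
    rewrite [leLHS]yE ler_pM2l ?invr_gt0 //.
    by apply: le_trans (expR_ge1Dx _); rewrite lerDr.
  apply: le_lt_trans Qb _; rewrite bt mulr_natl mulr2n expRD mulrA ltr_pM2r ?expR_gt0 //.
  have -> : K = A ^+ 2 * t by rewrite /t; field; rewrite gt_eqF.
  by rewrite ltr_pM2l //; apply: lt_le_trans (expR_ge1Dx _); rewrite ltrDr.
by move=> x /andP[cx xd] i; have := Hc i (H i); rewrite H; lra.
Qed.

End Potential.

(** * Polar form of a solution *)

Local Notation radius := Defs.radius.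

Section Expi.
Context {R : realType}.
Implicit Types (s t x y : R) (z : R[i]).

Lemma expiD s t : expi (s + t) = expi s * expi t.
Proof. by rewrite /expi; simpc; rewrite cosD sinD addrC [in RHS]addrC; congr (_ +i* _); ring. Qed.

Lemma expi0 : expi 0 = 1 :> R[i].
Proof. by rewrite /expi cos0 sin0. Qed.

Lemma expiJ t : (expi t)^*%C = expi (- t).
Proof. by rewrite /expi cosN sinN. Qed.

Lemma expiNK t : expi (- t) * expi t = 1 :> R[i].
Proof. by rewrite -expiD addNr expi0. Qed.

Lemma expi_neq0 t : expi t != 0 :> R[i].
Proof. by apply/eqP => e; have := expiNK t; rewrite e mulr0 => /eqP; rewrite eq_sym oner_eq0. Qed.

Lemma expi_sum (I : finType) (P : pred I) (t : I -> R) :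
  expi (\sum_(i | P i) t i) = \prod_(i | P i) expi (t i).
Proof. by rewrite (big_morph _ expiD expi0). Qed.

Lemma polar_prod (I : finType) (P : pred I) (r t : I -> R) :
  \prod_(i | P i) ((r i)%:C * expi (t i)) =
  (\prod_(i | P i) r i)%:C * expi (\sum_(i | P i) t i).
Proof. by rewrite big_split /= expi_sum rmorph_prod. Qed.

Lemma polarJ x t : (x%:C * expi t)^*%C = x%:C * expi (- t).
Proof. by rewrite /expi cosN sinN; simpc. Qed.

Lemma Re_polar x t : Rpart (x%:C * expi t) = x * cos t.
Proof. by rewrite /expi; simpc. Qed.

Lemma Im_polar x t : Ipart (x%:C * expi t) = x * sin t.
Proof. by rewrite /expi; simpc. Qed.

Lemma normc_polar x t : 0 <= x -> Normc.normc (x%:C * expi t) = x.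
Proof.
move=> x0; rewrite /expi; simpc; rewrite /= !exprMn -mulrDr cos2Dsin2 mulr1.
by rewrite sqrtr_sqr ger0_norm.
Qed.

Lemma complex_ext z z' : Rpart z = Rpart z' -> Ipart z = Ipart z' -> z = z'.
Proof. by case: z z' => [a b] [c d] /= -> ->. Qed.

End Expi.

Section SolutionAnalysis.
Context {R : realType} {n : nat}.
Variables (I : set R) (lam : 'I_n -> R) (alpha A : R).
Variables (w : 'I_n -> R -> R[i]) (theta : R -> R) (phi : 'I_n -> R -> R) (s0 : R).
Hypotheses (oI : open I) (itvI : is_interval I) (Is0 : I s0).
Hypothesis sol : solution I lam alpha w theta.
Hypothesis pol : polar_lift I w phi.
Hypothesis fi : first_integral I lam alpha w theta phi s0 A.

Let psi s := phi_sum phi s - theta s.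
Let q s := \prod_j radius w j s.
Let u := ufun w theta phi s0.
Let al := alphas w s0.

Lemma radius_gt0 j s : I s -> 0 < radius w j s.
Proof.
move=> Is; have [_ _ /(_ j s Is) w0 _ _] := sol.
rewrite lt_neqAle; apply/andP; split; last by rewrite /radius; case: (w j s) => x y /=; exact: sqrtr_ge0.
by rewrite eq_sym; apply: contra w0 => /eqP/Normc.eq0_normc ->.
Qed.

Lemma radius_prod_gt0 s : I s -> 0 < q s.
Proof. by move=> Is; apply: prodr_gt0 => j _; exact: radius_gt0. Qed.

Lemma solution_prod s (P : pred 'I_n) : I s ->
  \prod_(k | P k) w k s = (\prod_(k | P k) radius w k s)%:C * expi (\sum_(k | P k) phi k s).
Proof.
move=> Is; have [_ H] := pol; rewrite -polar_prod; apply: eq_bigr => k _; exact: H.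
Qed.

Let radius_others j s := \prod_(k | k != j) radius w k s.

Let q_split j s : q s = radius w j s * radius_others j s.
Proof. by rewrite /q (bigD1 j). Qed.

Let w_rhs j s : I s ->
  (lam j)%:C * expi (theta s) * (\prod_(k | k != j) w k s)^*%C =
  (lam j * radius_others j s)%:C * expi (phi j s - psi s).
Proof.
move=> Is; rewrite solution_prod // polarJ [in RHS]rmorphM /=.
have -> : phi j s - psi s = theta s + - \sum_(k | k != j) phi k s.
  by rewrite /psi /phi_sum (bigD1 j) //=; ring.
by rewrite expiD; ring.
Qed.

Lemma Re_w_der j (s : R) : I s -> is_derive s 1 (fun t => Rpart (w j t))
  (lam j * radius_others j s * cos (phi j s - psi s)).
Proof.
move=> Is; have [/(_ j) [sm _] _ _ /(_ j s Is) E _] := sol.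
apply: der_eq (der_derive1 (sm 0%N s Is)) _.
by have := congr1 (@complex.Re R) E; rewrite w_rhs // Re_polar.
Qed.

Lemma Im_w_der j (s : R) : I s -> is_derive s 1 (fun t => Ipart (w j t))
  (lam j * radius_others j s * sin (phi j s - psi s)).
Proof.
move=> Is; have [/(_ j) [_ sm] _ _ /(_ j s Is) E _] := sol.
apply: der_eq (der_derive1 (sm 0%N s Is)) _.
by have := congr1 (@complex.Im R) E; rewrite w_rhs // Im_polar.
Qed.

Lemma Re_w j s : I s -> Rpart (w j s) = radius w j s * cos (phi j s).
Proof. by move=> Is; have [_ /(_ j s Is) {1}->] := pol; rewrite Re_polar. Qed.

Lemma Im_w j s : I s -> Ipart (w j s) = radius w j s * sin (phi j s).
Proof. by move=> Is; have [_ /(_ j s Is) {1}->] := pol; rewrite Im_polar. Qed.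

Let phi_derivable j (s : R) : I s -> is_derive s 1 (phi j) (derive1 (phi j) s).
Proof. by move=> Is; have [/(_ j) sm _] := pol; exact: der_derive1 (sm 0%N s Is). Qed.

Lemma theta_der (s : R) : I s -> is_derive s 1 theta (alpha * (q s * sin (psi s))).
Proof.
move=> Is; have [_ sm _ _ /(_ s Is) E] := sol.
apply: der_eq (der_derive1 (sm 0%N s Is)) _; rewrite E.
by rewrite solution_prod // mulrCA -expiD Im_polar [- _ + _]addrC.
Qed.

(** Differentiating the identity x sin(phi) = y cos(phi) for w = x + iy avoids the
    derivative of the radius. *)
Lemma phi_der j (s : R) : I s ->
  is_derive s 1 (phi j) (- lam j * q s * sin (psi s) / radius w j s ^+ 2).
Proof.
move=> Is; apply: der_eq (phi_derivable j Is) _.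
pose g t := Rpart (w j t) * sin (phi j t) - Ipart (w j t) * cos (phi j t).
have dg := der_add (der_mul (Re_w_der j Is) (der_sin (phi_derivable j Is)))
  (der_opp (der_mul (Im_w_der j Is) (der_cos (phi_derivable j Is)))).
have g0 : \forall t \near s, 0 = g t.
  apply: filterS (open_nbhs_in oI Is) => t It.
  by rewrite /g Re_w // Im_w //; ring.
have := der_unique dg (der_near g0 (der_cst s 1 0)).
rewrite Re_w // Im_w // cosB sinB (q_split j).
have r0 := radius_gt0 j Is; set r := radius w j s in r0 *.
have := cos2Dsin2 (phi j s).
set c := cos (phi j s); set d := sin (phi j s); set p := derive1 _ s.
set cp := cos (psi s); set sp := sin (psi s); set ro := radius_others j s.
move=> cd H.
have : (c ^+ 2 + d ^+ 2) * (r * p) = (c ^+ 2 + d ^+ 2) * (- lam j * ro * sp).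
  apply/eqP; rewrite -subr_eq0; apply/eqP; rewrite -H; ring.
rewrite cd !mul1r => rp; apply: (mulfI (lt0r_neq0 r0)); rewrite rp.
by field; rewrite gt_eqF.
Qed.

Lemma radius_der (j : 'I_n) (s : R) : I s ->
  is_derive s 1 (fun t => radius w j t ^+ 2) (lam j * (2 * (q s * cos (psi s)))).
Proof.
move=> Is.
have dr := der_add (der_exp 2 (Re_w_der j Is)) (der_exp 2 (Im_w_der j Is)).
have sq z : Rpart z ^+ 2 + Ipart z ^+ 2 = Normc.normc z ^+ 2 :> R.
  by case: z => x y /=; rewrite sqr_sqrtr // addr_ge0 // sqr_ge0.
apply: der_ext (_ : _ =1 _) (der_eq dr _) => [t|]; first exact: sq.
rewrite /= !expr1 Re_w // Im_w // cosB sinB (q_split j).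
have := cos2Dsin2 (phi j s).
set c := cos (phi j s); set d := sin (phi j s) => cd.
have -> : lam j * (2 * (radius w j s * radius_others j s * cos (psi s))) =
  (c ^+ 2 + d ^+ 2) * (lam j * (2 * (radius w j s * radius_others j s * cos (psi s)))).
  by rewrite cd mul1r.
ring.
Qed.

Let q_continuous s : I s -> {for s, continuous q}.
Proof.
move=> Is.
have dr j : is_derive s 1 (radius w j)
    ((2 * Num.sqrt (radius w j s ^+ 2))^-1 * (lam j * (2 * (q s * cos (psi s))))).
  have r2 : 0 < radius w j s ^+ 2 by rewrite exprn_gt0 // radius_gt0.
  apply: (der_near _ (der_sqrt (f := fun t => radius w j t ^+ 2) r2 (radius_der j Is))).
  apply: filterS (open_nbhs_in oI Is) => t It.
  by rewrite sqrtr_sqr ger0_norm // ltW // radius_gt0.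
have cr j : {for s, continuous (radius w j)} by exact: der_continuous1 (dr j).
rewrite /q; elim: (index_enum _) => [|j r IH].
  have -> : (fun s => \prod_(j <- [::]) radius w j s) = cst 1.
    by apply: funext => t; rewrite big_nil.
  exact: cvg_cst.
have -> : (fun s => \prod_(k <- j :: r) radius w k s) =
    (fun s => radius w j s * \prod_(k <- r) radius w k s).
  by apply: funext => t; rewrite big_cons.
exact: continuousM.
Qed.

Lemma psi_der (s : R) : I s -> is_derive s 1 psi
  (\sum_j (- lam j * q s * sin (psi s) / radius w j s ^+ 2) - alpha * (q s * sin (psi s))).
Proof.
move=> Is; apply: der_add; last by apply: der_opp; exact: theta_der.
by apply: der_sum => j; exact: phi_der.
Qed.

Lemma ufun_der (s : R) : I s -> is_derive s 1 u (2 * (q s * cos (psi s))).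
Proof.
move=> Is; apply: der_mulc.
apply: (oint_der oI itvI Is0 Is) => z Iz.
apply: continuousM; first exact: q_continuous.
exact: der_continuous1 (der_cos (psi_der Iz)).
Qed.

Lemma ufun0 : u s0 = 0. Proof. by rewrite /u /ufun oint0 mulr0. Qed.

(** All r_j^2 have the same derivative up to the factor lam_j, namely lam_j u'. *)
Lemma radius_sq j s : I s -> radius w j s ^+ 2 = al j + lam j * u s.
Proof.
move=> Is.
have dz (t : R) : I t -> is_derive t 1 (fun t => radius w j t ^+ 2 - lam j * u t) 0.
  move=> It; have := der_add (radius_der j It) (der_opp (der_mulc (lam j) (ufun_der It))).
  by rewrite subrr.
have := cst_on itvI dz Is Is0; rewrite ufun0 mulr0 subr0 /al /alphas => <-.
by rewrite subrK.
Qed.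

Lemma alphas_gt0 j : 0 < al j.
Proof. by rewrite exprn_gt0 // radius_gt0. Qed.

Lemma lin_gt0 j s : I s -> 0 < al j + lam j * u s.
Proof. by move=> Is; rewrite -radius_sq // exprn_gt0 // radius_gt0. Qed.

Lemma radius_prod_sq s : I s -> q s ^+ 2 = (Qpoly lam al).[u s].
Proof.
by move=> Is; rewrite QpolyE -prodrXl; apply: eq_bigr => j _; exact: radius_sq.
Qed.

Lemma sin_psi s : I s -> q s * sin (psi s) = A * expR (- alpha * u s / 2).
Proof.
move=> Is; have := fi Is; rewrite /Qfun -/u -/al -/psi.
rewrite -QpolyE -radius_prod_sq // sqrtr_sqr ger0_norm ?ltW ?radius_prod_gt0 // => <-.
rewrite -/(psi s) !mulNr expRN.
by field; rewrite gt_eqF // expR_gt0.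
Qed.

Lemma phi_der_u j (s : R) : I s -> is_derive s 1 (phi j)
  (- lam j * (A * expR (- alpha * u s / 2)) / (al j + lam j * u s)).
Proof.
move=> Is; apply: der_eq (phi_der j Is) _.
by rewrite -radius_sq // -sin_psi // !mulrA.
Qed.

Lemma theta_der_u (s : R) : I s ->
  is_derive s 1 theta (alpha * (A * expR (- alpha * u s / 2))).
Proof. by move=> Is; rewrite -sin_psi //; exact: theta_der. Qed.

Let v s := 2 * (q s * cos (psi s)).

Lemma velocity_sq s : I s -> v s ^+ 2 = energy lam al alpha A (u s).
Proof.
move=> Is; rewrite /v /energy -radius_prod_sq //.
have -> : A ^+ 2 * expR (- alpha * u s) = (q s * sin (psi s)) ^+ 2.
  by rewrite sin_psi // exprMn -expRM_natl; congr (_ * expR _); field.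
have := cos2Dsin2 (psi s) => cs.
have -> : q s ^+ 2 = q s ^+ 2 * (cos (psi s) ^+ 2 + sin (psi s) ^+ 2) by rewrite cs mulr1.
ring.
Qed.

(** The first integral eliminates psi = phi - theta from the equations: u' is
    2 Q^{1/2} cos(psi), and A = Q^{1/2} e^{alpha u / 2} sin(psi) turns its derivative
    into a function of u alone. *)
Lemma solution_newton : newton I (force lam al alpha A) u v.
Proof.
move=> s Is; split; first exact: ufun_der.
have q0 := radius_prod_gt0 Is.
have dq : is_derive s 1 q ((2 * q s)^-1 * ((Qpoly lam al)^`().[u s] * v s)).
  have q2 : 0 < (Qpoly lam al).[u s] by rewrite -radius_prod_sq // exprn_gt0.
  have := der_sqrt (f := fun t => (Qpoly lam al).[u t]) q2 (der_comp (ufun_der Is) (is_derive_poly (Qpoly lam al) (u s))).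
  rewrite -radius_prod_sq // sqrtr_sqr ger0_norm ?ltW // => dq; apply: (der_near _ dq).
  apply: filterS (open_nbhs_in oI Is) => t It.
  by rewrite -radius_prod_sq // sqrtr_sqr ger0_norm // ltW // radius_prod_gt0.
apply: der_eq (der_mulc 2 (der_mul dq (der_cos (psi_der Is)))) _.
have pos j : 0 < al j + lam j * u s by exact: lin_gt0.
have := Qpoly_deriv pos; rewrite /force -radius_prod_sq //.
have -> : \sum_j - lam j * q s * sin (psi s) / radius w j s ^+ 2 =
    - (q s * sin (psi s)) * \sum_j lam j / (al j + lam j * u s).
  by rewrite mulr_sumr; apply: eq_bigr => j _; rewrite -radius_sq //; ring.
have := cos2Dsin2 (psi s).
rewrite /v -[alpha * _ * _]mulrA.
have -> : A ^+ 2 * expR (- alpha * u s) = (q s * sin (psi s)) ^+ 2.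
  by rewrite sin_psi // exprMn -expRM_natl; congr (_ * expR _); field.
set S := \sum_j _; set c := cos _; set d := sin _; set D := _.[u s].
move=> cd DE.
rewrite DE.
transitivity (2 * (q s ^+ 2 * S * (c ^+ 2 + d ^+ 2) + alpha * (q s * d) ^+ 2)).
  by field; rewrite gt_eqF.
by rewrite cd mulr1.
Qed.

End SolutionAnalysis.

(** * Recovering a solution from the motion of u *)

Section SmoothAlgebra.
Context {R : realType}.
Variable atom : (R -> R) -> Prop.

(** If the atoms have derivatives in the algebra they generate, then this algebra is
    closed under differentiation, and its members are smooth. *)
Inductive gen : (R -> R) -> Prop :=
| gen_atom f of atom f : gen f
| gen_cst c : gen (fun=> c)
| gen_add f g of gen f & gen g : gen (fun t => f t + g t)
| gen_mul f g of gen f & gen g : gen (fun t => f t * g t).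

Hypothesis atom_der : forall f, atom f ->
  exists g, gen g /\ forall t : R, is_derive t 1 f (g t).

Lemma gen_der f : gen f -> exists g, gen g /\ forall t : R, is_derive t 1 f (g t).
Proof.
elim=> {f} [f /atom_der //|c|f g _ [f' [gf' df]] _ [g' [gg' dg]]|f g gf [f' [gf' df]] gg [g' [gg' dg]]].
- by exists (fun=> 0); split=> [|t]; [exact: gen_cst|exact: der_cst].
- exists (fun t => f' t + g' t); split=> [|t]; first exact: gen_add.
  exact: der_add.
- exists (fun t => f' t * g t + f t * g' t); split=> [|t]; last exact: der_mul.
  by apply: gen_add; apply: gen_mul.
Qed.

Lemma gen_smooth f : gen f -> smooth_on1 setT f.
Proof.
move=> + k; elim: k f => [|k IH] f /gen_der [g [gg fg]] s _.
  by have [] := fg s.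
rewrite derive1Sn; have -> : derive1 f = g by apply: funext => t; exact: derive1_der.
exact: IH.
Qed.

Lemma gen_opp f : gen f -> gen (fun t => - f t).
Proof.
move=> gf; have -> : (fun t => - f t) = (fun t => -1 * f t).
  by apply: funext => t; rewrite mulN1r.
by apply: gen_mul gf; exact: gen_cst.
Qed.

Lemma gen_poly (p : {poly R}) f : gen f -> gen (fun t => p.[f t]).
Proof.
move=> gf; elim/poly_ind: p => [|p c IH].
  have -> : (fun t => (0 : {poly R}).[f t]) = (fun=> 0).
    by apply: funext => t; rewrite horner0.
  exact: gen_cst.
have -> : (fun t => (p * 'X + c%:P).[f t]) = (fun t => p.[f t] * f t + c).
  by apply: funext => t; rewrite !hornerE.
by apply: gen_add; [exact: gen_mul|exact: gen_cst].
Qed.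

End SmoothAlgebra.

Section Reconstruction.
Context {R : realType} {n : nat}.
Variables (lam al : 'I_n -> R) (alpha A : R) (U V : R -> R).
Variables (ph : 'I_n -> R -> R) (th : R -> R) (s0 : R).

Let ell j s := al j + lam j * U s.
Let e s := expR (- alpha * U s / 2).
Let rho j s := Num.sqrt (ell j s).
Let q s := Num.sqrt (Qpoly lam al).[U s].
Let psi s := phi_sum ph s - th s.

Hypothesis NU : newton setT (force lam al alpha A) U V.
Hypothesis EU : forall s, V s ^+ 2 = energy lam al alpha A (U s).
Hypothesis ell_gt0 : forall j s, 0 < ell j s.
Hypothesis ph_der : forall j (s : R), is_derive s 1 (ph j) (- lam j * (A * e s) / ell j s).
Hypothesis th_der : forall s : R, is_derive s 1 th (alpha * (A * e s)).
Hypothesis U0 : U s0 = 0.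
Hypothesis V0 : V s0 = 2 * (q s0 * cos (psi s0)).
Hypothesis A0 : A = q s0 * sin (psi s0).

Let U_der (s : R) : is_derive s 1 U (V s). Proof. by have [] := NU (I : setT s). Qed.

Let V_der (s : R) : is_derive s 1 V (force lam al alpha A (U s)).
Proof. by have [] := NU (I : setT s). Qed.

Let e_der (s : R) : is_derive s 1 e (e s * (- alpha / 2 * V s)).
Proof.
have -> : e = fun s => expR (- alpha / 2 * U s).
  by apply: funext => t; rewrite /e mulrAC.
exact: der_expR (der_mulc (- alpha / 2) (U_der s)).
Qed.

Let e_sq s : expR (- alpha * U s) = e s ^+ 2.
Proof. by rewrite /e -expRM_natl; congr expR; field. Qed.

Let ell_der j (s : R) : is_derive s 1 (ell j) (lam j * V s).
Proof. by apply: der_eq (der_add (der_cst s 1 (al j)) (der_mulc (lam j) (U_der s))) (add0r _). Qed.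

Let rho_gt0 j s : 0 < rho j s. Proof. by rewrite sqrtr_gt0. Qed.
Let rho_sq j s : rho j s ^+ 2 = ell j s. Proof. by rewrite sqr_sqrtr // ltW. Qed.

Let rho_der j (s : R) : is_derive s 1 (rho j) ((2 * rho j s)^-1 * (lam j * V s)).
Proof. by apply: (der_sqrt (f := ell j)); [exact: ell_gt0|exact: ell_der]. Qed.

Let Q_gt0 s : 0 < (Qpoly lam al).[U s].
Proof. by apply: Qpoly_gt0 => j; exact: ell_gt0. Qed.

Let q_gt0 s : 0 < q s. Proof. by rewrite sqrtr_gt0. Qed.
Let q_sq s : q s ^+ 2 = (Qpoly lam al).[U s]. Proof. by rewrite sqr_sqrtr // ltW. Qed.

Let q_prod s : q s = \prod_j rho j s.
Proof.
apply/eqP; rewrite -(@eqrXn2 _ 2) //; last by apply: prodr_ge0 => j _; exact: ltW.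
  by rewrite q_sq QpolyE -prodrXl; apply/eqP/eq_bigr => j _; rewrite rho_sq.
exact: ltW.
Qed.

Let S s := \sum_j lam j / ell j s.

Let psi_der' (s : R) : is_derive s 1 psi (- (S s + alpha) * (A * e s)).
Proof.
have H := der_add (der_sum (fun j => ph_der j s)) (der_opp (th_der s)).
apply: der_eq H _.
rewrite mulNr mulrDl opprD mulr_suml -sumrN; congr (_ + _).
by apply: eq_bigr => j _; ring.
Qed.

Let q_der (s : R) : is_derive s 1 q (q s * S s * (V s / 2)).
Proof.
have H := der_sqrt (f := fun t => (Qpoly lam al).[U t]) (Q_gt0 s)
  (der_comp (U_der s) (is_derive_poly (Qpoly lam al) (U s))).
apply: der_eq H _; rewrite Qpoly_deriv -/(S s); last by move=> j; exact: ell_gt0.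
rewrite -/(q s) -q_sq; field; rewrite gt_eqF //.
Qed.

(** In the plane of (u'/2, A e^{-alpha u/2}), whose square norm is Q by
    conservation of energy, the unit direction turns exactly at the rate psi'. *)
Let polar_velocity s : V s / 2 = q s * cos (psi s) /\ A * e s = q s * sin (psi s).
Proof.
pose N s := V s / 2 * cos (psi s) + A * e s * sin (psi s).
have norm t : (V t / 2) ^+ 2 + (A * e t) ^+ 2 = q t ^+ 2.
  by rewrite expr_div_n EU /energy e_sq q_sq; field.
have dg (t : R) : setT t -> is_derive t 1 (fun t => N t * (q t)^-1) 0.
  move=> _.
  have Vd2 : is_derive t 1 (fun t => V t / 2) (force lam al alpha A (U t) / 2).
    have := der_mul (V_der t) (der_cst t 1 2^-1); rewrite mulr0 addr0.
    exact.
  have H := der_mul (der_add (der_mul Vd2 (der_cos (psi_der' t)))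
     (der_mul (der_mulc A (e_der t)) (der_sin (psi_der' t)))) (der_inv (lt0r_neq0 (q_gt0 t)) (q_der t)).
  apply: der_eq H _; rewrite /force e_sq Qpoly_deriv -/(S t); last by move=> j; exact: ell_gt0.
  rewrite -q_sq; have := norm t; have := q_gt0 t.
  set c := cos _; set d := sin _; set x := V t; set y := e t; set Q := q t => Q0 nm.
  have -> : 2 * (Q ^+ 2 * S t + alpha * A ^+ 2 * y ^+ 2) / 2 =
    ((x / 2) ^+ 2 + (A * y) ^+ 2) * S t + alpha * A ^+ 2 * y ^+ 2 by rewrite nm; field.
  by field; rewrite gt_eqF.
have Nq : N s = q s.
  have := cst_on intervalT dg (I : setT s) (I : setT s0).
  have e0 : e s0 = 1 by rewrite /e U0 mulr0 mul0r expR0.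
  have Ns0 : N s0 = q s0.
    transitivity (q s0 * (cos (psi s0) ^+ 2 + sin (psi s0) ^+ 2)).
      by rewrite /N V0 e0 mulr1 {1}A0; field.
    by rewrite cos2Dsin2 mulr1.
  rewrite Ns0 divff ?gt_eqF // => H.
  by rewrite -[N s](divfK (lt0r_neq0 (q_gt0 s))) H mul1r.
have := norm s; have cd := cos2Dsin2 (psi s); move: Nq cd; rewrite /N.
set c := cos _; set d := sin _; set x := V s / 2; set y := A * e s => Nq cd nm.
have P0 : x * d - y * c = 0.
  apply/eqP; rewrite -sqrf_eq0; apply/eqP.
  have -> : (x * d - y * c) ^+ 2 = (x ^+ 2 + y ^+ 2) * (c ^+ 2 + d ^+ 2) - (x * c + y * d) ^+ 2.
    by ring.
  by rewrite nm Nq cd mulr1 subrr.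
split.
  have -> : x = x * (c ^+ 2 + d ^+ 2) by rewrite cd mulr1.
  have -> : x * (c ^+ 2 + d ^+ 2) = (x * c + y * d) * c + (x * d - y * c) * d by ring.
  by rewrite P0 Nq mul0r addr0.
have -> : y = y * (c ^+ 2 + d ^+ 2) by rewrite cd mulr1.
have -> : y * (c ^+ 2 + d ^+ 2) = (x * c + y * d) * d - (x * d - y * c) * c by ring.
by rewrite P0 Nq mul0r subr0.
Qed.

(** The solution whose squared radii are al_j + lam_j U. *)
Definition rebuilt (j : 'I_n) s : R[i] := (rho j s)%:C * expi (ph j s).

Let radius_rebuilt j s : radius rebuilt j s = rho j s.
Proof. by rewrite /radius normc_polar // ltW. Qed.

Let atom (f : R -> R) : Prop :=
  [\/ f = U, f = V, f = e | f = th] \/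
  exists j, [\/ f = ph j, f = rho j, f = (fun t => (rho j t)^-1) |
               f = (fun t => cos (ph j t)) \/ f = (fun t => sin (ph j t))].

Let atom_gen f : atom f -> gen atom f. Proof. exact: gen_atom. Qed.
Let gU : gen atom U. Proof. by apply: atom_gen; left; constructor 1. Qed.
Let gV : gen atom V. Proof. by apply: atom_gen; left; constructor 2. Qed.
Let ge : gen atom e. Proof. by apply: atom_gen; left; constructor 3. Qed.
Let gth : gen atom th. Proof. by apply: atom_gen; left; constructor 4. Qed.
Let gph j : gen atom (ph j). Proof. by apply: atom_gen; right; exists j; constructor 1. Qed.
Let grho j : gen atom (rho j). Proof. by apply: atom_gen; right; exists j; constructor 2. Qed.
Let grhoV j : gen atom (fun t => (rho j t)^-1).
Proof. by apply: atom_gen; right; exists j; constructor 3. Qed.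
Let gcos j : gen atom (fun t => cos (ph j t)).
Proof. by apply: atom_gen; right; exists j; constructor 4; left. Qed.
Let gsin j : gen atom (fun t => sin (ph j t)).
Proof. by apply: atom_gen; right; exists j; constructor 4; right. Qed.

Let gAe : gen atom (fun t => A * e t).
Proof. by apply: gen_mul ge; exact: gen_cst. Qed.

Let gph' j : gen atom (fun t => - lam j * (A * e t) * (rho j t)^-1 * (rho j t)^-1).
Proof.
apply: gen_mul (grhoV j); apply: gen_mul (grhoV j).
by apply: gen_mul gAe; exact: gen_cst.
Qed.

Let ph'E j t : - lam j * (A * e t) * (rho j t)^-1 * (rho j t)^-1 = - lam j * (A * e t) / ell j t.
Proof. by rewrite -rho_sq expr2 invfM !mulrA. Qed.

Let atom_closed f : atom f -> exists g, gen atom g /\ forall t : R, is_derive t 1 f (g t).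
Proof.
have grho' j : gen atom (fun t => 2^-1 * (rho j t)^-1 * (lam j * V t)).
  apply: gen_mul; first by apply: gen_mul (grhoV j); exact: gen_cst.
  by apply: gen_mul gV; exact: gen_cst.
case=> [[->|->|->|->]|[j [->|->|->|[->|->]]]].
- by exists V.
- exists (fun t => force lam al alpha A (U t)); split=> //.
  have -> : (fun t => force lam al alpha A (U t)) =
      (fun t => 2 * ((Qpoly lam al)^`().[U t] + alpha * A ^+ 2 * (e t * e t))).
    by apply: funext => t; rewrite /force e_sq.
  apply: gen_mul; first exact: gen_cst.
  apply: gen_add; first exact: gen_poly.
  by apply: gen_mul; [exact: gen_cst|exact: gen_mul].
- exists (fun t => e t * (- alpha / 2 * V t)); split=> //.
  by apply: gen_mul => //; apply: gen_mul gV; exact: gen_cst.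
- exists (fun t => alpha * (A * e t)); split=> //.
  by apply: gen_mul gAe; exact: gen_cst.
- exists (fun t => - lam j * (A * e t) * (rho j t)^-1 * (rho j t)^-1); split=> // t.
  by rewrite ph'E.
- exists (fun t => 2^-1 * (rho j t)^-1 * (lam j * V t)); split=> // t.
  by rewrite -invfM.
- exists (fun t => - ((rho j t)^-1 * (rho j t)^-1) * (2^-1 * (rho j t)^-1 * (lam j * V t))).
  split=> [|t]; first by apply: gen_mul => //; apply: gen_opp; exact: gen_mul.
  by rewrite -invfM -expr2 -invfM; apply: der_inv; rewrite ?gt_eqF.
- exists (fun t => - sin (ph j t) * (- lam j * (A * e t) * (rho j t)^-1 * (rho j t)^-1)).
  split=> [|t]; first by apply: gen_mul => //; exact: gen_opp.
  by rewrite ph'E; exact: der_cos.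
- exists (fun t => cos (ph j t) * (- lam j * (A * e t) * (rho j t)^-1 * (rho j t)^-1)).
  split=> [|t]; first by apply: gen_mul.
  by rewrite ph'E; exact: der_sin.
Qed.

Let smoothP f : gen atom f -> smooth_on1 setT f.
Proof. by move=> gf; exact: (@gen_smooth _ atom atom_closed f gf). Qed.

Let Re_rebuilt j : (fun s => Rpart (rebuilt j s)) = fun s => rho j s * cos (ph j s).
Proof. by apply: funext => s; rewrite Re_polar. Qed.

Let Im_rebuilt j : (fun s => Ipart (rebuilt j s)) = fun s => rho j s * sin (ph j s).
Proof. by apply: funext => s; rewrite Im_polar. Qed.

Lemma rebuilt_polar_lift : polar_lift setT rebuilt ph.
Proof.
split=> [j|j s _]; first exact: smoothP.
by rewrite radius_rebuilt.
Qed.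

Lemma rebuilt_solution : solution setT lam alpha rebuilt th.
Proof.
split.
- move=> j; split; rewrite ?Re_rebuilt ?Im_rebuilt; apply: smoothP; exact: gen_mul.
- exact: smoothP.
- by move=> j s _; rewrite mulf_neq0 ?expi_neq0 // eq_complex /= gt_eqF.
- move=> j s _; have [Vq Ae] := polar_velocity s.
  rewrite /rebuilt polar_prod polarJ -[RHS]mulrA.
  have rj := rho_gt0 j s.
  have -> : expi (th s) * ((\prod_(k | k != j) rho k s)%:C * expi (- \sum_(k | k != j) ph k s))
    = (q s / rho j s)%:C * expi (ph j s - psi s) :> R[i].
    rewrite mulrCA -expiD q_prod [in RHS](bigD1 j) //= [rho j s * _]mulrC mulfK ?gt_eqF //.
    by congr (_ * expi _); rewrite /psi /phi_sum [in RHS](bigD1 j) //=; ring.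
  rewrite -[LHS]/(Cderive1 (rebuilt j) s) /Cderive1 Re_rebuilt Im_rebuilt.
  have V2 : V s = 2 * (q s * cos (psi s)) by rewrite -Vq mulrC divfK.
  rewrite (derive1_der (der_mul (rho_der j s) (der_cos (ph_der j s)))).
  rewrite (derive1_der (der_mul (rho_der j s) (der_sin (ph_der j s)))).
  rewrite -rho_sq Ae V2; move: (psi s) => p; apply: complex_ext.
    rewrite /= /expi; simpc; rewrite /= cosB; field; rewrite gt_eqF //.
  rewrite /= /expi; simpc; rewrite /= sinB; field; rewrite gt_eqF //.
- move=> s _; have [_ Ae] := polar_velocity s.
  rewrite (derive1_der (th_der s)) /rebuilt polar_prod [expi _ * _]mulrCA -expiD Im_polar.
  by rewrite -q_prod [- _ + _]addrC -/(psi s) Ae.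
Qed.

Let cos_velocity s : \prod_j radius rebuilt j s * cos (phi_sum ph s - th s) = V s / 2.
Proof.
have [-> _] := polar_velocity s; rewrite q_prod; congr (_ * _).
by apply: eq_bigr => j _; rewrite radius_rebuilt.
Qed.

Lemma rebuilt_ufun s : ufun rebuilt th ph s0 s = U s.
Proof.
rewrite /ufun.
have -> : (fun t => \prod_j radius rebuilt j t * cos (phi_sum ph t - th t)) = fun t => V t / 2.
  by apply: funext => t; exact: cos_velocity.
have dz (t : R) : setT t -> is_derive t 1 (fun t => 2 * oint s0 t (fun t => V t / 2) - U t) 0.
  move=> _; have cV z : {for z, continuous (fun t => V t / 2)}.
    by apply: continuousM; [exact: der_continuous1 (V_der z)|exact: cvg_cst].
  have H := @oint_der _ setT (fun t => V t / 2) s0 t openT intervalT I I (fun z _ => cV z).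
  apply: der_eq (der_add (der_mulc 2 H) (der_opp (U_der t))) _; by field.
have := cst_on intervalT dz (I : setT s) (I : setT s0).
by rewrite oint0 U0 mulr0 subrr => /eqP; rewrite subr_eq0 => /eqP.
Qed.

Lemma rebuilt_alphas j : alphas rebuilt s0 j = al j.
Proof. by rewrite /alphas radius_rebuilt rho_sq /ell U0 mulr0 addr0. Qed.

Lemma rebuilt_first_integral : first_integral setT lam alpha rebuilt th ph s0 A.
Proof.
move=> s _; rewrite rebuilt_ufun /Qfun.
have -> : \prod_j (alphas rebuilt s0 j + lam j * U s) = (Qpoly lam al).[U s].
  by rewrite QpolyE; apply: eq_bigr => j _; rewrite rebuilt_alphas.
have [_ Ae] := polar_velocity s.
have eV : e s * expR (alpha * U s / 2) = 1.
  by rewrite /e -expRD (_ : _ + _ = 0) ?expR0 //; ring.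
by rewrite -/(q s) -/(psi s) mulrAC -Ae -[A * e s * _]mulrA eV mulr1.
Qed.

End Reconstruction.

(** * Global solutions: extension, periodicity and rest *)

Section Dynamics.
Context {R : realType} {n : nat}.
Variables (lam : 'I_n -> R) (C alpha A : R).
Hypotheses (n_gt0 : (1 <= n)%N) (hcase : case_a lam C alpha A \/ case_b lam C A).

Lemma case_lam j : lam j = 1 \/ lam j = -1.
Proof.
by case: hcase => [[-> _ _ _]|[m [_ -> _ _]]]; [left|case: ifP; [left|right]].
Qed.

Lemma case_lam_sq j : lam j ^+ 2 = 1.
Proof. by case: (case_lam j) => ->; rewrite ?sqrrN expr1n. Qed.

Lemma case_lam_neq0 j : lam j != 0.
Proof. by rewrite -sqrf_eq0 case_lam_sq oner_eq0. Qed.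

Lemma case_A_gt0 : 0 < A.
Proof. by case: hcase => [[_ _ _ ?]|[m [_ _ _ ?]]]. Qed.

Lemma case_C : C = 1.
Proof. by case: hcase => [[_ ? _ _]|[m [_ _ ? _]]]. Qed.

Section OnInterval.
Variables (I : set R) (s0 : R) (w : 'I_n -> R -> R[i]) (theta : R -> R) (phi : 'I_n -> R -> R).
Hypotheses (oI : open I) (itvI : is_interval I) (Is0 : I s0).
Hypothesis sol : solution I lam alpha w theta.
Hypothesis pol : polar_lift I w phi.
Hypothesis fi : first_integral I lam alpha w theta phi s0 A.

Let psi s := phi_sum phi s - theta s.
Let q s := \prod_j radius w j s.
Let u := ufun w theta phi s0.
Let al := alphas w s0.
Let v s := 2 * (q s * cos (psi s)).

Lemma solution_confined : exists a b : R, [/\ a < 0 < b,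
    energy lam al alpha A a < 0, energy lam al alpha A b < 0,
    forall x, a < x < b -> forall j, 0 < al j + lam j * x
  & forall s, I s -> a < u s < b].
Proof.
have [j|a [b [ab ea eb pos]]] := barriers n_gt0 hcase (al := al).
  exact: alphas_gt0 Is0 sol j.
exists a, b; split=> // s Is.
apply: (@confined _ I (energy lam al alpha A) u a b s0 s itvI) => //.
- by move=> t It; exact: der_continuous1 (ufun_der oI itvI Is0 sol pol It).
- move=> t It; rewrite -(velocity_sq oI itvI Is0 sol pol fi It).
  exact: sqr_ge0.
- by rewrite /u ufun0.
Qed.

(** The motion u on I is the restriction of a motion U defined for all times, from
    which the angles are recovered by integration and the w_j from their moduli
    and angles. *)
Lemma extend_solution :
  exists (w' : 'I_n -> R -> R[i]) (theta' : R -> R) (phi' : 'I_n -> R -> R),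
      [/\ solution setT lam alpha w' theta',
          polar_lift setT w' phi',
          first_integral setT lam alpha w' theta' phi' s0 A
        & forall s, I s ->
            (forall j, w' j s = w j s /\ phi' j s = phi j s) /\
            theta' s = theta s].
Proof.
have [a [b [/andP[a0 b0] ea eb pos uab]]] := solution_confined.
have ab : a <= b by rewrite ltW // (lt_trans a0).
have u0 : u s0 = 0 by exact: ufun0.
have [|U1 [V1 [N1 U10 V10 E1 U1ab]]] :=
    @force_confined _ _ lam al alpha A a b (v s0) _ ea eb (etrans (velocity_sq oI itvI Is0 sol pol fi Is0) (congr1 _ u0)).
  by rewrite a0.
pose U s := U1 (s - s0); pose V s := V1 (s - s0).
have NU : newton setT (force lam al alpha A) U V by exact: newton_shift.
have Us0 : U s0 = 0 by rewrite /U subrr.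
have Vs0 : V s0 = v s0 by rewrite /V subrr.
have [L L0 lipF] := force_lipschitz lam al alpha A ab.
have weak x : a < x < b -> [set x | a <= x <= b] x by move=> /andP[? ?] /=; rewrite !ltW.
have Uu s : I s -> U s = u s /\ V s = v s.
  apply: (newton_unique itvI Is0 (ltW L0) lipF (fun t _ => NU t Logic.I)
    (solution_newton oI itvI Is0 sol pol fi)) => //.
  - by move=> t _; apply: weak; exact: U1ab.
  - by move=> t It; apply: weak; exact: uab.
  - by rewrite Us0 -u0.
have ell_gt0 j s : 0 < al j + lam j * U s by apply: pos; exact: U1ab.
have U_der (s : R) : is_derive s 1 U (V s) by have [] := NU s Logic.I.
have e_der (s : R) : exists d, is_derive s 1 (fun s => A * expR (- alpha * U s / 2)) d.
  have H := der_mulc A (der_expR (der_mul (der_mulc (- alpha) (U_der s)) (der_cst s 1 2^-1))).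
  by eexists; exact: H.
have ex_phi j : exists p : R -> R, p s0 = phi j s0 /\ forall s : R, is_derive s 1 p
    (- lam j * (A * expR (- alpha * U s / 2)) / (al j + lam j * U s)).
  have c : continuous (fun s => - lam j * (A * expR (- alpha * U s / 2)) / (al j + lam j * U s)).
    move=> s; have [d de] := e_der s.
    have H := der_add (der_cst s 1 (al j)) (der_mulc (lam j) (U_der s)).
    have Hi := der_inv (f := fun t => al j + lam j * U t) (lt0r_neq0 (ell_gt0 j s)) H.
    exact: der_continuous1 (der_mul (der_mulc (- lam j) de) Hi).
  have [p [p0 dp]] := antiderivative s0 c.
  exists (fun s => phi j s0 + p s); split=> [|s]; first by rewrite p0 addr0.
  exact: der_eq (der_add (der_cst s 1 (phi j s0)) (dp s)) (add0r _).
have {ex_phi} /choice [ph ph_spec] := ex_phi.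
have [th [th0 th_der]] : exists p : R -> R, p s0 = theta s0 /\ forall s : R, is_derive s 1 p
    (alpha * (A * expR (- alpha * U s / 2))).
  have c : continuous (fun s => alpha * (A * expR (- alpha * U s / 2))).
    by move=> s; have [d de] := e_der s; exact: der_continuous1 (der_mulc alpha de).
  have [p [p0 dp]] := antiderivative s0 c.
  exists (fun s => theta s0 + p s); split=> [|s]; first by rewrite p0 addr0.
  exact: der_eq (der_add (der_cst s 1 (theta s0)) (dp s)) (add0r _).
have ph0 j : ph j s0 = phi j s0 by have [] := ph_spec j.
have ph_der j (s : R) : is_derive s 1 (ph j)
    (- lam j * (A * expR (- alpha * U s / 2)) / (al j + lam j * U s)) by have [_] := ph_spec j.
have phs : phi_sum ph s0 = phi_sum phi s0 by apply: eq_bigr => j _.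
have q0E : Num.sqrt (Qpoly lam al).[U s0] = q s0.
  rewrite Us0 -u0 -(radius_prod_sq oI itvI Is0 sol pol Is0) sqrtr_sqr ger0_norm //.
  by rewrite ltW // (radius_prod_gt0 sol Is0).
have V0 : V s0 = 2 * (Num.sqrt (Qpoly lam al).[U s0] * cos (phi_sum ph s0 - th s0)).
  by rewrite Vs0 q0E phs th0.
have A0 : A = Num.sqrt (Qpoly lam al).[U s0] * sin (phi_sum ph s0 - th s0).
  rewrite q0E phs th0 (sin_psi oI itvI Is0 sol pol fi Is0).
  by rewrite -/u u0 mulr0 mul0r expR0 mulr1.
have E s : V s ^+ 2 = energy lam al alpha A (U s) by exact: E1.
exists (rebuilt lam al U ph), th, ph; split.
- exact: (rebuilt_solution NU E ell_gt0 ph_der th_der Us0 V0 A0).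
- exact: (rebuilt_polar_lift NU ell_gt0 ph_der th_der).
- exact: (rebuilt_first_integral NU E ell_gt0 ph_der th_der Us0 V0 A0).
move=> s Is.
have phE j t : I t -> ph j t = phi j t.
  move=> It; have dz (z : R) : I z -> is_derive z 1 (fun t => ph j t - phi j t) 0.
    move=> Iz; have [Uz _] := Uu z Iz.
    apply: der_eq (der_add (ph_der j z) (der_opp (phi_der_u oI itvI Is0 sol pol fi j Iz))) _.
    by rewrite Uz subrr.
  have := cst_on itvI dz It Is0.
  by rewrite ph0 subrr => /eqP; rewrite subr_eq0 => /eqP.
split=> [j|].
  split; last exact: phE.
  have [_ /(_ j s Is) ->] := pol; rewrite /rebuilt phE //; congr (_%:C * _).
  have [-> _] := Uu s Is.
  rewrite -(radius_sq oI itvI Is0 sol pol j Is) sqrtr_sqr ger0_norm // ltW //.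
  exact: radius_gt0 sol j s Is.
have dz (z : R) : I z -> is_derive z 1 (fun t => th t - theta t) 0.
  move=> Iz; have [Uz _] := Uu z Iz.
  apply: der_eq (der_add (th_der z) (der_opp (theta_der_u oI itvI Is0 sol pol fi Iz))) _.
  by rewrite Uz subrr.
have := cst_on itvI dz Is Is0.
by rewrite th0 subrr => /eqP; rewrite subr_eq0 => /eqP.
Qed.

End OnInterval.

(** Between two values that differ by a nonzero multiple of 2 pi, f would cross a
    value where the sine is negative. *)
Lemma lift_unique (f : R -> R) s t : continuous f -> (forall x, 0 < sin (f x)) ->
  sin (f s) = sin (f t) -> cos (f s) = cos (f t) -> f s = f t.
Proof.
move=> cf pf.
suff aux x y : sin (f x) = sin (f y) -> cos (f x) = cos (f y) -> f x < f y -> False.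
  move=> es ec; have [h|h|//] := ltgtP (f s) (f t); first by case: (aux s t es ec h).
  by case: (aux t s (esym es) (esym ec) h).
move=> es ec xy.
have sd : sin (f y - f x) = 0 by rewrite sinB es ec; ring.
have cc x' : {for x', continuous f} by exact: cf.
have no z : f z != f x + pi.
  by apply/eqP => fz; have := pf z; rewrite fz sinDpi oppr_gt0 ltNge ltW.
have := ivt_avoid intervalT (fun t _ => cc t) (fun t _ => no t) (I : setT x) (I : setT y).
rewrite ltrDl pi_gt0 => /esym h.
have : 0 < sin (f y - f x) by rewrite sin_gt0_pi // subr_gt0 xy /=; lra.
by rewrite sd ltxx.
Qed.

Section Global.
Variables (s0 : R) (w : 'I_n -> R -> R[i]) (theta : R -> R) (phi : 'I_n -> R -> R).
Hypothesis sol : solution setT lam alpha w theta.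
Hypothesis pol : polar_lift setT w phi.
Hypothesis fi : first_integral setT lam alpha w theta phi s0 A.

Let psi s := phi_sum phi s - theta s.
Let q s := \prod_j radius w j s.
Let u := ufun w theta phi s0.
Let al := alphas w s0.
Let v s := 2 * (q s * cos (psi s)).

Let NU : newton setT (force lam al alpha A) u v.
Proof. exact: (solution_newton openT intervalT I sol pol fi). Qed.

Let EU s : v s ^+ 2 = energy lam al alpha A (u s).
Proof. exact: (velocity_sq openT intervalT I sol pol fi I). Qed.

Let u0 : u s0 = 0. Proof. exact: ufun0. Qed.

Let al_gt0 j : 0 < al j. Proof. exact: (@alphas_gt0 _ _ setT lam alpha w theta s0 I sol j). Qed.

Let ph_der j (s : R) : is_derive s 1 (phi j)
  (- lam j * (A * expR (- alpha * u s / 2)) / (al j + lam j * u s)).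
Proof. exact: (phi_der_u openT intervalT I sol pol fi j I). Qed.

Let th_der (s : R) : is_derive s 1 theta (alpha * (A * expR (- alpha * u s / 2))).
Proof. exact: (theta_der_u openT intervalT I sol pol fi I). Qed.

Lemma al_pos j : 0 < al j. Proof. exact: al_gt0. Qed.

Lemma theta_cst : alpha = 0 -> forall s, theta s = theta 0.
Proof.
move=> a0 s; have dz (z : R) : setT z -> is_derive z 1 theta 0.
  by move=> _; apply: der_eq (th_der z) _; rewrite a0 mul0r.
exact: cst_on intervalT dz (I : setT s) (I : setT 0).
Qed.

Let confined_global : exists a b : R, [/\ a < b,
    forall x, a < x < b -> forall j, 0 < al j + lam j * x,
    forall s, a < u s < b, energy lam al alpha A a < 0 & energy lam al alpha A b < 0].
Proof.
have [a [b [/andP[a0 b0] ea eb pos uab]]] := solution_confined openT intervalT I sol pol fi.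
by exists a, b; split=> //; [exact: lt_trans b0|move=> s; exact: uab].
Qed.

Let psi_continuous : continuous psi.
Proof.
move=> s; have H := der_add (der_sum (fun j => ph_der j s)) (der_opp (th_der s)).
exact: der_continuous1 H.
Qed.

Let sin_psiE s : q s * sin (psi s) = A * expR (- alpha * u s / 2).
Proof. exact: (sin_psi openT intervalT I sol pol fi I). Qed.

Let q_gt0 s : 0 < q s. Proof. exact: (radius_prod_gt0 sol I). Qed.

Let sin_psi_gt0 s : 0 < sin (psi s).
Proof. by rewrite -(pmulr_rgt0 _ (q_gt0 s)) sin_psiE mulr_gt0 ?expR_gt0 // case_A_gt0. Qed.

Let q_sq s : q s ^+ 2 = (Qpoly lam al).[u s].
Proof. exact: (radius_prod_sq openT intervalT I sol pol I). Qed.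

Let q_of_u s t : u s = u t -> q s = q t.
Proof.
move=> ust; apply/eqP; rewrite -(@eqrXn2 _ 2) ?ltW //.
by rewrite !q_sq ust.
Qed.

(** The motion has two turning points unless it tends to a rest point m. By the
    uniqueness of rest points it would then be constant, m = u(s0) = 0, and the
    equations for a rest point at 0 are those of case_i. Once u is periodic, the
    derivatives of the angles, being functions of u, are periodic too. *)
Lemma periodic_motion : ~ case_i lam alpha w s0 A ->
  exists (S : R) (gamma : 'I_n -> R),
    [/\ 0 < S,
        forall s, phi_sum phi (s + S) - theta (s + S) = phi_sum phi s - theta s,
        forall s,
          [/\ u (s + S) = u s,
              forall j, phi j (s + S) = phi j s + gamma j,
              phi_sum phi (s + S) = phi_sum phi s + \sum_j gamma j
            & theta (s + S) = theta s + \sum_j gamma j]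
      & case_b lam C A -> alpha = 0 -> \sum_j gamma j = 0].
Proof.
move=> not_i; have [a [b [ab pos uab ea eb]]] := confined_global.
have wk s : a <= u s <= b by have /andP[? ?] := uab s; rewrite !ltW.
have [L L0 lipF] := force_lipschitz lam al alpha A (ltW ab).
have [s1 [s2 [s12 v1 v2]]] : exists s1 s2, [/\ s1 < s2, v s1 = 0 & v s2 = 0].
  apply: (two_turning_points (@force_continuous _ _ lam al alpha A)
    (@energy_continuous _ _ lam al alpha A) NU wk EU) => m /andP[am mb] em fm.
  have mab : a < m < b.
    rewrite !lt_neqAle am mb !andbT; apply/andP; split; apply/eqP => e.
      by rewrite e em ltxx in ea.
    by rewrite -e em ltxx in eb.
  have um s : u s = m.
    apply: (rest_point_unique (Ordinal n_gt0) case_lam_neq0 pos mab em fm (uab s)).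
    by rewrite -EU sqr_ge0.
  have m0 : m = 0 by rewrite -(um s0).
  apply: not_i; split.
    have := rest_point_balance (pos m mab) em fm; rewrite m0.
    by under eq_bigr do rewrite mulr0 addr0.
  have := energy_zero em; rewrite m0 mulr0 expR0 mulr1 => <-.
  by rewrite QpolyE; apply: eq_bigr => j _; rewrite mulr0 addr0.
pose S := 2 * (s2 - s1).
have per s : u (s + S) = u s /\ v (s + S) = v s.
  exact: (newton_periodic (ltW L0) lipF NU wk v1 v2 s).
have psiS s : psi (s + S) = psi s.
  have [uS vS] := per s; have qS : q (s + S) = q s by exact: q_of_u.
  have q0 := lt0r_neq0 (q_gt0 s).
  apply: lift_unique => //; apply: (mulfI q0).
    by rewrite -{1}qS !sin_psiE uS.
  have : 2 * (q (s + S) * cos (psi (s + S))) = 2 * (q s * cos (psi s)) by exact: vS.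
  by rewrite qS => H; apply: (mulfI (_ : 2 != 0 :> R)).
pose gamma j := phi j (0 + S) - phi j 0.
have shift_der (f df : R -> R) : (forall s : R, is_derive s 1 f (df s)) ->
    (forall s, df (s + S) = df s) -> forall s, f (s + S) - f s = f (0 + S) - f 0.
  move=> fdf dfS s.
  have dz (z : R) : setT z -> is_derive z 1 (fun t => f (t + S) - f t) 0.
    move=> _; have ds : is_derive z 1 (fun t : R => t + S) 1.
      by apply: der_eq (der_add (is_derive_id z 1) (der_cst z 1 S)) (addr0 _).
    apply: der_eq (der_add (der_comp ds (fdf (z + S))) (der_opp (fdf z))) _.
    by rewrite mulr1 dfS subrr.
  exact: cst_on intervalT dz (I : setT s) (I : setT 0).
have phiS j s : phi j (s + S) = phi j s + gamma j.
  rewrite /gamma -(shift_der (phi j) _ (ph_der j) _ s) ?[phi j s + _]addrC ?subrK // => t.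
  by have [-> _] := per t.
have sumS s : phi_sum phi (s + S) = phi_sum phi s + \sum_j gamma j.
  by rewrite /phi_sum -big_split; apply: eq_bigr => j _; exact: phiS.
have thS s : theta (s + S) = theta s + \sum_j gamma j.
  by have := psiS s; rewrite /psi sumS => H; lra.
exists S, gamma; split=> //.
- by rewrite /S mulr_gt0 // subr_gt0.
- by move=> s; have [uS _] := per s; split.
- move=> _ /theta_cst th0; have := thS 0; rewrite th0 => H; lra.
Qed.

Hypothesis resonant : case_i lam alpha w s0 A.

(** The two equations of case_i say that 0 is a rest point of the motion. *)
Lemma resonant_rest s : u s = 0.
Proof.
have [a [b [ab pos uab ea eb]]] := confined_global.
have wk s' : a <= u s' <= b by have /andP[? ?] := uab s'; rewrite !ltW.
have [L L0 lipF] := force_lipschitz lam al alpha A (ltW ab).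
have [bal prd] := resonant.
have pos0 j : 0 < al j + lam j * 0 by rewrite mulr0 addr0.
have Q0 : (Qpoly lam al).[0] = A ^+ 2.
  by rewrite QpolyE -prd; apply: eq_bigr => j _; rewrite mulr0 addr0.
have E0 : energy lam al alpha A 0 = 0.
  by rewrite /energy Q0 mulr0 expR0 mulr1 subrr mulr0.
have F0 : force lam al alpha A 0 = 0.
  rewrite /force Qpoly_deriv // Q0 mulr0 expR0 mulr1.
  have -> : \sum_j lam j / (al j + lam j * 0) = \sum_j lam j / al j.
    by apply: eq_bigr => j _; rewrite mulr0 addr0.
  by rewrite [alpha * _]mulrC -mulrDr bal !mulr0.
have v0 : v s0 = 0 by apply/eqP; rewrite -sqrf_eq0 EU u0 E0.
have rest : newton setT (force lam al alpha A) (fun=> 0) (fun=> 0).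
  by move=> t _; rewrite F0; split; exact: der_cst.
have m0 : a <= 0 <= b by rewrite -u0.
have [] := newton_unique intervalT (I : setT s0) (ltW L0) lipF NU rest
   (fun t _ => wk t) (fun _ _ => m0) u0 v0 (I : setT s).
by [].
Qed.

Lemma resonant_phi j s : phi j s = phi j 0 - lam j * A * s / al j.
Proof.
have dz (z : R) : setT z -> is_derive z 1 (fun t => phi j t - (- lam j * A / al j) * t) 0.
  move=> _; apply: der_eq (der_add (ph_der j z) (der_opp (der_mulc (- lam j * A / al j) (is_derive_id z 1)))) _.
  by rewrite resonant_rest mulr0 mul0r expR0 !mulr0 addr0 !mulr1 subrr.
have := cst_on intervalT dz (I : setT s) (I : setT 0).
by rewrite mulr0 subr0 => <-; ring.
Qed.

Lemma resonant_theta s : theta s = theta 0 + alpha * A * s.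
Proof.
have dz (z : R) : setT z -> is_derive z 1 (fun t => theta t - alpha * A * t) 0.
  move=> _; apply: der_eq (der_add (th_der z) (der_opp (der_mulc (alpha * A) (is_derive_id z 1)))) _.
  by rewrite resonant_rest mulr0 mul0r expR0 !mulr1 subrr.
have := cst_on intervalT dz (I : setT s) (I : setT 0).
by rewrite mulr0 subr0 => <-; ring.
Qed.

Lemma resonant_solution j s :
  w j s = (Num.sqrt (al j))%:C * expi (phi j 0 - lam j * A * s / al j).
Proof.
have [_ /(_ j s I) ->] := pol; rewrite resonant_phi; congr (_%:C * _).
have : radius w j s ^+ 2 = al j + lam j * u s := radius_sq openT intervalT I sol pol j I.
rewrite resonant_rest mulr0 addr0 => <-.
by rewrite sqrtr_sqr ger0_norm // ltW // (radius_gt0 sol).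
Qed.

(** At rest cos(phi - theta) = 0, so the phases of the w_j add up to theta + pi/2. *)
Lemma resonant_prod s : \prod_j w j s = (A%:C * 'i) * expi (theta s).
Proof.
have vs : v s = 0.
  have [bal prd] := resonant.
  apply/eqP; rewrite -sqrf_eq0 EU resonant_rest /energy mulr0 expR0 mulr1.
  rewrite (_ : (Qpoly lam al).[0] = A ^+ 2) ?subrr ?mulr0 //.
  by rewrite QpolyE -prd; apply: eq_bigr => j _; rewrite mulr0 addr0.
have cq : q s * cos (psi s) = 0 by move: vs; rewrite /v => H; lra.
have sq : q s * sin (psi s) = A by rewrite sin_psiE resonant_rest mulr0 mul0r expR0 mulr1.
rewrite (solution_prod pol predT I) -/(phi_sum phi s).
have -> : phi_sum phi s = psi s + theta s by rewrite /psi subrK.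
rewrite expiD mulrA; congr (_ * _).
by apply: complex_ext; rewrite ?Re_polar ?Im_polar -/(q s) ?cq ?sq; simpc.
Qed.

End Global.

End Dynamics.

(** * Linear algebra of the induced metric *)

Section RankOne.
Context {K : comNzRingType}.

(** The block matrix S with diagonal blocks 1 and off-diagonal blocks -u and v has
    two block triangular factorizations, with these two determinants. *)
Lemma det_rank_one n (u : 'cV[K]_n) (v : 'rV[K]_n) :
  \det (1%:M + u *m v) = 1 + (v *m u) 0 0.
Proof.
pose S := block_mx (1%:M : 'M[K]_n) (- u) v (1%:M : 'M[K]_1).
have E1 : S = block_mx (1%:M : 'M[K]_n) (- u) 0 (1%:M : 'M[K]_1) *m
              block_mx (1%:M + u *m v) 0 v (1%:M : 'M[K]_1).
  rewrite mulmx_block !mul1mx !mulmx1 !mul0mx ?mulmx0 !add0r mulNmx.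
  by rewrite addrK.
have E2 : S = block_mx (1%:M : 'M[K]_n) 0 v (1%:M : 'M[K]_1) *m
              block_mx (1%:M : 'M[K]_n) (- u) 0 (1%:M + v *m u).
  rewrite mulmx_block !mul1mx !mulmx1 !mul0mx ?mulmx0 !addr0 mulmxN.
  by rewrite addrC addrK.
have := congr1 determinant E1; rewrite {}E2 !det_mulmx !det_ublock !det_lblock.
by rewrite !det1 !mul1r mulr1 => <-; rewrite det_mx11 !mxE.
Qed.

End RankOne.

Section Frame.
Context {R : realType} {n : nat}.
Variables (lam al : 'I_n -> R) (A : R) (x : 'I_n -> R).
Variables (dX : 'I_n -> 'I_n -> R) (ds : 'I_n -> R).
Hypotheses (al_gt0 : forall j, 0 < al j) (lam_sq : forall j, lam j ^+ 2 = 1) (A_gt0 : 0 < A).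
Hypothesis on_quadric : \sum_j lam j * x j ^+ 2 = 1.
Hypothesis tangent : forall a, \sum_j lam j * x j * dX a j = 0.
Hypothesis regular : row_free (row_mx (\matrix_(a, j) dX a j) (\col_a ds a)).

(** The angular velocity of w_j: its argument is psi_j - rate j * s. *)
Definition rate (j : 'I_n) : R := lam j * A / al j.
Definition weight : R := \sum_j x j ^+ 2 / al j.
(** The components of the coframe dx_k + rate_k x_k ds, which is orthogonal for the
    induced metric, with squared lengths 1 / al_k. *)
Definition frame : 'M[R]_n := \matrix_(a, k) (dX a k + rate k * x k * ds a).
(** The components of ds in that coframe, see frame_slope. *)
Definition slope (l : 'I_n) : R := lam l * x l / (A * weight).

Lemma weight_gt0 : 0 < weight.
Proof.
have H j : 0 <= x j ^+ 2 / al j by rewrite divr_ge0 ?sqr_ge0 // ltW.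
have w0 : 0 <= weight by apply: sumr_ge0 => j _.
rewrite lt_neqAle w0 andbT eq_sym; apply/negP => /eqP/psumr_eq0P h.
have x0 j : x j = 0.
  have /eqP := h (fun i _ => H i) j isT.
  by rewrite mulf_eq0 invr_eq0 (gt_eqF (al_gt0 j)) orbF sqrf_eq0 => /eqP.
have := on_quadric; rewrite big1 => [/esym/eqP|j _]; first by rewrite oner_eq0.
by rewrite x0 expr0n mulr0.
Qed.

(** The field d/ds has the components rate_k x_k in the coframe, and ds of it is 1. *)
Lemma rate_slope : \sum_k rate k * x k * slope k = 1.
Proof.
have w0 := weight_gt0.
have -> : \sum_k rate k * x k * slope k = \sum_k (x k ^+ 2 / al k) / weight.
  apply: eq_bigr => k _; rewrite /rate /slope.
  transitivity (lam k ^+ 2 * (x k ^+ 2 / al k / weight)).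
    by field; rewrite !gt_eqF.
  by rewrite lam_sq mul1r.
by rewrite -mulr_suml divff // gt_eqF.
Qed.

Lemma frame_slope a : \sum_k frame a k * slope k = ds a.
Proof.
have -> : \sum_k frame a k * slope k =
    (\sum_j lam j * x j * dX a j) / (A * weight) + (\sum_k rate k * x k * slope k) * ds a.
  rewrite !mulr_suml -big_split /=; apply: eq_bigr => k _.
  by rewrite mxE /slope; ring.
by rewrite tangent rate_slope mul0r add0r mul1r.
Qed.


Lemma regular_kernel (y : 'rV[R]_n) :
  (forall k, \sum_a y 0 a * dX a k = 0) -> \sum_a y 0 a * ds a = 0 -> y = 0.
Proof.
move=> yX ys; apply/eqP; rewrite -(mulmx_free_eq0 y regular) mul_mx_row.
have -> : y *m (\matrix_(a, j) dX a j) = 0.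
  apply/matrixP => i j; rewrite [LHS]mxE [RHS]mxE (ord1 i) -[RHS](yX j).
  by apply: eq_bigr => a _; rewrite mxE.
have -> : y *m (\col_a ds a) = 0.
  apply/matrixP => i j; rewrite [LHS]mxE [RHS]mxE (ord1 i) -[RHS]ys.
  by apply: eq_bigr => a _; rewrite mxE.
by rewrite row_mx0.
Qed.

Lemma frame_unit : frame \in unitmx.
Proof.
rewrite -row_free_unit; apply: inj_row_free => y yB.
have yk k : \sum_a y 0 a * dX a k + (\sum_a y 0 a * ds a) * (rate k * x k) = 0.
  have := congr1 (fun M : 'rV[R]_n => M 0 k) yB; rewrite !mxE => yB0; rewrite -[RHS]yB0.
  by rewrite mulr_suml -big_split /=; apply: eq_bigr => a _; rewrite mxE; ring.
have t0 : \sum_a y 0 a * ds a = 0.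
  have -> : \sum_a y 0 a * ds a = \sum_a y 0 a * \sum_k frame a k * slope k.
    by apply: eq_bigr => a _; rewrite frame_slope.
  under eq_bigr do rewrite mulr_sumr.
  rewrite exchange_big big1 //= => k _.
  under eq_bigr do rewrite mulrA.
  rewrite -mulr_suml (_ : \sum_a _ = 0) ?mul0r //.
  by have := congr1 (fun M : 'rV[R]_n => M 0 k) yB; rewrite !mxE.
by apply: regular_kernel => // k; have := yk k; rewrite t0 mul0r addr0.
Qed.

Let C := invmx frame.

Lemma coframe_ds l : \sum_a C l a * ds a = slope l.
Proof.
have : C *m (frame *m \col_k slope k) = \col_k slope k by rewrite mulKmx ?frame_unit.
move/(congr1 (fun M : 'cV[R]_n => M l 0)); rewrite !mxE => <-.
by apply: eq_bigr => a _; rewrite !mxE -frame_slope; congr (_ * _); apply: eq_bigr => k _; rewrite !mxE.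
Qed.

Lemma coframe_dX l k : \sum_a C l a * dX a k = (l == k)%:R - rate k * x k * slope l.
Proof.
have : C *m frame = 1%:M by rewrite mulVmx ?frame_unit.
move/(congr1 (fun M : 'M[R]_n => M l k)); rewrite !mxE => <-.
rewrite -coframe_ds mulr_sumr -sumrB; apply: eq_bigr => a _.
by rewrite mxE; ring.
Qed.

Definition frame_gram : 'M[R]_n := \matrix_(a, b)
  \sum_k al k * (dX a k * dX b k + (rate k * x k * ds a) * (rate k * x k * ds b)).

(** The cross terms dx_k ds cancel by tangency to the quadric. *)
Lemma frame_gramE : frame_gram = frame *m diag_mx (\row_k al k) *m frame^T.
Proof.
apply/matrixP => a b; rewrite mxE [RHS]mxE.
have cross c : \sum_k al k * dX c k * (rate k * x k) = 0.
  transitivity (A * \sum_j lam j * x j * dX c j); last by rewrite tangent mulr0.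
  rewrite mulr_sumr; apply: eq_bigr => k _.
  by rewrite /rate; field; rewrite gt_eqF.
have -> : \sum_j (frame *m diag_mx (\row_k al k)) a j * frame^T j b =
    \sum_k al k * (dX a k * dX b k + (rate k * x k * ds a) * (rate k * x k * ds b)) +
    (\sum_k al k * dX a k * (rate k * x k)) * ds b + (\sum_k al k * dX b k * (rate k * x k)) * ds a.
  rewrite !mulr_suml -!big_split /=; apply: eq_bigr => k _.
  by rewrite mul_mx_diag !mxE /=; ring.
by rewrite !cross !mul0r !addr0.
Qed.

Lemma det_frame_gram : \det frame_gram = \det frame ^+ 2 * \prod_k al k.
Proof.
rewrite frame_gramE !det_mulmx det_tr det_diag; under eq_bigr do rewrite mxE.
ring.
Qed.

Lemma frame_gram_unit : frame_gram \in unitmx.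
Proof.
rewrite unitmxE det_frame_gram unitfE mulf_neq0 //.
  by rewrite sqrf_eq0 -unitfE -unitmxE frame_unit.
by rewrite gt_eqF // prodr_gt0.
Qed.

Lemma frame_gramV a b : invmx frame_gram a b = \sum_l C l a * C l b / al l.
Proof.
pose Dv := diag_mx (\row_k (al k)^-1).
have DV : diag_mx (\row_k al k) *m Dv = 1%:M.
  rewrite mulmx_diag -diag_const_mx; congr diag_mx; apply/rowP => k.
  by rewrite !mxE divff // gt_eqF.
have E : frame_gram *m (C^T *m Dv *m C) = 1%:M.
  rewrite frame_gramE !mulmxA.
  have -> : frame *m diag_mx (\row_k al k) *m frame^T *m C^T = frame *m diag_mx (\row_k al k).
    by rewrite -mulmxA -trmx_mul mulVmx ?frame_unit // trmx1 mulmx1.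
  by rewrite -[frame *m _ *m Dv]mulmxA DV mulmx1 mulmxV // frame_unit.
have -> : invmx frame_gram = C^T *m Dv *m C.
  by rewrite -[LHS]mulmx1 -E mulKmx // frame_gram_unit.
by rewrite mxE; apply: eq_bigr => l _; rewrite mul_mx_diag !mxE mulrAC.
Qed.

(** Traces for the inverse metric are sums over the coframe; the following lemmas
    evaluate those that occur in the mean curvature. *)
Lemma frame_trace (f g : 'I_n -> R) :
  \sum_a \sum_b invmx frame_gram a b * (f a * g b) =
  \sum_l (\sum_a C l a * f a) * (\sum_b C l b * g b) / al l.
Proof.
under eq_bigr => a _ do under eq_bigr => b _ do rewrite frame_gramV mulr_suml.
under eq_bigr => a _ do rewrite exchange_big.
rewrite exchange_big; apply: eq_bigr => l _.
rewrite mulr_suml mulr_suml; apply: eq_bigr => a _.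
by rewrite mulr_sumr mulr_suml; apply: eq_bigr => b _; ring.
Qed.

Lemma gradient_ds a : \sum_b invmx frame_gram a b * ds b = \sum_l C l a * (slope l / al l).
Proof.
under eq_bigr => b _ do rewrite frame_gramV mulr_suml.
rewrite exchange_big; apply: eq_bigr => l _.
by rewrite -coframe_ds mulr_suml mulr_sumr; apply: eq_bigr => b _; ring.
Qed.

Lemma trace_ds_ds : \sum_a \sum_b invmx frame_gram a b * (ds a * ds b) = (A ^+ 2 * weight)^-1.
Proof.
rewrite frame_trace; under eq_bigr do rewrite !coframe_ds.
have w0 := weight_gt0.
have -> : (A ^+ 2 * weight)^-1 = (\sum_l x l ^+ 2 / al l) / (A * weight) ^+ 2.
  by rewrite -/weight; field; rewrite !gt_eqF.
rewrite mulr_suml; apply: eq_bigr => l _.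
transitivity (lam l ^+ 2 * (x l ^+ 2 / al l / (A * weight) ^+ 2)); last by rewrite lam_sq mul1r.
by rewrite /slope; field; rewrite !gt_eqF.
Qed.

Lemma trace_dX_ds k : \sum_a \sum_b invmx frame_gram a b * (dX a k * ds b) = 0.
Proof.
rewrite frame_trace.
have -> : \sum_l (\sum_a C l a * dX a k) * (\sum_b C l b * ds b) / al l =
    slope k / al k - rate k * x k * \sum_l slope l * slope l / al l.
  under eq_bigr do rewrite coframe_dX coframe_ds mulrBl mulrBl.
  rewrite sumrB (bigD1 k) //= eqxx mul1r big1 ?addr0 => [|l lk]; last first.
    by rewrite (negPf lk) !mul0r.
  by congr (_ - _); rewrite mulr_sumr; apply: eq_bigr => l _; ring.
have := trace_ds_ds; rewrite frame_trace; under eq_bigr do rewrite !coframe_ds.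
have w0 := weight_gt0.
by move=> ->; rewrite /slope /rate; field; rewrite !gt_eqF.
Qed.

Lemma trace_dX_dX k : \sum_a \sum_b invmx frame_gram a b * (dX a k * dX b k) =
  (al k)^-1 - x k ^+ 2 / (al k ^+ 2 * weight).
Proof.
rewrite frame_trace.
have -> : \sum_l (\sum_a C l a * dX a k) * (\sum_b C l b * dX b k) / al l =
    (al k)^-1 - 2 * (rate k * x k) * slope k / al k +
    (rate k * x k) ^+ 2 * \sum_l slope l * slope l / al l.
  transitivity (\sum_l ((l == k)%:R * ((al k)^-1 - 2 * (rate k * x k) * slope k / al k) +
     (rate k * x k) ^+ 2 * (slope l * slope l / al l))).
    apply: eq_bigr => l _; rewrite coframe_dX.
    have [->|lk] := eqVneq l k; rewrite /= ?mulr1n ?mulr0n; ring.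
  rewrite big_split /= -mulr_sumr; congr (_ + _).
  rewrite (bigD1 k) //= eqxx mul1r big1 ?addr0 // => l lk.
  by rewrite (negPf lk) mul0r.
have := trace_ds_ds; rewrite frame_trace; under eq_bigr do rewrite !coframe_ds.
have w0 := weight_gt0.
move=> ->; rewrite /slope /rate.
transitivity ((al k)^-1 - lam k ^+ 2 * (x k ^+ 2 / (al k ^+ 2 * weight))).
  by field; rewrite !gt_eqF.
by rewrite lam_sq mul1r.
Qed.

(** The complex Jacobian differs from the frame by a rank-one factor whose
    determinant is -i; hence its phase is constant up to the sign of det frame. *)
Lemma det_complex_frame :
  \det (\matrix_(a, k) (dX a k +i* - (rate k * x k * ds a)) : 'M[R[i]]_n) =
  - 'i * (\det frame)%:C.
Proof.
have RC (p r : R) : (p * r)%:C = p%:C * r%:C := rmorphM (real_complex R) p r.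
pose T : R[i] -> 'M[R[i]]_n := fun c =>
  1%:M + (\col_k (- c * (slope k)%:C)) *m (\row_k (rate k * x k)%:C).
have -> : (\matrix_(a, k) (dX a k +i* - (rate k * x k * ds a)) : 'M[R[i]]_n) =
    map_mx (real_complex R) frame *m T (1 +i* 1).
  apply/matrixP => a k; rewrite /T mulmxDr mulmx1 mulmxA mxE [RHS]mxE !mxE.
  rewrite big_ord1 !mxE.
  have -> : \sum_j map_mx (real_complex R) frame a j * (\col_k0 (- (1 +i* 1) * (slope k0)%:C)) j 0
      = - (1 +i* 1) * (ds a)%:C.
    rewrite -frame_slope rmorph_sum mulr_sumr; apply: eq_bigr => j _ /=.
    by rewrite [map_mx _ _ a j]mxE [(\col__ _) j 0]mxE (RC (frame a j)); ring.
  by simpc; congr (_ +i* _); ring.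
rewrite det_mulmx det_map_mx mulrC; congr (_ * _).
rewrite /T det_rank_one !mxE.
have -> : \sum_j (\row_k (rate k * x k)%:C) 0 j * (\col_k (- (1 +i* 1) * (slope k)%:C)) j 0
    = - (1 +i* 1) * (\sum_k rate k * x k * slope k)%:C :> R[i].
  rewrite rmorph_sum mulr_sumr; apply: eq_bigr => j _ /=.
  by rewrite [(\row__ _) 0 j]mxE [(\col__ _) j 0]mxE (RC (rate j * x j)); ring.
by rewrite rate_slope; simpc.
Qed.

End Frame.

(** * Determinants and mixed partial derivatives *)

Lemma near_eq_differentiable {R : numFieldType} {V W : normedModType R}
  (f g : V -> W) (x : V) : (\forall y \near x, f y = g y) ->
  differentiable f x -> differentiable g x.
Proof.
move=> fg df; have fgx : f x = g x by exact: nbhs_singleton fg.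
have cdf : continuous ('d f x : V -> W) by exact: diff_continuous.
have E : g \o shift x = cst (g x) + 'd f x +o_ 0 id.
  apply/eqaddoP => _ /posnumP[e].
  have /eqaddoP/(_ e%:num (gt0 e)) := diff_locally df.
  have fg0 : \forall y \near (0 : V), f (y + x) = g (y + x).
    by move: fg; rewrite (near_shift 0) /= => H; apply: filterS H => y /=; rewrite subr0.
  by move: fg0; apply: filterS2 => y /= fgy; rewrite !fctE /= fgy fgx.
by apply/diff_locallyP; rewrite (diff_unique cdf E).
Qed.

Section DerivativeOfDeterminant.
Context {R : realType} {V : normedModType R}.
Implicit Types (x v : V).

Lemma der_sum_seq (T : Type) (r : seq T) x v (f : T -> V -> R) (df : T -> R) :
  (forall i, is_derive x v (f i) (df i)) ->
  is_derive x v (fun t => \sum_(i <- r) f i t) (\sum_(i <- r) df i).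
Proof.
move=> H; elim: r => [|i r IH].
  rewrite big_nil; have -> : (fun t => \sum_(i <- [::]) f i t) = (fun=> 0).
    by apply: funext => t; rewrite big_nil.
  exact: der_cst.
rewrite big_cons.
have -> : (fun t => \sum_(i <- i :: r) f i t) = (fun t => f i t + \sum_(i <- r) f i t).
  by apply: funext => t; rewrite big_cons.
exact: der_add.
Qed.

Lemma der_prod n x v (f : 'I_n -> V -> R) (df : 'I_n -> R) :
  (forall i, is_derive x v (f i) (df i)) ->
  is_derive x v (fun t => \prod_i f i t) (\sum_i df i * \prod_(k | k != i) f k x).
Proof.
move=> H; elim: n f df H => [|n IH] f df H.
  rewrite big_ord0; have -> : (fun t => \prod_(i < 0) f i t) = (fun=> 1).
    by apply: funext => t; rewrite big_ord0.
  exact: der_cst.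
have -> : (fun t => \prod_i f i t) = (fun t => f ord0 t * \prod_(i < n) f (lift ord0 i) t).
  by apply: funext => t; rewrite big_ord_recl.
apply: der_eq (der_mul (H ord0) (IH _ _ (fun i => H (lift ord0 i)))) _.
rewrite big_ord_recl; congr (_ + _).
  congr (_ * _); rewrite [RHS]big_mkcond big_ord_recl /= mul1r.
  by apply: eq_bigr => i _.
rewrite mulr_sumr; apply: eq_bigr => i _; rewrite mulrCA; congr (_ * _).
rewrite [RHS]big_mkcond big_ord_recl /=; congr (_ * _).
rewrite [LHS]big_mkcond; apply: eq_bigr => k _.
by rewrite (inj_eq lift_inj).
Qed.

(** Jacobi: differentiating one row at a time, each resulting determinant is
    expanded along the differentiated row. *)
Lemma der_det n x v (M : V -> 'M[R]_n) (dM : 'I_n -> 'I_n -> R) :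
  (forall i j, is_derive x v (fun t => M t i j) (dM i j)) ->
  is_derive x v (fun t => \det (M t)) (\sum_i \sum_j dM i j * cofactor (M x) i j).
Proof.
move=> H.
pose row_changed i : 'M[R]_n := \matrix_(k, j) if k == i then dM i j else M x k j.
have E i : \sum_j dM i j * cofactor (M x) i j = \det (row_changed i).
  rewrite (expand_det_row _ i); apply: eq_bigr => j _; rewrite mxE eqxx; congr (_ * _).
  rewrite /cofactor; congr (_ * \det _); apply/matrixP => k l; rewrite !mxE.
  by rewrite eq_sym (negPf (neq_lift _ _)).
under eq_bigr do rewrite E.
have D : is_derive x v (fun t => \sum_(s : 'S_n) (-1) ^+ s * \prod_i M t i (s i))
    (\sum_(s : 'S_n) (-1) ^+ s * \sum_i dM i (s i) * \prod_(k | k != i) M x k (s k)).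
  apply: der_sum_seq => s; apply: der_mulc.
  exact: (der_prod (f := fun i t => M t i (s i)) (fun i => H i (s i))).
apply: der_eq D _.
under [LHS]eq_bigr => s _ do rewrite mulr_sumr.
rewrite exchange_big; apply: eq_bigr => i _; apply: eq_bigr => s _.
congr (_ * _); rewrite [RHS](bigD1 i) //= mxE eqxx; congr (_ * _).
by apply: eq_bigr => k ki; rewrite mxE (negPf ki).
Qed.

Lemma derivable_cofactor n x v (M : V -> 'M[R]_n) (dM : 'I_n -> 'I_n -> R) i j :
  (forall i j, is_derive x v (fun t => M t i j) (dM i j)) ->
  derivable (fun t => cofactor (M t) i j) x v.
Proof.
move=> H.
have H' k l : is_derive x v (fun t => (row' i (col' j (M t))) k l) (dM (lift i k) (lift j l)).
  by apply: der_ext (H (lift i k) (lift j l)) => t; rewrite !mxE.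
have D := der_det H'.
by have [] := der_mulc ((-1) ^+ (i + j)) D.
Qed.

End DerivativeOfDeterminant.

Section ContinuityOfDeterminant.
Context {R : realType} {T : topologicalType}.

Lemma continuous_det n (M : T -> 'M[R]_n) (p : T) :
  (forall i j, {for p, continuous (fun t => M t i j)}) ->
  {for p, continuous (fun t => \det (M t))}.
Proof.
move=> cM.
have cP (s : {perm 'I_n}) (r : seq 'I_n) : {for p, continuous (fun t => \prod_(i <- r) M t i (s i))}.
  elim: r => [|i r IH].
    have -> : (fun t => \prod_(i <- [::]) M t i (s i)) = cst 1.
      by apply: funext => t; rewrite big_nil.
    exact: cvg_cst.
  have -> : (fun t => \prod_(i <- i :: r) M t i (s i)) =
      (fun t => M t i (s i) * \prod_(i <- r) M t i (s i)).
    by apply: funext => t; rewrite big_cons.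
  exact: continuousM.
rewrite /determinant; elim: (index_enum _) => [|s r IH].
  have -> : (fun t => \sum_(s <- [::] : seq {perm 'I_n}) (-1) ^+ s * \prod_i M t i (s i)) = cst (0 : R).
    by apply: funext => t; rewrite big_nil.
  exact: cvg_cst.
have -> : (fun t => \sum_(s <- s :: r) (-1) ^+ s * \prod_i M t i (s i)) =
    (fun t => (-1) ^+ s * \prod_i M t i (s i) + \sum_(s <- r) (-1) ^+ s * \prod_i M t i (s i)).
  by apply: funext => t; rewrite big_cons.
by apply: continuousD => //; apply: continuousM; [exact: cvg_cst|exact: cP].
Qed.

End ContinuityOfDeterminant.

Section SeveralVariables.
Context {R : realType} {n : nat}.
Implicit Types (U : set 'rV[R]_n) (f g : 'rV[R]_n -> R) (p : 'rV[R]_n).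
Local Notation e_ a := (delta_mx 0 a : 'rV[R]_n).

Lemma smooth_der U f p a : smooth_on U f -> U p -> is_derive p (e_ a) f (partial a f p).
Proof. by move=> /(_ [::] p) /[apply] df; exact/derivableP/diff_derivable. Qed.

Lemma smooth_partial U f a : smooth_on U f -> smooth_on U (partial a f).
Proof.
move=> sf l p Up; have := sf (rcons l a) p Up.
by rewrite -cats1 foldr_cat.
Qed.

Lemma smooth_continuous U f p : smooth_on U f -> U p -> {for p, continuous f}.
Proof. by move=> /(_ [::] p) /[apply] df; exact: differentiable_continuous. Qed.

Lemma near_open U p : open U -> U p -> \forall q \near p, U q.
Proof. by move=> oU Up; exact: open_nbhs_nbhs. Qed.

Lemma continuous_ball f p (e : R) : {for p, continuous f} -> 0 < e ->
  exists2 r, 0 < r & forall q, ball p r q -> `|f p - f q| < e.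
Proof.
move=> cf e0; have /cvgrPdist_lt/(_ e e0) H : f q @[q --> p] --> f p by exact: cf.
have [r /= r0 Hr] := (nbhs_ballP _ _).1 H.
by exists r => // q; exact: Hr.
Qed.

Lemma open_ball U p : open U -> U p ->
  exists2 r : R, 0 < r & forall q, ball p r q -> U q.
Proof.
move=> oU Up; have [r /= r0 Hr] := (nbhs_ballP _ _).1 (near_open oU Up).
by exists r => // q; exact: Hr.
Qed.

Lemma partial_eq_on U f g a p : open U -> U p -> (forall q, U q -> f q = g q) ->
  partial a f p = partial a g p.
Proof.
move=> oU Up fg; apply: near_eq_derive.
by apply: filterS (near_open oU Up) => q; exact: fg.
Qed.

Lemma smooth_affine U f c0 c1 : open U -> smooth_on U f ->
  smooth_on U (fun q => c0 + c1 * f q).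
Proof.
move=> oU sf l.
have key : forall q, U q -> foldr partial (fun q => c0 + c1 * f q) l q =
    (if l is [::] then c0 else 0) + c1 * foldr partial f l q.
  elim: l => [//|a l IH] q Uq /=.
  rewrite (partial_eq_on a oU Uq IH).
  have dl : is_derive q (e_ a) (foldr partial f l) (partial a (foldr partial f l) q).
    exact/derivableP/diff_derivable/sf.
  have := der_add (der_cst q (e_ a) (if l is [::] then c0 else 0)) (der_mulc c1 dl).
  by move=> [_ <-].
move=> p Up.
apply: near_eq_differentiable (_ : differentiable (fun q =>
    (if l is [::] then c0 else 0) + c1 * foldr partial f l q) p).
  by apply: filterS (near_open oU Up) => q /key ->.
apply: differentiableD; first exact: differentiable_cst.
by apply: differentiableM; [exact: differentiable_cst|exact: sf].
Qed.

Lemma line_der f (q v : 'rV[R]_n) (t df : R) : is_derive (q + t *: v) v f df ->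
  is_derive t 1 (fun t : R => f (q + t *: v)) df.
Proof.
move=> H; pose T (t : R) : 'rV[R]_n := q + t *: v.
have E : (fun h : R => h^-1 *: (((fun t : R => f (q + t *: v)) \o shift t) (h *: 1) - f (q + t *: v))) =
    (fun h : R => h^-1 *: ((f \o shift (q + t *: v)) (h *: v) - f (q + t *: v))).
  apply: funext => h /=; congr (_ *: (f _ - _)).
  by rewrite [h *: 1]mulr1 scalerDl addrCA.
case: H => dv <-; split; first by rewrite /derivable E.
by rewrite /derive E.
Qed.

(** The mean value theorem, applied first in the direction a and then in the
    direction b. *)
Lemma second_difference U f p a b e : 0 < e -> open U -> smooth_on U f ->
  (forall s t : R, 0 <= s <= e -> 0 <= t <= e -> U (p + s *: e_ a + t *: e_ b)) ->
  exists s t, [/\ 0 <= s <= e, 0 <= t <= e &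
    f (p + e *: e_ a + e *: e_ b) - f (p + e *: e_ a) - f (p + e *: e_ b) + f p =
    e ^+ 2 * partial b (partial a f) (p + s *: e_ a + t *: e_ b)].
Proof.
move=> e0 oU sf box.
pose g s := f (p + s *: e_ a + e *: e_ b) - f (p + s *: e_ a).
pose dg s := partial a f (p + s *: e_ a + e *: e_ b) - partial a f (p + s *: e_ a).
have box0 s : 0 <= s <= e -> U (p + s *: e_ a).
  by move=> se; have := box s 0 se; rewrite lexx ltW // scale0r addr0; apply.
have gD (s : R) : 0 <= s <= e -> is_derive s 1 g (dg s).
  move=> se; apply: der_add.
    have E : (fun t : R => f (p + t *: e_ a + e *: e_ b)) = (fun t : R => f (p + e *: e_ b + t *: e_ a)).
      by apply: funext => t; rewrite addrAC.
    rewrite E; apply: line_der; rewrite addrAC; apply: (smooth_der _ sf).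
    by apply: box => //; rewrite lexx ltW.
  apply: der_opp; apply: line_der; apply: (smooth_der _ sf); exact: box0.
have [s||s se gE] := @MVT_segment _ g dg 0 e (ltW e0).
- by rewrite in_itv /= => /andP[s0 se]; apply: gD; rewrite !ltW.
- by apply: continuous_segment => s se; exact: der_continuous1 (gD s se).
rewrite in_itv /= in se.
pose h t := partial a f (p + s *: e_ a + t *: e_ b).
pose dh t := partial b (partial a f) (p + s *: e_ a + t *: e_ b).
have hD (t : R) : 0 <= t <= e -> is_derive t 1 h (dh t).
  move=> te; apply: line_der; apply: (smooth_der _ (smooth_partial a sf)); exact: box.
have [t||t te hE] := @MVT_segment _ h dh 0 e (ltW e0).
- by rewrite in_itv /= => /andP[t0 te]; apply: hD; rewrite !ltW.
- by apply: continuous_segment => t te; exact: der_continuous1 (hD t te).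
rewrite in_itv /= in te.
exists s, t; split=> //.
have := hE; rewrite /h scale0r addr0 -/(dg s) subr0 => dgE.
move: gE; rewrite /g dgE !scale0r !addr0 subr0 -/(dh t) => gE.
move: gE; move: (dh t) => D.
move: (f (p + e *: e_ a + e *: e_ b)) (f (p + e *: e_ a)) (f (p + e *: e_ b)) (f p) => w1 w2 w3 w4 gE.
have -> : e ^+ 2 * D = D * e * e by ring.
by rewrite -gE; ring.
Qed.

Lemma dist_half (X Y Z d : R) : `|X - Z| < d / 2 -> `|Y - Z| < d / 2 -> `|X - Y| < d.
Proof.
move=> H1 H2; have -> : X - Y = (X - Z) - (Y - Z) by ring.
by apply: le_lt_trans (ler_normB _ _) _; lra.
Qed.

(** The second difference over a small square is symmetric in the two directions, so
    by second_difference the two mixed derivatives agree at two points of the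
    square; let the square shrink, by continuity. *)
Lemma clairaut U f p a b : open U -> smooth_on U f -> U p ->
  partial a (partial b f) p = partial b (partial a f) p.
Proof.
move=> oU sf Up.
apply/eqP; rewrite -subr_eq0 -normr_le0 leNgt; apply/negP => d0.
set d := `|_ - _| in d0.
have c1 := smooth_continuous (smooth_partial a (smooth_partial b sf)) Up.
have c2 := smooth_continuous (smooth_partial b (smooth_partial a sf)) Up.
have d20 : 0 < d / 2 by rewrite divr_gt0.
have [r1 r10 H1] := continuous_ball c1 d20.
have [r2 r20 H2] := continuous_ball c2 d20.
have [r3 r30 H3] := open_ball oU Up.
have [r r0 [rr1 rr2 rr3]] : exists2 r, 0 < r & [/\ r <= r1, r <= r2 & r <= r3].
  exists (Num.min r1 (Num.min r2 r3)); first by rewrite !lt_min r10 r20.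
  by rewrite !ge_min !lexx !orbT.
pose N := `|e_ a| + `|e_ b| + 1.
have N0 : 0 < N by rewrite ltr_wpDl // addr_ge0.
pose e := r / N.
have e0 : 0 < e by rewrite divr_gt0.
have inball s t : 0 <= s <= e -> 0 <= t <= e -> ball p r (p + s *: e_ a + t *: e_ b).
  move=> /andP[s0 se] /andP[t0 te]; rewrite -ball_normE /ball_ /= -addrA opprD addrA subrr add0r normrN.
  apply: le_lt_trans (ler_normD _ _) _; rewrite !normrZ !ger0_norm //.
  have h1 : s * `|e_ a| <= e * `|e_ a| by rewrite ler_wpM2r.
  have h2 : t * `|e_ b| <= e * `|e_ b| by rewrite ler_wpM2r.
  have : e * N = r by rewrite /e divfK // gt_eqF.
  by rewrite /N; lra.
have box s t : 0 <= s <= e -> 0 <= t <= e -> U (p + s *: e_ a + t *: e_ b).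
  by move=> hs ht; apply: H3; exact: le_ball rr3 _ (inball _ _ hs ht).
have box' s t : 0 <= s <= e -> 0 <= t <= e -> U (p + s *: e_ b + t *: e_ a).
  by move=> hs ht; rewrite addrAC; exact: box.
have [s [t [hs ht E1]]] := second_difference e0 oU sf box.
have [s' [t' [hs' ht' E2]]] := second_difference e0 oU sf box'.
have {}H2 := H2 _ (le_ball rr2 (inball _ _ hs ht)).
have {}H1 := H1 _ (le_ball rr1 (inball _ _ ht' hs')).
rewrite addrAC in H1.
have EE : partial b (partial a f) (p + s *: e_ a + t *: e_ b) =
    partial a (partial b f) (p + s' *: e_ b + t' *: e_ a).
  have e20 : e ^+ 2 != 0 by rewrite sqrf_eq0 gt_eqF.
  have P1 : p + e *: e_ b + e *: e_ a = p + e *: e_ a + e *: e_ b by rewrite addrAC.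
  apply: (mulfI e20); apply: (etrans (esym E1)); apply: (etrans _ E2).
  by rewrite P1; congr (_ + _); exact: addrAC.
rewrite EE in H2.
have : d < d by exact: dist_half H1 H2.
by rewrite ltxx.
Qed.

(** The cofactors of a Jacobian matrix are divergence free: differentiate
    J adj(J) = det(J) and compare with Jacobi's formula. The symmetry of dJ says
    that the columns of J are gradients, to first order at p. *)
Lemma piola p (J : 'rV[R]_n -> 'M[R]_n) (ddY : 'I_n -> 'I_n -> 'I_n -> R) (k : 'I_n) :
  (forall c a l, is_derive p (e_ c) (fun q => J q a l) (ddY c a l)) ->
  (forall c a l, ddY c a l = ddY a c l) -> J p \in unitmx ->
  \sum_a partial a (fun q => cofactor (J q) a k) p = 0.
Proof.
move=> dJ ddY_sym Ju.
have [D DE] : exists D : 'I_n -> 'I_n -> 'I_n -> R,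
    forall c a l, D c a l = partial c (fun q => cofactor (J q) a l) p by eexists.
have dcof c a l : is_derive p (e_ c) (fun q => cofactor (J q) a l) (D c a l).
  rewrite DE; apply/derivableP; exact: (derivable_cofactor (M := J) (dM := fun a l => ddY c a l)).
have expand (q : 'rV[R]_n) a b : \sum_l J q a l * cofactor (J q) b l = (a == b)%:R * \det (J q).
  have := mul_mx_adj (J q); move/(congr1 (fun M : 'M[R]_n => M a b)); rewrite !mxE.
  rewrite mulr_natl => <-; apply: eq_bigr => l _.
  by rewrite [\adj _ l b]mxE.
under eq_bigr do rewrite -DE.
have row a : \sum_l J p a l * \sum_b D b b l = 0.
  have H b : \sum_l (ddY b a l * cofactor (J p) b l + J p a l * D b b l) =
      (a == b)%:R * \sum_c \sum_l ddY b c l * cofactor (J p) c l.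
    have H1 := der_sum (fun l => der_mul (dJ b a l) (dcof b b l)).
    have H2 := der_mulc (a == b)%:R (der_det (M := J) (dM := fun a l => ddY b a l) (fun c l => dJ b c l)).
    have := der_unique H1 (der_ext (fun q => esym (expand q a b)) H2).
    by [].
  have := eq_bigr (fun b => (\sum_l (ddY b a l * cofactor (J p) b l + J p a l * D b b l)))
     (fun b (_ : true) => esym (H b)) : \sum_b _ = \sum_b _.
  rewrite (bigD1 a) //= eqxx mul1r [X in _ + X]big1 ?addr0 => [|b ba]; last first.
    by rewrite eq_sym (negPf ba) mul0r.
  under [RHS]eq_bigr do rewrite big_split /=.
  rewrite big_split /= => E.
  have sym : \sum_b \sum_l ddY b a l * cofactor (J p) b l =
      \sum_c \sum_l ddY a c l * cofactor (J p) c l.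
    by apply: eq_bigr => b _; apply: eq_bigr => l _; rewrite ddY_sym.
  have : \sum_b \sum_l J p a l * D b b l = 0.
    by move: E; rewrite sym -[LHS]addr0 => /addrI.
  by rewrite exchange_big => H0; rewrite -[RHS]H0; apply: eq_bigr => l _; rewrite mulr_sumr.
have : J p *m (\col_l \sum_b D b b l) = 0.
  apply/matrixP => a z; rewrite [RHS]mxE [LHS]mxE -[RHS](row a).
  by apply: eq_bigr => l _; rewrite [(\col__ _) l z]mxE.
move/(congr1 (mulmx (invmx (J p)))); rewrite mulKmx // mulmx0.
by move/(congr1 (fun M : 'cV[R]_n => M k 0)); rewrite !mxE.
Qed.

End SeveralVariables.

(** * Geometry of the submanifold at rest *)

Section ResonantGeometry.
Context {R : realType} {n : nat}.
Variables (lam al : 'I_n -> R) (alpha A th0 : R) (ps : 'I_n -> R).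
Variables (w : 'I_n -> R -> R[i]).
Hypotheses (al_gt0 : forall j, 0 < al j) (lam_sq : forall j, lam j ^+ 2 = 1) (A_gt0 : 0 < A).
Hypothesis balance : \sum_j lam j / al j + alpha = 0.
Hypothesis product : \prod_j al j = A ^+ 2.
Hypothesis wE : forall j s, w j s = (Num.sqrt (al j))%:C * expi (ps j - lam j * A * s / al j).
Hypothesis wprod : forall s, \prod_j w j s = (A%:C * 'i) * expi (th0 + alpha * A * s).

Variables (U : set 'rV[R]_n) (X : 'rV[R]_n -> 'rV[R]_n) (sig : 'rV[R]_n -> R).
Hypothesis oU : open U.
Hypothesis sX : forall j, smooth_on U (fun p => X p 0 j).
Hypothesis sS : smooth_on U sig.
Hypothesis quad : forall p, U p -> \sum_j lam j * X p 0 j ^+ 2 = 1.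
Hypothesis reg : forall p, U p ->
  row_free (row_mx (\matrix_(a, j) partial a (fun q => X q 0 j) p) (\col_a partial a sig p)).

Local Notation e_ a := (delta_mx 0 a : 'rV[R]_n).
Local Notation kap := (rate lam al A).

Let Phi p := L_map w (X p) (sig p).
Let x p j := X p 0 j.
Let dX p a j := partial a (fun q => X q 0 j) p.
Let ds p a := partial a sig p.

Let xD p a j : U p -> is_derive p (e_ a) (fun q => x q j) (dX p a j).
Proof. by move=> Up; exact: smooth_der (sX j) Up. Qed.

Let sD p a : U p -> is_derive p (e_ a) sig (ds p a).
Proof. by move=> Up; exact: smooth_der sS Up. Qed.

Let dXD p a b j : U p -> is_derive p (e_ a) (fun q => dX q b j) (partial a (fun q => dX q b j) p).
Proof. by move=> Up; exact: smooth_der (smooth_partial b (sX j)) Up. Qed.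

Let dsD p a b : U p -> is_derive p (e_ a) (fun q => ds q b) (partial a (fun q => ds q b) p).
Proof. by move=> Up; exact: smooth_der (smooth_partial b sS) Up. Qed.

Let tang p : U p -> forall a, \sum_j lam j * x p j * dX p a j = 0.
Proof.
move=> Up a.
have H := der_sum (fun j => der_mulc (lam j) (der_exp 2 (xD a j Up))).
have near1 : \forall q \near p, \sum_j lam j * x q j ^+ 2 = 1.
  by apply: filterS (near_open oU Up) => q; exact: quad.
have := der_unique (der_near near1 H) (der_cst p (e_ a) 1).
move=> E; have : 2 * \sum_j lam j * x p j * dX p a j = 0.
  rewrite mulr_sumr -[RHS]E; apply: eq_bigr => j _.
  by rewrite /= expr1; move: (dX p a j) (x p j) => d y; ring.
by move/eqP; rewrite mulf_eq0 pnatr_eq0 /= => /eqP.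
Qed.

(* Differentiating the tangency relation once more. *)
Let tang2 p : U p -> forall a b, \sum_j lam j * (dX p a j * dX p b j + x p j * partial a (fun q => dX q b j) p) = 0.
Proof.
move=> Up a b.
have H := der_sum (fun j => der_mul (der_mulc (lam j) (xD a j Up)) (dXD a b j Up)).
have near1 : \forall q \near p, \sum_j lam j * x q j * dX q b j = 0.
  by apply: filterS (near_open oU Up) => q Uq; exact: tang.
have E := der_unique (der_near near1 H) (der_cst p (e_ a) 0).
rewrite -[RHS]E; apply: eq_bigr => j _.
by move: (dX p a j) (dX p b j) (x p j) (partial a _ p) => d d' y z; ring.
Qed.

Let kapE j s : lam j * A * s / al j = kap j * s.
Proof. by rewrite /rate mulrAC. Qed.

Let al_sqrt j : Num.sqrt (al j) ^+ 2 = al j. Proof. by rewrite sqr_sqrtr // ltW. Qed.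

(** Vectors of C^n are written in the unitary frame that rotates with the w_k: then
    the arguments of the w_k disappear from the inner product and from omega, and
    only show up as rotation terms in derivatives. *)
Definition framed p (m l : 'I_n -> R) : 'rV[R[i]]_n := \row_k (w k (sig p) * (m k +i* l k)).

Let framed_re p m l k : Rpart (framed p m l 0 k) =
  Num.sqrt (al k) * (cos (ps k - kap k * sig p) * m k - sin (ps k - kap k * sig p) * l k).
Proof. by rewrite mxE wE kapE /expi; simpc; rewrite /=; ring. Qed.

Let framed_im p m l k : Ipart (framed p m l 0 k) =
  Num.sqrt (al k) * (cos (ps k - kap k * sig p) * l k + sin (ps k - kap k * sig p) * m k).
Proof. by rewrite mxE wE kapE /expi; simpc; rewrite /=; ring. Qed.

Lemma Cpartial_eq_on a (F G : 'rV[R]_n -> 'rV[R[i]]_n) p : U p ->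
  (forall q, U q -> F q = G q) -> Cpartial a F p = Cpartial a G p.
Proof.
move=> Up FG; apply/rowP => k; rewrite !mxE.
by congr (_ +i* _); apply: (partial_eq_on a oU Up) => q Uq; rewrite FG.
Qed.

(** The rotation of the frame adds a rotation of (m, l) at the rates kap. *)
Lemma framed_partial p a (m l : 'rV[R]_n -> 'I_n -> R) (dm dl : 'I_n -> R) : U p ->
  (forall k, is_derive p (e_ a) (fun q => m q k) (dm k)) ->
  (forall k, is_derive p (e_ a) (fun q => l q k) (dl k)) ->
  Cpartial a (fun q => framed q (m q) (l q)) p =
  framed p (fun k => dm k + kap k * l p k * ds p a) (fun k => dl k - kap k * m p k * ds p a).
Proof.
move=> Up mD lD; apply/rowP => k; rewrite [LHS]mxE; apply: complex_ext; rewrite /= ?framed_re ?framed_im.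
  have phase := der_add (der_cst p (e_ a) (ps k)) (der_opp (der_mulc (kap k) (sD a Up))).
  have H := der_mulc (Num.sqrt (al k)) (der_add (der_mul (der_cos phase) (mD k))
    (der_opp (der_mul (der_sin phase) (lD k)))).
  have [_ E] := der_ext (fun q => esym (framed_re q (m q) (l q) k)) H.
  rewrite /partial E; move: (ds p a) (cos _) (sin _) => d c s; ring.
have phase := der_add (der_cst p (e_ a) (ps k)) (der_opp (der_mulc (kap k) (sD a Up))).
have H := der_mulc (Num.sqrt (al k)) (der_add (der_mul (der_cos phase) (lD k))
  (der_mul (der_sin phase) (mD k))).
have [_ E] := der_ext (fun q => esym (framed_im q (m q) (l q) k)) H.
rewrite /partial E; move: (ds p a) (cos _) (sin _) => d c s; ring.
Qed.

Let PhiE p : Phi p = framed p (x p) (fun=> 0).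
Proof. by apply/rowP => k; rewrite !mxE mulrC. Qed.

Lemma Phi_partial p a : U p ->
  Cpartial a Phi p = framed p (dX p a) (fun k => - (kap k * x p k * ds p a)).
Proof.
move=> Up; rewrite (Cpartial_eq_on a (G := fun q => framed q (x q) (fun=> 0)) Up (fun q _ => PhiE q)).
rewrite (framed_partial Up (fun k => xD a k Up) (fun k => der_cst p (e_ a) 0)).
apply/rowP => k; rewrite !mxE; congr (_ * (_ +i* _)); last exact: sub0r.
by rewrite mulr0 mul0r addr0.
Qed.

Lemma Phi_partial2 p a b : U p -> Cpartial a (Cpartial b Phi) p = framed p
  (fun k => partial a (fun q => dX q b k) p - kap k ^+ 2 * x p k * (ds p a * ds p b))
  (fun k => - (kap k * (dX p a k * ds p b + dX p b k * ds p a +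
                        x p k * partial a (fun q => ds q b) p))).
Proof.
move=> Up; rewrite (Cpartial_eq_on a Up (fun q Uq => Phi_partial b Uq)).
have lD k := der_opp (der_mul (der_mulc (kap k) (xD a k Up)) (dsD a b Up)).
rewrite (framed_partial Up (fun k => dXD a b k Up) lD).
apply/rowP => k; rewrite !mxE; congr (_ * (_ +i* _)).
  by move: (partial a _ p) (ds p a) (ds p b) (x p k) (kap k) => z d d' y c; ring.
by move: (partial a _ p) (ds p a) (ds p b) (x p k) (kap k) (dX p a k) (dX p b k)
  => z d d' y c e e'; ring.
Qed.

Lemma framed_inner p m l m' l' : inner (framed p m l) (framed p m' l') =
  \sum_k al k * (m k * m' k + l k * l' k).
Proof.
apply: eq_bigr => k _; rewrite !framed_re !framed_im -{5}(al_sqrt k).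
have := cos2Dsin2 (ps k - kap k * sig p).
set c := cos _; set s := sin _; set r := Num.sqrt _ => cs.
rewrite -[RHS]mulr1 -cs; ring.
Qed.

Lemma framed_omega p m l m' l' : omega (framed p m l) (framed p m' l') =
  \sum_k al k * (m k * l' k - l k * m' k).
Proof.
apply: eq_bigr => k _; rewrite !framed_re !framed_im -{5}(al_sqrt k).
have := cos2Dsin2 (ps k - kap k * sig p).
set c := cos _; set s := sin _; set r := Num.sqrt _ => cs.
rewrite -[RHS]mulr1 -cs; ring.
Qed.

Let fr p := frame lam al A (x p) (dX p) (ds p).

Lemma Phi_gram p : U p -> gram Phi p = frame_gram lam al A (x p) (dX p) (ds p).
Proof.
move=> Up; apply/matrixP => a b; rewrite !mxE !Phi_partial // framed_inner.
by apply: eq_bigr => k _; rewrite mulrNN.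
Qed.

Lemma Phi_omega p a b : U p -> omega (Cpartial a Phi p) (Cpartial b Phi p) = 0.
Proof.
move=> Up; rewrite !Phi_partial // framed_omega.
have -> : \sum_k al k * (dX p a k * - (kap k * x p k * ds p b) - - (kap k * x p k * ds p a) * dX p b k)
    = A * (ds p a * \sum_j lam j * x p j * dX p b j - ds p b * \sum_j lam j * x p j * dX p a j).
  rewrite [ds p a * _]mulr_sumr [ds p b * _]mulr_sumr -sumrB mulr_sumr.
  apply: eq_bigr => k _; rewrite /rate; have a0 := lt0r_neq0 (al_gt0 k).
  by move: (ds p a) (ds p b) (x p k) (dX p a k) (dX p b k) => d d' y e e'; field.
by rewrite !tang // !mulr0 subrr mulr0.
Qed.

Let w_neq0 j s : w j s != 0.
Proof. by rewrite wE mulf_neq0 ?expi_neq0 // eq_complex /= gt_eqF // sqrtr_gt0. Qed.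

Lemma Re_sum (T : Type) (r : seq T) (F : T -> R[i]) :
  Rpart (\sum_(i <- r) F i) = \sum_(i <- r) Rpart (F i).
Proof. by apply: (big_morph (@complex.Re R)) => // -[a b] [c d]. Qed.

Lemma Im_sum (T : Type) (r : seq T) (F : T -> R[i]) :
  Ipart (\sum_(i <- r) F i) = \sum_(i <- r) Ipart (F i).
Proof. by apply: (big_morph (@complex.Im R)) => // -[a b] [c d]. Qed.

Lemma framed_comb p (I : Type) (r : seq I) (c : I -> R) (m l : I -> 'I_n -> R) :
  \sum_(i <- r) (c i)%:C *: framed p (m i) (l i) =
  framed p (fun k => \sum_(i <- r) c i * m i k) (fun k => \sum_(i <- r) c i * l i k).
Proof.
apply/rowP => k; rewrite summxE [RHS]mxE.
have -> : (\sum_(i <- r) c i * m i k) +i* (\sum_(i <- r) c i * l i k) =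
    \sum_(i <- r) (c i)%:C * (m i k +i* l i k).
  by apply: complex_ext; rewrite ?Re_sum ?Im_sum /=; apply: eq_bigr => i _; simpc.
by rewrite mulr_sumr; apply: eq_bigr => i _; rewrite !mxE mulrCA.
Qed.

Lemma framed_eq0 p m l : framed p m l = 0 -> forall k, m k = 0 /\ l k = 0.
Proof.
move=> /rowP F0 k; have := F0 k; rewrite !mxE => /eqP.
by rewrite mulf_eq0 (negPf (w_neq0 _ _)) /= eq_complex /= => /andP[/eqP -> /eqP ->].
Qed.

Lemma Phi_immersed p : U p ->
  row_free (row_mx (map_mx (@complex.Re R) (Cjacobian Phi p))
                   (map_mx (@complex.Im R) (Cjacobian Phi p))).
Proof.
move=> Up; apply: inj_row_free => y.
rewrite mul_mx_row -[RHS](@row_mx0 _ 1 n n) => /eq_row_mx [/rowP E1 /rowP E2].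
have comb0 : \sum_a (y 0 a)%:C *: Cpartial a Phi p = 0.
  apply/rowP => k; rewrite summxE [RHS]mxE.
  apply: complex_ext; rewrite ?Re_sum ?Im_sum /=.
    have := E1 k; rewrite mxE [RHS]mxE => H0; rewrite -[RHS]H0; apply: eq_bigr => a _.
    by rewrite !mxE; simpc.
  have := E2 k; rewrite mxE [RHS]mxE => H0; rewrite -[RHS]H0; apply: eq_bigr => a _.
  by rewrite !mxE; simpc.
have E a : Cpartial a Phi p = framed p (dX p a) (fun k => - (kap k * x p k * ds p a)).
  exact: Phi_partial.
rewrite (eq_bigr _ (fun a _ => congr1 (fun v => (y 0 a)%:C *: v) (E a))) framed_comb in comb0.
have K := framed_eq0 comb0.
apply: (regular_kernel (reg Up)); first by move=> k; have [] := K k.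
have xt k : x p k * \sum_a y 0 a * ds p a = 0.
  have [_ E0] := K k; have : - kap k * (x p k * \sum_a y 0 a * ds p a) = 0.
    rewrite -[RHS]E0 !mulr_sumr; apply: eq_bigr => a _.
    by move: (y 0 a) (ds p a) (x p k) => c d z; ring.
  have lam0 : lam k != 0 by rewrite -sqrf_eq0 lam_sq oner_eq0.
  have kap0 : kap k != 0 by apply: mulf_neq0; [apply: mulf_neq0 => //; rewrite gt_eqF|rewrite invr_eq0 gt_eqF].
  by move/eqP; rewrite mulf_eq0 oppr_eq0 (negPf kap0) => /eqP.
rewrite -[LHS]mul1r -(quad Up) mulr_suml big1 // => k _.
by rewrite expr2 -!mulrA xt !mulr0.
Qed.

Let g p := frame_gram lam al A (x p) (dX p) (ds p).

Let g_unit p : U p -> g p \in unitmx.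
Proof. by move=> Up; apply: frame_gram_unit => //; [exact: quad|exact: tang|exact: reg]. Qed.

Lemma normal_part_add p v v' : normal_part Phi p (v + v') = normal_part Phi p v + normal_part Phi p v'.
Proof.
have innerD z : inner (v + v') z = inner v z + inner v' z.
  rewrite /inner -big_split; apply: eq_bigr => k _ /=; rewrite !mxE.
  by case: (v 0 k) (v' 0 k) => a b [c d] /=; ring.
rewrite /normal_part addrACA -opprD; congr (_ - _); rewrite -big_split; apply: eq_bigr => a _ /=.
rewrite -big_split; apply: eq_bigr => b _ /=.
by rewrite innerD mulrDr raddfD /= scalerDl.
Qed.

Lemma normal_part_scale p (c : R) v : normal_part Phi p (c%:C *: v) = c%:C *: normal_part Phi p v.
Proof.
have innerZ z : inner (c%:C *: v) z = c * inner v z.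
  rewrite /inner mulr_sumr; apply: eq_bigr => k _ /=; rewrite !mxE.
  by case: (v 0 k) => a b; simpc; rewrite /=; ring.
rewrite /normal_part scalerBr scaler_sumr; congr (_ - _); apply: eq_bigr => a _.
rewrite scaler_sumr; apply: eq_bigr => b _.
by rewrite innerZ scalerA -rmorphM /= mulrCA.
Qed.

Lemma normal_part_sum p (I : Type) (r : seq I) (F : I -> 'rV[R[i]]_n) :
  normal_part Phi p (\sum_(i <- r) F i) = \sum_(i <- r) normal_part Phi p (F i).
Proof.
have np0 : normal_part Phi p 0 = 0.
  by have := normal_part_scale p 0 0; rewrite scaler0 scale0r.
exact: (big_morph _ (normal_part_add p) np0).
Qed.

Lemma normal_part_tangent p (c : 'I_n -> R) : U p ->
  normal_part Phi p (\sum_b (c b)%:C *: Cpartial b Phi p) = 0.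
Proof.
move=> Up; rewrite normal_part_sum big1 // => b _; rewrite normal_part_scale.
suff -> : normal_part Phi p (Cpartial b Phi p) = 0 by rewrite scaler0.
rewrite /normal_part; apply/eqP; rewrite subr_eq0 eq_sym; apply/eqP.
rewrite exchange_big (bigD1 b) //= [X in _ + X]big1 ?addr0 => [|d db]; last first.
  rewrite -scaler_suml -rmorph_sum /= (_ : \sum_a _ = (gram Phi p *m invmx (gram Phi p)) b d).
    by rewrite mulmxV ?Phi_gram ?g_unit // mxE eq_sym (negPf db) scale0r.
  by rewrite mxE; apply: eq_bigr => a _; rewrite [gram _ _ b a]mxE mulrC.
rewrite -scaler_suml -rmorph_sum /= (_ : \sum_a _ = (gram Phi p *m invmx (gram Phi p)) b b).
  by rewrite mulmxV ?Phi_gram ?g_unit // mxE eqxx scale1r.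
by rewrite mxE; apply: eq_bigr => a _; rewrite [gram _ _ b a]mxE mulrC.
Qed.

Lemma framed_sub p m l m' l' c :
  framed p m l - c%:C *: framed p m' l' =
  framed p (fun k => m k - c * m' k) (fun k => l k - c * l' k).
Proof.
apply/rowP => k; rewrite !mxE.
have -> : (m k - c * m' k) +i* (l k - c * l' k) = (m k +i* l k) - c%:C * (m' k +i* l' k).
  by simpc.
by rewrite mulrBr mulrCA.
Qed.

Lemma framed_ext p m l m' l' : m =1 m' -> l =1 l' -> framed p m l = framed p m' l'.
Proof. by move=> /funext -> /funext ->. Qed.

Let tr p (f : 'I_n -> 'I_n -> R) := \sum_a \sum_b invmx (g p) a b * f a b.

Let trD p f f' : tr p (fun a b => f a b + f' a b) = tr p f + tr p f'.
Proof.
rewrite /tr -big_split; apply: eq_bigr => a _ /=; rewrite -big_split.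
by apply: eq_bigr => b _; rewrite mulrDr.
Qed.

Let trZ p c f : tr p (fun a b => c * f a b) = c * tr p f.
Proof.
rewrite /tr mulr_sumr; apply: eq_bigr => a _; rewrite mulr_sumr.
by apply: eq_bigr => b _; rewrite mulrCA.
Qed.

Let tr_sum p (f : 'I_n -> 'I_n -> 'I_n -> R) :
  tr p (fun a b => \sum_k f k a b) = \sum_k tr p (f k).
Proof.
rewrite /tr [RHS]exchange_big; apply: eq_bigr => a _; rewrite [RHS]exchange_big.
by apply: eq_bigr => b _; rewrite mulr_sumr.
Qed.

Let tr_ext p f f' : (forall a b, f a b = f' a b) -> tr p f = tr p f'.
Proof. by move=> E; apply: eq_bigr => a _; apply: eq_bigr => b _; rewrite E. Qed.

Let tr_pair p f : tr p f = \sum_ab invmx (g p) ab.1 ab.2 * f ab.1 ab.2.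
Proof. by rewrite /tr pair_bigA. Qed.

(** The trace of the second derivatives of Phi differs from alpha Phi by a tangent
    vector. Its coefficients c can be read off in the frame, provided that the real
    part mW is tangent to the quadric, and this is the equation balance. *)
Lemma Phi_self_similar p : U p ->
  mean_curvature Phi p = alpha%:C *: normal_part Phi p (Phi p).
Proof.
move=> Up.
have Q := quad Up; have T := tang Up; have RG := reg Up.
have w0 := weight_gt0 al_gt0 Q.
have [ddX ddXE] : exists ddX : 'I_n -> 'I_n -> 'I_n -> R,
    forall k a b, ddX k a b = partial a (fun q => dX q b k) p by eexists.
have [dds ddsE] : exists dds : 'I_n -> 'I_n -> R,
    forall a b, dds a b = partial a (fun q => ds q b) p by eexists.
pose kx k := kap k * x p k.
pose mW k := tr p (ddX k) - kap k * kx k * (A ^+ 2 * weight al (x p))^-1 - alpha * x p k.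
pose D := tr p dds.
have tdd : tr p (fun a b => ds p a * ds p b) = (A ^+ 2 * weight al (x p))^-1.
  exact: trace_ds_ds al_gt0 lam_sq A_gt0 Q T RG.
have tXs k : tr p (fun a b => dX p a k * ds p b) = 0.
  exact: trace_dX_ds al_gt0 lam_sq A_gt0 Q T RG k.
have tsX k : tr p (fun a b => dX p b k * ds p a) = 0.
  rewrite -[RHS](tXs k) /tr.
  transitivity (\sum_a \sum_b invmx (g p) a b * (ds p a * dX p b k)).
    by apply: eq_bigr => a _; apply: eq_bigr => b _; congr (_ * _); exact: mulrC.
  rewrite !(frame_trace al_gt0 lam_sq A_gt0 Q T RG).
  by apply: eq_bigr => l _; congr (_ / _); exact: mulrC.
have tXX k : tr p (fun a b => dX p a k * dX p b k) =
    (al k)^-1 - x p k ^+ 2 / (al k ^+ 2 * weight al (x p)).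
  exact: trace_dX_dX al_gt0 lam_sq A_gt0 Q T RG k.
have traceE : \sum_a \sum_b (invmx (gram Phi p) a b)%:C *: Cpartial a (Cpartial b Phi) p
     - alpha%:C *: Phi p = framed p mW (fun k => - (kx k * D)).
  rewrite Phi_gram // -/(g p) pair_bigA /=.
  under eq_bigr => ab _ do rewrite Phi_partial2 //.
  rewrite (framed_comb p _ (fun ab => invmx (g p) ab.1 ab.2)) PhiE framed_sub.
  apply: framed_ext => k.
    rewrite -(tr_pair p (fun a b => partial a (fun q => dX q b k) p - kap k ^+ 2 * x p k * (ds p a * ds p b))).
    rewrite (@tr_ext p _ (fun a b => ddX k a b + - (kap k * kx k) * (ds p a * ds p b))) => [|a b].
      by rewrite trD trZ tdd /mW mulNr.
    rewrite ddXE /kx; move: (partial a _ p) (ds p a) (ds p b) (x p k) (kap k)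
      => z d d' y c; ring.
  rewrite mulr0 subr0.
  rewrite -(tr_pair p (fun a b => - (kap k * (dX p a k * ds p b + dX p b k * ds p a + x p k * partial a (fun q => ds q b) p)))).
  rewrite (@tr_ext p _ (fun a b => - kap k * (dX p a k * ds p b) +
      (- kap k * (dX p b k * ds p a) + - kx k * dds a b))) => [|a b].
    by rewrite !trD !trZ tXs tsX !mulr0 !add0r mulNr.
  rewrite ddsE /kx; move: (partial a _ p) (ds p a) (ds p b) (x p k) (kap k) (dX p a k) (dX p b k)
    => z d d' y c e e'; ring.
have normal0 : \sum_k lam k * x p k * mW k = 0.
  have -> : \sum_k lam k * x p k * mW k =
      \sum_k lam k * x p k * tr p (ddX k)
      - \sum_k lam k * x p k ^+ 2 / (al k ^+ 2 * weight al (x p))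
      - alpha * \sum_k lam k * x p k ^+ 2.
    rewrite mulr_sumr -!sumrB; apply: eq_bigr => k _; rewrite /mW /kx /rate.
    transitivity (lam k * x p k * tr p (ddX k)
       - lam k ^+ 2 * (lam k * x p k ^+ 2 / (al k ^+ 2 * weight al (x p)))
       - alpha * (lam k * x p k ^+ 2)); last by rewrite lam_sq mul1r.
    move: (tr p _) (x p k) (weight _ _) (al k) (lam k) w0 (al_gt0 k) => t y W a c W0 a0.
    by field; rewrite !gt_eqF.
  have -> : \sum_k lam k * x p k * tr p (ddX k) =
      - \sum_k lam k * tr p (fun a b => dX p a k * dX p b k).
    apply/eqP; rewrite -subr_eq0 opprK -big_split /=; apply/eqP.
    transitivity (\sum_k tr p (fun a b => lam k * (dX p a k * dX p b k + x p k * ddX k a b))).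
      apply: eq_bigr => k _; rewrite trZ trD trZ.
      by move: (tr p _) (tr p _) => t t'; ring.
    rewrite -tr_sum (@tr_ext p _ (fun a b => 0 * 0)) ?trZ ?mul0r // => a b.
    rewrite ?mul0r -[RHS](tang2 Up a b); apply: eq_bigr => k _.
    by rewrite ddXE.
  rewrite Q mulr1.
  have -> : \sum_k lam k * tr p (fun a b => dX p a k * dX p b k) =
      \sum_k lam k / al k - \sum_k lam k * x p k ^+ 2 / (al k ^+ 2 * weight al (x p)).
    by rewrite -sumrB; apply: eq_bigr => k _; rewrite tXX mulrBr mulrA.
  have := balance; move: (\sum_k lam k / _) (\sum_k lam k * _ / _) => t t'; lra.
pose Cf := invmx (frame lam al A (x p) (dX p) (ds p)).
pose c b := \sum_k (mW k + kx k * D) * Cf k b.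
have slope0 : \sum_k mW k * slope lam al A (x p) k = 0.
  transitivity ((\sum_k lam k * x p k * mW k) / (A * weight al (x p))); last first.
    by rewrite normal0 mul0r.
  rewrite mulr_suml; apply: eq_bigr => k _; rewrite /slope; move: (mW k) (x p k) (_ * weight _ _) => t y W; ring.
have mslope : \sum_k (mW k + kx k * D) * slope lam al A (x p) k = D.
  transitivity (\sum_k mW k * slope lam al A (x p) k + D * \sum_k kx k * slope lam al A (x p) k).
    rewrite mulr_sumr -big_split; apply: eq_bigr => k _ /=.
    by move: (mW k) (kx k) (slope _ _ _ _ _) => t y W; ring.
  by rewrite slope0 add0r (rate_slope al_gt0 lam_sq A_gt0 Q) mulr1.
have cds : \sum_b c b * ds p b = D.
  rewrite -[RHS]mslope; under eq_bigr do rewrite mulr_suml.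
  rewrite exchange_big; apply: eq_bigr => k _ /=.
  rewrite -(coframe_ds al_gt0 lam_sq A_gt0 Q T RG) mulr_sumr.
  by apply: eq_bigr => b _; rewrite mulrA.
have cdX k : \sum_b c b * dX p b k = mW k.
  under eq_bigr do rewrite mulr_suml.
  rewrite exchange_big /=.
  transitivity (\sum_l (mW l + kx l * D) * ((l == k)%:R - kx k * slope lam al A (x p) l)).
    apply: eq_bigr => l _; rewrite -(coframe_dX al_gt0 lam_sq A_gt0 Q T RG) mulr_sumr.
    by apply: eq_bigr => b _; rewrite mulrA.
  transitivity (\sum_l (l == k)%:R * (mW l + kx l * D) -
                kx k * \sum_l (mW l + kx l * D) * slope lam al A (x p) l).
    rewrite mulr_sumr -sumrB; apply: eq_bigr => l _.
    by move: (_ + _) (slope _ _ _ _ _) (_%:R) (kx k) => t W e y; ring.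
  rewrite mslope (bigD1 k) //= eqxx mul1r big1 ?addr0 ?addrK // => l lk.
  by rewrite (negPf lk) mul0r.
have tangentE : framed p mW (fun k => - (kx k * D)) = \sum_b (c b)%:C *: Cpartial b Phi p.
  under [RHS]eq_bigr do rewrite Phi_partial //.
  rewrite framed_comb; apply: framed_ext => k; first by rewrite cdX.
  rewrite -[in LHS]cds mulr_sumr -sumrN; apply: eq_bigr => b _.
  by rewrite /kx; move: (c b) (ds p b) (kap k) (x p k) => t d y z; ring.
have mcE : mean_curvature Phi p =
    normal_part Phi p (\sum_a \sum_b (invmx (gram Phi p) a b)%:C *: Cpartial a (Cpartial b Phi) p).
  rewrite normal_part_sum; apply: eq_bigr => a _; rewrite normal_part_sum.
  by apply: eq_bigr => b _; rewrite normal_part_scale.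
have := normal_part_tangent c Up; rewrite -tangentE -traceE normal_part_add -mcE.
have -> : - (alpha%:C *: Phi p) = (- alpha)%:C *: Phi p by rewrite rmorphN scaleNr.
rewrite normal_part_scale rmorphN scaleNr => /eqP; rewrite subr_eq0 => /eqP.
by [].
Qed.


Let fr_unit p : U p -> fr p \in unitmx.
Proof. by move=> Up; apply: frame_unit => //; [exact: quad|exact: tang|exact: reg]. Qed.

Let det_fr_neq0 p : U p -> \det (fr p) != 0.
Proof. by move=> /fr_unit; rewrite unitmxE unitfE. Qed.

Lemma Phi_vol p : U p -> vol Phi p = A * `|\det (fr p)|.
Proof.
move=> Up; rewrite /vol Phi_gram // det_frame_gram //; last exact: tang.
by rewrite product -exprMn sqrtr_sqr normrM mulrC ger0_norm // ltW.
Qed.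

(** The product of the w_k contributes i A e^{i theta} and the frame contributes
    -i times a real number; so the Lagrangian angle is theta, up to pi. *)
Lemma det_Cjacobian p : U p ->
  \det (Cjacobian Phi p) = (A * \det (fr p))%:C * expi (th0 + alpha * A * sig p).
Proof.
move=> Up.
have -> : Cjacobian Phi p = (\matrix_(a, k) (dX p a k +i* - (kap k * x p k * ds p a))) *m
    diag_mx (\row_k w k (sig p)).
  apply/matrixP => a k; rewrite mul_mx_diag !mxE /= mulrC.
  by have /rowP/(_ k) := Phi_partial a Up; rewrite !mxE => ->.
rewrite det_mulmx det_diag (det_complex_frame (ds p) al_gt0 lam_sq A_gt0 (quad Up) (tang Up)).
under eq_bigr do rewrite mxE.
rewrite wprod -/(fr p) rmorphM /=.
have i2 : 'i * 'i = -1 :> R[i] by rewrite -expr2 sqr_i.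
transitivity (- ('i * 'i) * (A%:C * (\det (fr p))%:C * expi (th0 + alpha * A * sig p)) : R[i]).
  ring.
by rewrite i2 opprK mul1r.
Qed.

Let fr_det_continuous p : U p -> {for p, continuous (fun q => \det (fr q))}.
Proof.
move=> Up; apply: continuous_det => a k.
have -> : (fun q => fr q a k) = (fun q => dX q a k + kap k * x q k * ds q a).
  by apply: funext => q; rewrite mxE.
apply: continuousD; first exact: smooth_continuous (smooth_partial a (sX k)) Up.
apply: continuousM; last exact: smooth_continuous (smooth_partial a sS) Up.
by apply: continuousM; [exact: cst_continuous|exact: smooth_continuous (sX k) Up].
Qed.

Let K := \sum_k kap k.

(* The matrix of partial derivatives of the functions e^{kap_k sig} x_k. *)
Let J q : 'M[R]_n := \matrix_(a, l) (expR (kap l * sig q) * (dX q a l + kap l * x q l * ds q a)).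

Let J_frame q : J q = fr q *m diag_mx (\row_l expR (kap l * sig q)).
Proof. by apply/matrixP => a l; rewrite mul_mx_diag !mxE mulrC. Qed.

Let J_der p : U p -> exists dJ : 'I_n -> 'I_n -> 'I_n -> R,
  (forall c a l, is_derive p (e_ c) (fun q => J q a l) (dJ c a l)) /\
  (forall c a l, dJ c a l = dJ a c l).
Proof.
move=> Up.
exists (fun c a l => expR (kap l * sig p) * (kap l * ds p c * dX p a l + kap l * ds p a * dX p c l +
  kap l ^+ 2 * x p l * ds p c * ds p a + partial c (fun q => dX q a l) p +
  kap l * x p l * partial c (fun q => ds q a) p)); split=> [c a l|c a l].
  have H1 := der_expR (der_mulc (kap l) (sD c Up)).
  have H2 := der_add (dXD c a l Up) (der_mul (der_mulc (kap l) (xD c l Up)) (dsD c a Up)).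
  apply: der_ext (der_eq (der_mul H1 H2) _) => [q|]; first by rewrite mxE.
  move: (expR _) => E.
  move: (partial c (fun q => dX q a l) p) (partial c (fun q => ds q a) p) (ds p a) (ds p c) (dX p a l)
    (dX p c l) (x p l) (kap l) => z z' d d' e e' y k; ring.
have s1 : partial c (fun q => dX q a l) p = partial a (fun q => dX q c l) p.
  exact: clairaut c a oU (sX l) Up.
have s2 : partial c (fun q => ds q a) p = partial a (fun q => ds q c) p.
  exact: clairaut c a oU sS Up.
rewrite s1 s2; move: (expR _) => E.
move: (partial a (fun q => dX q c l) p) (partial a (fun q => ds q c) p) (ds p a) (ds p c) (dX p a l)
  (dX p c l) (x p l) (kap l) => z z' d d' e e' y k; ring.
Qed.

Let J_cofactor p a l : U p -> cofactor (J p) a l =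
  \det (fr p) * expR (K * sig p) * expR (- kap l * sig p) * invmx (fr p) l a.
Proof.
move=> Up.
pose Dm := diag_mx (\row_l expR (- kap l * sig p)).
have DJ : Dm *m invmx (fr p) *m J p = 1%:M.
  rewrite J_frame -mulmxA mulKmx ?fr_unit // mulmx_diag -diag_const_mx.
  congr diag_mx; apply/rowP => k; rewrite !mxE -expRD mulNr addNr expR0 //.
have : \adj (J p) = \det (J p) *: (Dm *m invmx (fr p)).
  rewrite -[LHS]mul1mx -DJ -!mulmxA mul_mx_adj !mulmxA mul_mx_scalar //.
move/(congr1 (fun M : 'M[R]_n => M l a)); rewrite [\adj _ l a]mxE => ->.
have -> : \det (J p) = \det (fr p) * expR (K * sig p).
  rewrite J_frame det_mulmx det_diag; congr (_ * _).
  by under eq_bigr do rewrite mxE; rewrite -expR_sum -mulr_suml.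
by rewrite [LHS]mxE -!mulrA; do 2 congr (_ * _); rewrite /Dm mul_diag_mx !mxE.
Qed.

Let z q l := kap l * expR ((kap l - K) * sig q) * x q l * (weight al (x q))^-1.

(** Up to sign and a constant, the density times the gradient of sig is a
    combination of cofactors of J. *)
Let gradient_density p a : U p ->
  \det (fr p) * (A ^+ 2 * \sum_b invmx (gram Phi p) a b * ds p b) =
  \sum_l cofactor (J p) a l * z p l.
Proof.
move=> Up; rewrite Phi_gram //.
rewrite (gradient_ds al_gt0 lam_sq A_gt0 (quad Up) (tang Up) (reg Up)) mulrA mulr_sumr.
have w0 := weight_gt0 al_gt0 (quad Up).
apply: eq_bigr => l _; rewrite J_cofactor // /z /slope -/(fr p) -/(x p l).
have -> : expR ((kap l - K) * sig p) = (expR (K * sig p) * expR (- kap l * sig p))^-1.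
  by rewrite -expRD -expRN; congr expR; ring.
have E0 : expR (K * sig p) * expR (- kap l * sig p) != 0.
  by rewrite mulf_neq0 // gt_eqF // expR_gt0.
move: E0; rewrite mulf_eq0 negb_or => /andP[E1 E2]; have a0 := lt0r_neq0 (al_gt0 l).
move: (expR (K * _)) (expR (- kap l * _)) E1 E2 => E E' E1 E2.
move: (invmx _ l a) (\det _) (x p l) (weight _ _) w0 => C D y W W0.
by rewrite /rate; field; rewrite ?E1 ?E2 ?a0 ?(gt_eqF A_gt0) ?(gt_eqF W0).
Qed.

Let weight_der p a : U p ->
  is_derive p (e_ a) (fun q => weight al (x q)) (\sum_j 2 * x p j * dX p a j / al j).
Proof.
move=> Up.
have H := der_sum (fun j => der_mul (der_exp 2 (xD a j Up)) (der_cst p (e_ a) (al j)^-1)).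
apply: der_eq H _; apply: eq_bigr => j _.
by rewrite /= expr1; move: (dX p a j) (x p j) => d y; ring.
Qed.

(** The flow of sum_l kap_l Y_l d/dY_l is the symmetry s -> s + t of L, so it fixes
    every x_j, and the divergence of the gradient of sig vanishes. *)
Let divergence_free p : U p ->
  \sum_a partial a (fun q => \sum_l cofactor (J q) a l * z q l) p = 0.
Proof.
move=> Up; have w0 := weight_gt0 al_gt0 (quad Up).
have Q := quad Up; have T := tang Up; have RG := reg Up.
have [dJ [dJD dJs]] := J_der Up.
have Ju : J p \in unitmx.
  rewrite J_frame unitmx_mul fr_unit //= unitmxE det_diag unitfE.
  by apply/prodf_neq0 => l _; rewrite mxE gt_eqF // expR_gt0.
have [dc dcE] : exists dc : 'I_n -> 'I_n -> R,
    forall a l, dc a l = partial a (fun q => cofactor (J q) a l) p by eexists.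
have cofD a l : is_derive p (e_ a) (fun q => cofactor (J q) a l) (dc a l).
  by rewrite dcE; apply/derivableP; exact: (derivable_cofactor (M := J) (fun i j => dJD a i j)).
pose W := weight al (x p).
pose dW a := \sum_j 2 * x p j * dX p a j / al j.
pose E l := expR ((kap l - K) * sig p).
pose dz a l := kap l * E l * ((kap l - K) * ds p a * x p l / W + dX p a l / W - x p l / W ^+ 2 * dW a).
have zD a l : is_derive p (e_ a) (fun q => z q l) (dz a l).
  have H1 := der_mulc (kap l) (der_expR (der_mulc (kap l - K) (sD a Up))).
  have H2 := der_inv (f := fun q => weight al (x q)) (lt0r_neq0 w0) (weight_der a Up).
  apply: der_eq (der_mul (der_mul H1 (xD a l Up)) H2) _.
  rewrite /dz -/(dW a) -/(E l) /W; move: (weight al (x p)) w0 (dW a) (ds p a) (dX p a l) (x p l) (E l)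
    => W' W0 d d' e y E'; field; rewrite gt_eqF //.
have step a : partial a (fun q => \sum_l cofactor (J q) a l * z q l) p =
    \sum_l (dc a l * z p l + cofactor (J p) a l * dz a l).
  by have [_] := der_sum (fun l => der_mul (cofD a l) (zD a l)).
under eq_bigr => a _ do rewrite step big_split /=.
rewrite big_split /= exchange_big /= [X in X + _]big1 ?add0r; last first.
  move=> l _; rewrite -mulr_suml; under eq_bigr do rewrite dcE.
  by rewrite (piola l dJD dJs Ju) mul0r.
rewrite exchange_big /=.
pose C := invmx (fr p).
pose kx l := kap l * x p l.
have EE l : expR (K * sig p) * expR (- kap l * sig p) * E l = 1.
  by rewrite /E -!expRD -[RHS]expR0; congr expR; ring.
transitivity (\det (fr p) * \sum_l kap l * ((kap l - K) * x p l / W * \sum_a C l a * ds p a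
    + (\sum_a C l a * dX p a l) / W - x p l / W ^+ 2 * \sum_a C l a * dW a)).
  rewrite mulr_sumr; apply: eq_bigr => l _.
  rewrite mulr_suml !mulr_sumr -big_split -sumrB !mulr_sumr; apply: eq_bigr => a _ /=.
  rewrite J_cofactor // -/C /dz -[LHS]mul1r -{1}[1]divr1.
  transitivity ((expR (K * sig p) * expR (- kap l * sig p) * E l) * (\det (fr p) * (kap l *
    ((kap l - K) * x p l / W * (C l a * ds p a) + C l a * dX p a l / W - x p l / W ^+ 2 * (C l a * dW a))))).
    rewrite divr1 mul1r; move: (expR (K * _)) (expR (- kap l * _)) (E l) => e1 e2 e3.
    move: (\det _) (C l a) (ds p a) (dX p a l) (x p l) (dW a) (kap l) K
      => D c d d' y v k K'; ring.
  by rewrite EE mul1r.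
have CdX l j : \sum_a C l a * dX p a j = (l == j)%:R - kx j * slope lam al A (x p) l.
  exact: coframe_dX al_gt0 lam_sq A_gt0 Q T RG l j.
have Cds l : \sum_a C l a * ds p a = slope lam al A (x p) l.
  exact: coframe_ds al_gt0 lam_sq A_gt0 Q T RG l.
have ks : \sum_l kx l * slope lam al A (x p) l = 1 by exact: rate_slope al_gt0 lam_sq A_gt0 Q.
have fixX j : \sum_l kx l * \sum_a C l a * dX p a j = 0.
  under eq_bigr do rewrite CdX mulrBr.
  rewrite sumrB (bigD1 j) //= eqxx mulr1 big1 ?addr0 => [|l lj]; last first.
    by rewrite (negPf lj) mulr0.
  rewrite (_ : \sum_l _ = kx j * \sum_l kx l * slope lam al A (x p) l); first by rewrite ks mulr1 subrr.
  by rewrite mulr_sumr; apply: eq_bigr => l _; rewrite mulrCA.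
have fixW : \sum_l kx l * \sum_a C l a * dW a = 0.
  transitivity (\sum_j 2 * x p j / al j * \sum_l kx l * \sum_a C l a * dX p a j); last first.
    by apply: big1 => j _; rewrite fixX mulr0.
  under [RHS]eq_bigr do rewrite mulr_sumr.
  rewrite exchange_big; apply: eq_bigr => l _ /=.
  under [RHS]eq_bigr do rewrite mulrCA mulr_sumr.
  rewrite -mulr_sumr; congr (_ * _); rewrite exchange_big; apply: eq_bigr => a _ /=.
  rewrite /dW mulr_sumr; apply: eq_bigr => j _.
  by move: (C l a) (x p j) (dX p a j) => c y d; ring.
have -> : \sum_l kap l * ((kap l - K) * x p l / W * \sum_a C l a * ds p a
    + (\sum_a C l a * dX p a l) / W - x p l / W ^+ 2 * \sum_a C l a * dW a) =
    (K - K * \sum_l kx l * slope lam al A (x p) l) / W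
    - (\sum_l kx l * \sum_a C l a * dW a) / W ^+ 2.
  have -> : K - K * \sum_l kx l * slope lam al A (x p) l =
      \sum_l (kap l - K * (kx l * slope lam al A (x p) l)) by rewrite mulr_sumr sumrB.
  rewrite !mulr_suml -sumrB; apply: eq_bigr => l _.
  rewrite Cds CdX eqxx /= mulr1n /kx.
  by move: (slope _ _ _ _ _) (\sum_a C l a * dW a) (x p l) (kap l) K => t v y k K'; ring.
by rewrite ks fixW mulr1 subrr !mul0r subrr mulr0.
Qed.

(** The angle is an affine function of sig, and the gradient of sig is divergence
    free. The sign eps of det (fr p) selects the orientation, and V is the region
    where this sign does not change. *)
Lemma Phi_stationary p : U p ->
  exists (V : set 'rV[R]_n) (ang : 'rV[R]_n -> R),
      [/\ open V, V p, V `<=` U, lagrangian_angle Phi V ang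
        & forall q, V q -> laplacian Phi ang q = 0].
Proof.
move=> Up; pose eps := Num.sg (\det (fr p)).
have eps2 : eps * eps = 1 by rewrite -expr2 sqr_sg det_fr_neq0.
pose V := [set q | U q /\ 0 < eps * \det (fr q)].
pose c0 := th0 + (if 0 < \det (fr p) then 0 else pi).
pose ang q := c0 + alpha * A * sig q.
have VU : V `<=` U by move=> q [].
have oV : open V.
  rewrite openE => q [Uq dq]; apply: (@filterS2 _ (nbhs q) _ _ _ _ _ (near_open oU Uq)).
    by move=> t Ut dt; split; [exact: Ut|exact: dt].
  have c : {for q, continuous (fun q => eps * \det (fr q))}.
    by apply: continuousM; [exact: cst_continuous|exact: fr_det_continuous].
  exact: (cvgr_gt _ c).
have sV : smooth_on V sig by move=> l q /VU; exact: sS.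
have eps_abs q : V q -> `|\det (fr q)| = eps * \det (fr q).
  by move=> [Uq dq]; rewrite -[RHS]ger0_norm ?ltW // normrM normr_sg det_fr_neq0 // mul1r.
have expi_eps q : expi (ang q) = eps%:C * expi (th0 + alpha * A * sig q) :> R[i].
  rewrite (_ : ang q = (if 0 < \det (fr p) then 0 else pi) + (th0 + alpha * A * sig q)).
    rewrite (expiD (if _ then _ else _)); congr (_ * _).
    rewrite /eps; case: ltP => d0; first by rewrite gtr0_sg // expi0.
    have d1 : \det (fr p) < 0 by rewrite lt_neqAle det_fr_neq0.
    by rewrite ltr0_sg // /expi cospi sinpi; apply: complex_ext.
  by rewrite /ang /c0 addrAC addrC.
exists V, ang; split=> //.
- by split=> //; rewrite /eps -normrEsg normr_gt0 det_fr_neq0.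
- split; first exact: smooth_affine.
  move=> q Vq; have Uq := VU q Vq; rewrite det_Cjacobian // Phi_vol // eps_abs // expi_eps.
  have -> : (A * (eps * \det (fr q)))%:C = eps%:C * (A * \det (fr q))%:C :> R[i].
    by rewrite -rmorphM /= mulrCA.
  transitivity ((eps * eps)%:C * ((A * \det (fr q))%:C * expi (th0 + alpha * A * sig q)) : R[i]).
    by rewrite eps2 mul1r.
  by rewrite rmorphM /=; ring.
move=> q Vq; have Uq := VU q Vq.
rewrite /laplacian (_ : \sum_a _ = 0) ?mulr0 //.
have flux a : partial a (fun q => vol Phi q * \sum_b invmx (gram Phi q) a b * partial b ang q) q =
    eps * alpha * partial a (fun q => \sum_l cofactor (J q) a l * z q l) q.
  rewrite (partial_eq_on a oV Vq (g := fun q => eps * alpha * \sum_l cofactor (J q) a l * z q l)).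
    have [dJ [dJD _]] := J_der Uq.
    have zd l : derivable (fun q => z q l) q (e_ a).
      have w0 := weight_gt0 al_gt0 (quad Uq).
      have H1 := der_mulc (kap l) (der_expR (der_mulc (kap l - K) (sD a Uq))).
      have H2 := der_inv (f := fun q => weight al (x q)) (lt0r_neq0 w0) (weight_der a Uq).
      by have [] := der_mul (der_mul H1 (xD a l Uq)) H2.
    have cd l : derivable (fun q => cofactor (J q) a l) q (e_ a).
      exact: (derivable_cofactor (M := J) (fun i j => dJD a i j)).
    have H := der_sum (fun l => der_mul (derivableP (cd l)) (derivableP (zd l))).
    have [_ E1] := H; have [_ E2] := der_mulc (eps * alpha) H.
    by rewrite /partial E2 E1.
  move=> t Vt; have Ut := VU t Vt.
  rewrite -gradient_density // Phi_vol // eps_abs //.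
  have dang b : partial b ang t = alpha * A * ds t b.
    have [_ E] := der_add (der_cst t (e_ b) c0) (der_mulc (alpha * A) (sD b Ut)).
    by rewrite /partial E add0r.
  rewrite (_ : \sum_b _ = alpha * A * \sum_b invmx (gram Phi t) a b * ds t b).
    by move: (\sum_b _) (\det _) => S D; ring.
  by rewrite mulr_sumr; apply: eq_bigr => b _; rewrite dang mulrCA.
under eq_bigr do rewrite flux.
by rewrite -mulr_sumr divergence_free // mulr0.
Qed.

End ResonantGeometry.

(** * One-parameter groups of diagonal matrices *)

Section DiagonalFlow.
Context {R : realType} {n : nat}.
Variable b : 'I_n -> R.
Implicit Types s t : R.

Lemma norm_expi t : `|expi t| = 1 :> R[i].
Proof. by rewrite normc_def /= cos2Dsin2 sqrtr1. Qed.

Lemma unit_is_expi (z : R[i]) : `|z| = 1 -> exists t, z = expi t.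
Proof.
case: z => x y; rewrite normc_def /= => -[] /(congr1 (fun r => r ^+ 2)).
rewrite sqr_sqrtr ?addr_ge0 ?sqr_ge0 // expr1n => xy1.
have x1 : -1 <= x <= 1.
  by rewrite -ler_norml -(@ler_pXn2r _ 2) ?nnegrE // expr1n real_normK ?num_real // -xy1 lerDl sqr_ge0.
have s : sin (acos x) = `|y|.
  by rewrite sin_acos // -xy1 addrAC subrr add0r sqrtr_sqr.
have c : cos (acos x) = x by rewrite acosK // in_itv.
have [y0|y0] := leP 0 y.
  by exists (acos x); rewrite /expi c s ger0_norm.
by exists (- acos x); rewrite /expi cosN sinN c s ltr0_norm // opprK.
Qed.

Lemma expi_neq1 t : 0 < t < pi *+ 2 -> expi t <> 1 :> R[i].
Proof.
move=> /andP[t0 t2] [c s].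
have [tp|] := ltP t pi.
  by have := sin_gt0_pi (x := t); rewrite t0 tp s ltxx => /(_ isT).
rewrite le_eqVlt => /orP[/eqP tp|pt].
  by move: c; rewrite -tp cospi => /eqP; rewrite -subr_eq0 -opprD oppr_eq0 paddr_eq0 ?oner_eq0 ?ler01.
have := sin_gt0_pi (x := t - pi); rewrite subr_gt0 pt ltrBlDr -mulr2n t2 => /(_ isT).
by have := sinDpi (t - pi); rewrite subrK s => /eqP; rewrite eq_sym oppr_eq0 => /eqP ->; rewrite ltxx.
Qed.

Lemma expi2pi : expi (pi *+ 2) = 1 :> R[i].
Proof. by rewrite /expi cos2pi sin2pi. Qed.

(** Divide t by T with remainder; the remainder lies in P. *)
Lemma least_generates (P : R -> Prop) T : (forall s t, P s -> P t -> P (s - t)) ->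
  0 < T -> P T -> (forall t, 0 < t < T -> ~ P t) ->
  forall t, P t -> exists m : int, t = m%:~R * T.
Proof.
move=> PB T0 PT least t Pt.
have P0 : P 0 by have := PB _ _ PT PT; rewrite subrr.
have PN s : P s -> P (- s) by move=> Ps; have := PB _ _ P0 Ps; rewrite sub0r.
have PnT (k : nat) : P (k%:R * T).
  elim: k => [|k IH]; first by rewrite mul0r.
  by have := PB _ _ IH (PN _ PT); rewrite opprK -natr1 mulrDl mul1r.
have PmT (m : int) : P (m%:~R * T).
  case: m => k; first exact: PnT.
  by rewrite NegzE mulrNz mulNr; apply: PN; exact: PnT.
exists (Num.floor (t / T)).
have /andP[f1 f2] := floor_itv (t / T).
set m := Num.floor _ in f1 f2 *.
have r0 : 0 <= t - m%:~R * T by rewrite subr_ge0 -ler_pdivlMr.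
have r1 : t - m%:~R * T < T.
  by rewrite ltrBlDl -{2}[T]mul1r -mulrDl -ltr_pdivrMr // -[X in _ < _ + X](mulr1z 1) -intrD.
apply/eqP; rewrite -subr_eq0; apply/negPn/negP => rn0.
apply: (least (t - m%:~R * T)); last exact: PB.
by rewrite r1 andbT lt_neqAle eq_sym rn0.
Qed.

Lemma expi_eq1 t : expi t = 1 :> R[i] -> exists m : int, t = m%:~R * (pi *+ 2).
Proof.
apply: (least_generates (P := fun t => expi t = 1 :> R[i])).
- by move=> s r es er; rewrite expiD es mul1r -expiJ er conjc1.
- by rewrite pmulrn_lgt0 // pi_gt0.
- exact: expi2pi.
- exact: expi_neq1.
Qed.

Lemma expi_int (m : int) : expi (m%:~R * (pi *+ 2)) = 1 :> R[i].
Proof.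
have N (k : nat) : expi (k%:R * (pi *+ 2)) = 1 :> R[i].
  elim: k => [|k IH]; first by rewrite mul0r expi0.
  by rewrite -natr1 mulrDl mul1r expiD IH expi2pi mulr1.
case: m => k; first exact: N.
by rewrite NegzE mulrNz mulNr -expiJ N conjc1.
Qed.

Lemma flowD s t : diag_flow b (s + t) = diag_flow b s *m diag_flow b t.
Proof.
rewrite /diag_flow mulmx_diag; congr diag_mx; apply/rowP => j.
by rewrite !mxE mulrDr expiD.
Qed.

Lemma flow0 : diag_flow b 0 = 1%:M.
Proof.
rewrite /diag_flow -diag_const_mx; congr diag_mx; apply/rowP => j.
by rewrite !mxE mulr0 expi0.
Qed.

Lemma flow_inv t : invmx (diag_flow b t) = diag_flow b (- t).
Proof.
have E : diag_flow b (- t) *m diag_flow b t = 1%:M by rewrite -flowD addNr flow0.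
have [_ u] := mulmx1_unit E.
by rewrite -[RHS](mulmxK u) E mul1mx.
Qed.

Lemma flow_unitary t : diag_flow b t \is unitarymx.
Proof.
apply/unitarymxP; have -> : ((diag_flow b t) ^t* )%sesqui = diag_flow b (- t).
  apply/matrixP => i j; rewrite !mxE eq_sym.
  have [->|_] := eqVneq i j; last by rewrite !mulr0n rmorph0.
  by rewrite !mulr1n mulrN -expiJ.
by rewrite -flowD subrr flow0.
Qed.

Lemma flow_subgroup : subgroup_of_Un (range (diag_flow b)).
Proof.
split.
- by move=> _ [t _ <-]; exact: flow_unitary.
- by exists 0 => //; exact: flow0.
- by move=> _ _ [s _ <-] [t _ <-]; exists (s + t) => //; exact: flowD.
- by move=> _ [t _ <-]; exists (- t) => //; rewrite flow_inv.
Qed.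

Lemma flow_continuous (c : R) : Ccontinuous_mx (fun t => diag_flow b (c * t)).
Proof.
move=> j k.
have [->|jk] := eqVneq j k; last first.
  by split=> t; rewrite (_ : (fun t => _) = cst 0) ?/cst //; first [exact: cst_continuous |
     apply: funext => r; rewrite /diag_flow !mxE (negPf jk) mulr0n].
have lin (t : R) : is_derive t 1 (fun t => b k * (c * t)) (b k * (c * 1)).
  exact: der_mulc (der_mulc c (is_derive_id t 1)).
split=> t.
  have -> : (fun t => Rpart (diag_flow b (c * t) k k)) = (fun t => cos (b k * (c * t))).
    by apply: funext => r; rewrite /diag_flow !mxE eqxx mulr1n.
  exact: der_continuous1 (der_cos (lin t)).
have -> : (fun t => Ipart (diag_flow b (c * t) k k)) = (fun t => sin (b k * (c * t))).
  by apply: funext => r; rewrite /diag_flow !mxE eqxx mulr1n.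
exact: der_continuous1 (der_sin (lin t)).
Qed.

Hypothesis b_neq0 : exists j, b j != 0.

(** If b_j <> 0, no time between 0 and pi / |b_j| acts trivially; hence the times
    that do are isolated, and the infimum of the positive ones is attained. *)
Lemma flow_period : (forall t, diag_flow b t = 1%:M -> t = 0) \/
  exists2 T, 0 < T & diag_flow b T = 1%:M /\
    (forall t, 0 < t < T -> diag_flow b t <> 1%:M).
Proof.
have [inj|] := pselect (forall t, diag_flow b t = 1%:M -> t = 0); first by left.
move=> /existsNP[t0 /not_implyP[ft0 t00]]; right.
have fN t : diag_flow b t = 1%:M -> diag_flow b (- t) = 1%:M.
  by move=> ft; rewrite -flow_inv ft invmx1.
have [j bj] := b_neq0.
pose d := pi / `|b j|.
have bj0 : 0 < `|b j| by rewrite normr_gt0.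
have d0 : 0 < d by rewrite divr_gt0 // pi_gt0.
have gap t : 0 < t < d -> diag_flow b t <> 1%:M.
  move=> /andP[t1 td] ft; have := congr1 (fun M : 'M[R[i]]_n => M j j) ft.
  rewrite /diag_flow !mxE eqxx !mulr1n => e1.
  have [h|h] := ltP 0 (b j).
    apply: (expi_neq1 _ e1); rewrite mulr_gt0 //=.
    have : b j * t < pi by rewrite mulrC -ltr_pdivlMr // -(gtr0_norm h).
    by have := @pi_gt0 R; rewrite mulr2n; lra.
  have h' : b j < 0 by rewrite lt_neqAle bj.
  apply: (@expi_neq1 (- (b j * t))); last by rewrite -expiJ e1 conjc1.
  rewrite -mulNr mulr_gt0 ?oppr_gt0 //=.
  have : - b j * t < pi by rewrite mulrC -ltr_pdivlMr ?oppr_gt0 // -(ltr0_norm h').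
  by have := @pi_gt0 R; rewrite mulr2n; lra.
pose P := [set t | 0 < t /\ diag_flow b t = 1%:M].
have P0 : P !=set0.
  have [h|h|h] := ltgtP t0 0; last by rewrite h in t00.
    by exists (- t0); split; [rewrite oppr_gt0|exact: fN].
  by exists t0.
have Pinf : has_inf P by split=> //; exists 0 => t [/ltW].
have [t1 [t10 ft1] t1d] := inf_adherent d0 Pinf.
have lb t : P t -> inf P <= t by move=> Pt; apply: inf_lbound => //; case: Pinf.
exists t1 => //; split=> // t /andP[tp tt1] ft.
apply: (gap (t1 - t)); last by rewrite flowD ft1 mul1mx fN.
by rewrite subr_gt0 tt1 /=; have := lb t (conj tp ft); lra.
Qed.

(** If the flow is not injective it factors through the circle, and its least
    period T corresponds to the full turn 2 pi. *)
Lemma flow_isomorphic : isomorphic_to_R (range (diag_flow b)) \/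
  isomorphic_to_U1 (range (diag_flow b)).
Proof.
have [inj|[T T0 [fT least]]] := flow_period.
  left; exists (diag_flow b); split=> //.
  - move=> j k; have [c1 c2] := flow_continuous 1 j k.
    by split; [move: c1|move: c2]; under eq_fun do rewrite mul1r.
  - exact: flowD.
  - move=> s t e; apply/eqP; rewrite -subr_eq0; apply/eqP/inj.
    by rewrite flowD e -flowD subrr flow0.
right.
have p20 : pi *+ 2 != 0 :> R by rewrite mulrn_eq0 /= gt_eqF // pi_gt0.
have Tn0 := lt0r_neq0 T0.
pose c := T / (pi *+ 2).
have mult t : diag_flow b t = 1%:M -> exists m : int, t = m%:~R * T.
  apply: (least_generates (P := fun t => diag_flow b t = 1%:M)) => //.
  by move=> s r es er; rewrite flowD es mul1mx -flow_inv er invmx1.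
have fm (m : int) : diag_flow b (m%:~R * T) = 1%:M.
  have fk (k : nat) : diag_flow b (k%:R * T) = 1%:M.
    elim: k => [|k IH]; first by rewrite mul0r flow0.
    by rewrite -natr1 mulrDl mul1r flowD IH fT mul1mx.
  case: m => k; first exact: fk.
  by rewrite NegzE mulrNz mulNr -flow_inv fk invmx1.
have wd s t : expi s = expi t :> R[i] -> diag_flow b (c * s) = diag_flow b (c * t).
  move=> e; have /expi_eq1 [m mE] : expi (s - t) = 1 :> R[i].
    by rewrite expiD e -expiD subrr expi0.
  have -> : c * s = m%:~R * T + c * t.
    rewrite -[s](subrK t) mE mulrDr; congr (_ + _).
    by rewrite /c mulrCA divfK.
  by rewrite flowD fm mul1mx.
have [arg argE] : exists arg : R[i] -> R, forall z, `|z| = 1 -> expi (arg z) = z.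
  have : forall z : R[i], exists t, `|z| = 1 -> expi t = z.
    move=> z; have [/unit_is_expi [t ->]|nz] := pselect (`|z| = 1); first by exists t.
    by exists 0.
  by move=> /choice [arg argP]; exists arg.
pose f z := diag_flow b (c * arg z).
have fE t : f (expi t) = diag_flow b (c * t).
  by apply: wd; rewrite argE // norm_expi.
exists f; split.
- have -> : (fun t => f (expi t)) = (fun t => diag_flow b (c * t)) by apply: funext.
  exact: flow_continuous.
- move=> z z' /unit_is_expi [s ->] /unit_is_expi [t ->].
  by rewrite -expiD !fE mulrDr flowD.
- move=> z z' /unit_is_expi [s ->] /unit_is_expi [t ->]; rewrite !fE => e.
  have /mult [m mE] : diag_flow b (c * (s - t)) = 1%:M.
    by rewrite mulrBr flowD e -flowD subrr flow0.
  have st : s - t = m%:~R * (pi *+ 2).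
    have cn0 : c != 0 by rewrite mulf_neq0 ?invr_eq0.
    by apply: (mulfI cn0); rewrite mE /c mulrCA divfK.
  by rewrite -[s](subrK t) st expiD expi_int mul1r.
- apply/seteqP; split=> [_ [z /= z1 <-]|_ [t _ <-]]; first by exists (c * arg z).
  exists (expi (c^-1 * t)) => /=; first exact: norm_expi.
  by rewrite fE mulrA divff ?mul1r // mulf_neq0 ?invr_eq0.
Qed.

End DiagonalFlow.

(** * Symmetry of the submanifold and the theorem *)

(** The flow at time t moves the point with parameters (x, s) to (x, s - t / A). *)
Lemma L_invariant {R : realType} {n : nat} (lam b psi r : 'I_n -> R) (A : R)
  (w : 'I_n -> R -> R[i]) : A != 0 ->
  (forall j s, w j s = (r j)%:C * expi (psi j - b j * A * s)) ->
  invariant_under (range (diag_flow b)) (L_set setT lam 1 w).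
Proof.
move=> A0 wE _ [t _ <-].
have move_s x s : L_map w x s *m diag_flow b t = L_map w x (s - t / A).
  apply/rowP => j; rewrite mul_mx_diag !mxE !wE -!mulrA -expiD.
  by congr (_ * (_ * expi _)); field.
apply/seteqP; split=> [_ [_ [x [s [qx _ ->]]] <-]|_ [x [s [qx _ ->]]]].
  by exists x, (s - t / A).
exists (L_map w x (s + t / A)); first by exists x, (s + t / A).
by rewrite move_s addrK.
Qed.

Theorem theoremE (R : realType) (n : nat) (lam : 'I_n -> R) (C alpha A : R)
    (hn : (1 <= n)%N)
    (hcase : case_a lam C alpha A \/ case_b lam C A) :
  (* every solution on an open interval extends to the real line *)
  (forall (I : set R) (s0 : R) (w : 'I_n -> R -> R[i]) (theta : R -> R)
      (phi : 'I_n -> R -> R),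
    open I -> is_interval I -> I s0 ->
    solution I lam alpha w theta ->
    polar_lift I w phi ->
    first_integral I lam alpha w theta phi s0 A ->
    exists (w' : 'I_n -> R -> R[i]) (theta' : R -> R) (phi' : 'I_n -> R -> R),
      [/\ solution setT lam alpha w' theta',
          polar_lift setT w' phi',
          first_integral setT lam alpha w' theta' phi' s0 A
        & forall s, I s ->
            (forall j, w' j s = w j s /\ phi' j s = phi j s) /\
            theta' s = theta s])
  /\
  (forall (s0 : R) (w : 'I_n -> R -> R[i]) (theta : R -> R)
      (phi : 'I_n -> R -> R),
    solution setT lam alpha w theta ->
    polar_lift setT w phi ->
    first_integral setT lam alpha w theta phi s0 A ->
    let al := alphas w s0 in
    let u := ufun w theta phi s0 in
    let L := L_set setT lam C w in
    let G := range (diag_flow (fun j => lam j / al j)) in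
    [/\ (* case (i) *)
        case_i lam alpha w s0 A ->
          [/\ exists psi : 'I_n -> R,
                let wexp (j : 'I_n) (s : R) : R[i] :=
                  (Num.sqrt (al j))%:C
                  * expi (psi j - lam j * A * s / al j) in
                [/\ forall j s, w j s = wexp j s,
                    forall s, theta s = theta 0 + alpha * A * s
                  & L = [set z | exists (x : 'rV[R]_n) (s : R),
                           \sum_j lam j * x 0 j ^+ 2 = 1 /\
                           z = \row_j ((x 0 j)%:C * wexp j s)]],
              hamiltonian_stationary (L_params setT lam C w),
              self_similar (L_params setT lam C w),
              subgroup_of_Un G /\ (isomorphic_to_R G \/ isomorphic_to_U1 G)
            & invariant_under G L],
        (* case (ii) *)
        ~ case_i lam alpha w s0 A ->
          exists (S : R) (gamma : 'I_n -> R),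
            [/\ 0 < S,
                forall s, phi_sum phi (s + S) - theta (s + S)
                          = phi_sum phi s - theta s,
                forall s,
                  [/\ u (s + S) = u s,
                      forall j, phi j (s + S) = phi j s + gamma j,
                      phi_sum phi (s + S) = phi_sum phi s + \sum_j gamma j
                    & theta (s + S) = theta s + \sum_j gamma j]
              & case_b lam C A -> alpha = 0 -> \sum_j gamma j = 0]
      & case_b lam C A -> alpha = 0 -> forall s, theta s = theta 0]).
Proof.
have lam2 := case_lam_sq hcase.
have A0 := case_A_gt0 hcase.
have C1 := case_C hcase.
split=> [I s0 w theta phi oI itvI Is0 sol pol fi|s0 w theta phi sol pol fi al u L G].
  exact: (extend_solution hn hcase oI itvI Is0 sol pol fi).
have al_gt0 j : 0 < al j by exact: (al_pos s0 sol j).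
split=> [ci|nci|_ a0]; last 2 first.
- exact: (periodic_motion hn hcase sol pol fi nci).
- exact: (theta_cst sol pol fi a0).
have wE j s := resonant_solution hn hcase sol pol fi ci j s.
have thE := resonant_theta hn hcase sol pol fi ci.
have wprod s := resonant_prod hn hcase sol pol fi ci s.
have [bal prd] := ci.
have wprod' s : \prod_j w j s = (A%:C * 'i) * expi (theta 0 + alpha * A * s).
  by rewrite wprod thE.
have params U Phi : L_params setT lam C w U Phi -> exists (X : 'rV[R]_n -> 'rV[R]_n) (sig : 'rV[R]_n -> R),
    [/\ open U, forall j, smooth_on U (fun p => X p 0 j), smooth_on U sig,
      forall p, U p -> \sum_j lam j * X p 0 j ^+ 2 = 1 &
      (forall p, U p -> row_free (row_mx (\matrix_(a, j) partial a (fun q => X q 0 j) p)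
                             (\col_a partial a sig p))) /\
      Phi = fun p => L_map w (X p) (sig p)].
  move=> [oU [X [sig [sX sS q reg ->]]]]; exists X, sig; split=> // p Up.
  by have [] := q p Up; rewrite /quadric /= C1.
have imm : immersed (L_params setT lam C w).
  move=> U Phi p /params [X [sig [oU sX sS q [reg ->]]]] Up.
  exact: (Phi_immersed al_gt0 lam2 A0 wE oU sX sS q reg Up).
split.
- exists (phi^~ 0) => wexp; split; [exact: wE|exact: thE|].
  apply/seteqP; split=> [z [x [s [qx _ ->]]]|z [x [s [qx ->]]]].
    exists x, s; split; first by rewrite -C1.
    by apply/rowP => j; rewrite !mxE wE.
  exists x, s; split=> //; first by rewrite /quadric /= C1.
  by apply/rowP => j; rewrite !mxE wE.
- split; first split=> // U Phi p a b /params [X [sig [oU sX sS q [reg ->]]]] Up.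
    exact: (Phi_omega al_gt0 wE oU sX sS q a b Up).
  move=> U Phi p /params [X [sig [oU sX sS q [reg ->]]]] Up.
  exact: (Phi_stationary al_gt0 lam2 A0 prd wE wprod' oU sX sS q reg Up).
- split=> //; exists alpha => U Phi p /params [X [sig [oU sX sS q [reg ->]]]] Up.
  exact: (Phi_self_similar al_gt0 lam2 A0 bal wE oU sX sS q reg Up).
- split; first exact: flow_subgroup.
  apply: flow_isomorphic; exists (Ordinal hn).
  apply: mulf_neq0; first exact: case_lam_neq0 hcase _.
  by rewrite invr_eq0 gt_eqF.
- rewrite /L C1; apply: (@L_invariant _ _ _ _ (phi^~ 0) (fun j => Num.sqrt (al j)) A).
    by rewrite gt_eqF.
  by move=> j s; rewrite wE; congr (_ * expi (_ - _)); rewrite /al; ring.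
Qed.
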